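(* Let $\mathbf v=(v_1,v_2)$ be the vector field on $\mathbf C^2$ given by $$v_1(x,y)=-\Bigl(\tfrac{\pi}{2}+i\log 2\Bigr)x^2+\Bigl(\tfrac{3\pi}{4}-\tfrac{i}{2}\log 2\Bigr)xy,\qquad v_2(x,y)=\Bigl(\tfrac{3\pi}{2}-i\log 2\Bigr)xy-\Bigl(\tfrac{5\pi}{4}+\tfrac{i}{2}\log 2\Bigr)y^2 ,$$ and let $\mathcal C=\{x=0\}\cup\{x=y\}\cup\{y=0\}$. The rotation number $\mathrm{Rot}:\mathbf C^2\setminus\mathcal C\to\mathbf R/\mathbf Z$ defined in the context is a well-defined continuous function, and it is constant along the real-time trajectories of $\mathbf v$.
   Context: Trajectories. A real-time trajectory of $\mathbf v$ is a maximal solution of $\gamma'(t)=\mathbf v(\gamma(t))$ on a sub-interval of $\mathbf R$. The affine surface $\mathcal S$. Let $\mathcal Q\subset\mathbf C$ be the quadrilateral with vertices $A=0$, $B=-i$, $C=2+i$, $D=i$ in this cyclic order ($A$ lies on the segment $[B,D]$, so as a set $\mathcal Q$ is the triangle $BCD$). Glue $[A,B]$ with $[B,C]$ by $z\mapsto -i+(2-2i)(z+i)$ (fixing $B$, sending $A$ to $C$) and $[A,D]$ with $[C,D]$ by $z\mapsto i+2i(z-i)$ (fixing $D$, sending $A$ to $C$). The result is a topological sphere carrying, outside its three singular points $A=C$, $B$, $D$, an atlas with complex affine changes of charts; call this affine surface $\mathcal S$. As a Riemann surface the sphere is identified with $\widehat{\mathbf C}$ so that $A=C$, $B$, $D$ correspond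 to $0,1,\infty$. A geodesic of $\mathcal S$ is a maximal curve avoiding the singular points which in affine charts has the form $t\mapsto at+b$, $a\neq0$. With this identification the map $g(x,y)=x/y$ sends trajectories of $\mathbf v$ in $\mathbf C^2\setminus\mathcal C$ to geodesics of $\mathcal S$ (known). One-dimensional maps. Let $\widetilde\theta=\pi/2-\arctan 2=\arctan(1/2)$. For $\theta\in\,]\widetilde\theta,\pi/4[$ put $s=2\tan\theta-1$ and $$T_\theta(x)=\frac{x}{16}+1-\frac{4\tan\theta-1}{16}\ \ (0\le x<s),\qquad T_\theta(x)=\frac{x-1}{16}+1-\frac{3\tan\theta+1}{4}\ \ (s\le x\le 1).$$ Let $\widetilde{T_\theta}:\mathbf R\to\mathbf R$ be given by $T_\theta(x)$ on $[0,s[$, $T_\theta(x)+1$ on $[s,1[$, and $\widetilde{T_\theta}(x+1)=\widetilde{T_\theta}(x)+1$. The limit $\lim_n\widetilde{T_\theta}^{\circ n}(x)/n$ exists and does not depend on $x$ (known); $\mathrm{rot}(\theta)\in\mathbf R/\mathbf Z$ is its class mod $1$. For $\theta\in[0,\widetilde\theta]\cup\{\pi/4\}$ put $\mathrm{rot}(\theta)=0$. Thus $\mathrm{rot}$ is a function on $[0,\pi/4]$ with equal values at $0$ and $\pi/4$, i.e. a function on $\mathbf R/\frac{\pi}{4}\mathbf Z$. Definition of $\mathrm{Rot}$. For $(x,y)\in\mathbf C^2\setminus\mathcal C$ let $\gamma$ be the trajectory with $\gamma(0)=(x,y)$ and $\delta=g\circ\gamma$ the corresponding geodesic of $\mathcal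 S$. Read in $\mathcal Q$, the velocity $\delta'(0)$ makes an angle $\theta$ with the positive real half-line. The gluings change angles by multiples of $\pi/4$, so only $\theta$ mod $\pi/4$ is meaningful. Put $\mathrm{Rot}(x,y)=\mathrm{rot}(\theta\bmod \pi/4)$.
   Formalization: The identification of the glued sphere with the Riemann sphere may reverse orientation: for the given field and quadrilateral, g sends trajectories to geodesics (taken as known) only for the orientation-reversing one; with a holomorphic one Rot would not be constant along trajectories. *)

(* Defs.v *)
(* Stdlib reals with Coquelicot. *)
From Stdlib Require Export Reals Relations Lra Lia.
From Coquelicot Require Export Coquelicot.

Open Scope R_scope.

(** ** The vector field *)

Definition v1 (x y : C) : C :=
  (- (RtoC (PI / 2) + Ci * RtoC (ln 2)) * (x * x)
   + (RtoC (3 * PI / 4) - Ci * RtoC (ln 2 / 2)) * (x * y))%C.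

Definition v2 (x y : C) : C :=
  ((RtoC (3 * PI / 2) - Ci * RtoC (ln 2)) * (x * y)
   - (RtoC (5 * PI / 4) + Ci * RtoC (ln 2 / 2)) * (y * y))%C.

Definition calC (m : C * C) : Prop :=
  fst m = RtoC 0 \/ fst m = snd m \/ snd m = RtoC 0.

Definition g (m : C * C) : C := (fst m / snd m)%C.

Definition open_interval (I : R -> Prop) : Prop :=
  open I /\ forall a b c, I a -> I c -> a <= b <= c -> I b.

(* A curve on [I] is a function on [R] of which only the values on [I] matter.
   Domains are taken open: that is automatic for a maximal solution. *)
Definition solution (I : R -> Prop) (gam : R -> C * C) : Prop :=
  open_interval I /\
  forall t, I t ->
    is_derive (K := R_AbsRing) (V := C_R_NormedModule)
      (fun s => fst (gam s)) t (v1 (fst (gam t)) (snd (gam t))) /\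
    is_derive (K := R_AbsRing) (V := C_R_NormedModule)
      (fun s => snd (gam s)) t (v2 (fst (gam t)) (snd (gam t))).

Definition trajectory (I : R -> Prop) (gam : R -> C * C) : Prop :=
  solution I gam /\
  forall J gam', solution J gam' ->
    (forall t, I t -> J t /\ gam' t = gam t) -> forall t, J t -> I t.

(** ** The affine surface *)

Definition ptA : C := (0, 0).
Definition ptB : C := (0, -1).
Definition ptC : C := (2, 1).
Definition ptD : C := (0, 1).

Definition calQ (z : C) : Prop :=
  exists b c d : R, 0 <= b /\ 0 <= c /\ 0 <= d /\ b + c + d = 1 /\
    z = (RtoC b * ptB + RtoC c * ptC + RtoC d * ptD)%C.

Definition seg (P P' z : C) : Prop :=
  exists l : R, 0 <= l <= 1 /\ z = (P + RtoC l * (P' - P))%C.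

Definition glueB (z : C) : C := (- Ci + (RtoC 2 - RtoC 2 * Ci) * (z + Ci))%C.
Definition glueD (z : C) : C := (Ci + RtoC 2 * Ci * (z - Ci))%C.

Definition glued (z w : C) : Prop :=
  (seg ptA ptB z /\ w = glueB z) \/ (seg ptA ptD z /\ w = glueD z).

(* Two points of [calQ] give the same point of the sphere. *)
Definition same_point : C -> C -> Prop := clos_refl_sym_trans C glued.

(* The Riemann sphere, [None] being the point at infinity. *)
Definition Chat : Type := option C.

Definition open_Chat (U : Chat -> Prop) : Prop :=
  open (fun z : C => U (Some z)) /\
  (U None -> exists M : R, forall z : C, M < Cmod z -> U (Some z)).

(* A point of the surface other than the singular ones, represented in [calQ]. *)
Definition regular (q : C) : Prop :=
  calQ q /\ q <> ptA /\ q <> ptB /\ q <> ptC /\ q <> ptD.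

(* [unfolds q w u]: in the affine chart centred at the regular point [q], the
   coordinate [w] (close to [q]) stands for the class of [u] in [calQ].  In the
   interior the chart is the identity; if [q] is on a side, the part of a
   neighbourhood of [q] lying outside [calQ] is carried into [calQ] by the
   gluing of that side.  On a side both rules apply and agree up to
   [same_point]. *)
Definition unfolds (q w u : C) : Prop :=
  calQ u /\
  (u = w \/
   (seg ptA ptB q /\ u = glueB w) \/ (seg ptB ptC q /\ w = glueB u) \/
   (seg ptA ptD q /\ u = glueD w) \/ (seg ptC ptD q /\ w = glueD u)).

(* Below, [p : C -> Chat] (only its values on [calQ] matter) is the quotient map
   from [calQ] to the glued sphere followed by the identification of the latter
   with [Chat].  [chart p q w z]: the point [z] of the plane has coordinate [w]
   in the affine chart centred at [q]; meaningful for [w] close to [q]. *)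
Definition chart (p : C -> Chat) (q w z : C) : Prop :=
  regular q /\ exists u, unfolds q w u /\ p u = Some z.

Definition holomorphic (p : C -> Chat) : Prop :=
  forall q, regular q -> exists (F : C -> C) (l : C),
    locally q (fun w => chart p q w (F w)) /\
    is_derive (K := C_AbsRing) (V := C_NormedModule) F q l.

Definition antiholomorphic (p : C -> Chat) : Prop :=
  forall q, regular q -> exists (F : C -> C) (l : C),
    locally q (fun w => chart p q w (F w)) /\
    is_derive (K := C_AbsRing) (V := C_NormedModule)
      (fun w => Cconj (F w)) q l.

(* The first three fields say that [p] induces a homeomorphism from the quotient
   space to the Riemann sphere.

   The last field allows both orientations, for the following reason.  Along
   trajectories z = x / y satisfies z'' = h(z) z'^2 with h rational; the affine
   charts phi for which phi(z(t)) is affine in t have multiplier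
   2^(-1/2) e^(5 i pi / 4) around z = 0, whereas the glued surface has
   multiplier (2 - 2i) / (2i) = 2^(1/2) e^(5 i pi / 4) around A = C; likewise
   the moduli are inverse to each other around the other two points.  Hence the
   identification through which trajectories correspond to geodesics reverses
   the orientation that the surface inherits from the plane. *)
Record identification (p : C -> Chat) : Prop := {
  id_onto : forall z : Chat, exists q, calQ q /\ p q = z;
  id_fibers : forall q q', calQ q -> calQ q' ->
    (p q = p q' <-> same_point q q');
  id_open : forall U : Chat -> Prop,
    open_Chat U <->
    exists V : C -> Prop, open V /\ forall q, calQ q -> (V q <-> U (p q));
  id_A : p ptA = Some (RtoC 0);
  id_B : p ptB = Some (RtoC 1);
  id_D : p ptD = None;
  id_conformal : holomorphic p \/ antiholomorphic p
}.

Definition geodesic_arc (p : C -> Chat) (I : R -> Prop) (del : R -> C) : Prop :=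
  open_interval I /\
  forall t0, I t0 -> exists q a b : C, a <> RtoC 0 /\
    (RtoC t0 * a + b)%C = q /\
    locally t0 (fun t => chart p q (RtoC t * a + b)%C (del t)).

Definition geodesic (p : C -> Chat) (I : R -> Prop) (del : R -> C) : Prop :=
  geodesic_arc p I del /\
  forall J del', geodesic_arc p J del' ->
    (forall t, I t -> J t /\ del' t = del t) -> forall t, J t -> I t.

Definition sends_trajectories_to_geodesics (p : C -> Chat) : Prop :=
  forall I gam, trajectory I gam -> (forall t, I t -> ~ calC (gam t)) ->
    geodesic p I (fun t => g (gam t)).

(* [a] is the velocity of [del] at time [t0], read in the chart centred at a
   representative [q] of [del t0] in [calQ]. *)
Definition velocity_in_Q
    (p : C -> Chat) (del : R -> C) (t0 : R) (q a : C) : Prop :=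
  exists c : R -> C, c t0 = q /\
    locally t0 (fun t => chart p q (c t) (del t)) /\
    is_derive (K := R_AbsRing) (V := C_R_NormedModule) c t0 a.

Definition has_angle (a : C) (theta : R) : Prop :=
  a <> RtoC 0 /\ a = (Cmod a * cos theta, Cmod a * sin theta).

(** ** The circle R/Z *)

Definition Zcoset (r : R) : R -> Prop := fun s => exists k : Z, s = r + IZR k.

Record RZ : Type := mkRZ {
  coset : R -> Prop;
  coset_spec : exists r, coset = Zcoset r
}.

Definition class_mod1 (r : R) : RZ := mkRZ (Zcoset r) (ex_intro _ r eq_refl).

Definition RZ_ball (X : RZ) (eps : R) (Y : RZ) : Prop :=
  exists x y, coset X x /\ coset Y y /\ Rabs (y - x) < eps.

Lemma RZ_ball_center (X : RZ) (e : posreal) : RZ_ball X e X.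
Proof.
destruct X as [X [r ->]]; exists r, r; simpl.
assert (H : Zcoset r r) by (exists 0%Z; simpl; ring).
repeat split; trivial.
rewrite Rminus_diag, Rabs_R0; apply cond_pos.
Qed.

Lemma RZ_ball_sym (X Y : RZ) (e : R) : RZ_ball X e Y -> RZ_ball Y e X.
Proof.
intros [x [y [Hx [Hy H]]]]; exists y, x; repeat split; trivial.
now rewrite Rabs_minus_sym.
Qed.

Lemma RZ_ball_triangle (X Y Z : RZ) (e1 e2 : R) :
  RZ_ball X e1 Y -> RZ_ball Y e2 Z -> RZ_ball X (e1 + e2) Z.
Proof.
intros [x [y [Hx [Hy H1]]]] [y' [z [Hy' [Hz H2]]]].
destruct Y as [Y [r ->]], Z as [Z [s ->]]; simpl in *.
destruct Hy as [k ->], Hy' as [k' ->], Hz as [m ->].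
exists x, (s + IZR (m + k - k')); split; [trivial | split].
- now exists (m + k - k')%Z.
- rewrite minus_IZR, plus_IZR.
  replace (s + (IZR m + IZR k - IZR k') - x)
    with ((r + IZR k - x) + (s + IZR m - (r + IZR k'))) by ring.
  eapply Rle_lt_trans; [apply Rabs_triang | lra].
Qed.

Definition RZ_UniformSpace_mixin : UniformSpace.mixin_of RZ :=
  UniformSpace.Mixin RZ (class_mod1 0) RZ_ball
    RZ_ball_center RZ_ball_sym RZ_ball_triangle.

Canonical RZ_UniformSpace : UniformSpace :=
  UniformSpace.Pack RZ RZ_UniformSpace_mixin RZ.

(** ** Rotation numbers *)

Definition theta_tilde : R := PI / 2 - atan 2.

Definition s_of (theta : R) : R := 2 * tan theta - 1.

Definition T (theta x : R) : R :=
  if Rlt_dec x (s_of theta)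
  then x / 16 + 1 - (4 * tan theta - 1) / 16
  else (x - 1) / 16 + 1 - (3 * tan theta + 1) / 4.

Definition Ttilde (theta x : R) : R :=
  let y := frac_part x in
  IZR (Int_part x) +
  (if Rlt_dec y (s_of theta) then T theta y else T theta y + 1).

(* The value of rot at a point of [0, pi/4]. *)
Definition is_rot (theta : R) (rho : RZ) : Prop :=
  (theta_tilde < theta < PI / 4 /\
   exists r : R, rho = class_mod1 r /\
     forall x : R,
       is_lim_seq (fun n => Nat.iter n (Ttilde theta) x / INR n) (Finite r))
  \/
  ((0 <= theta <= theta_tilde \/ theta = PI / 4) /\ rho = class_mod1 0).

Definition is_rot_mod (theta : R) (rho : RZ) : Prop :=
  exists k : Z, 0 <= theta - IZR k * (PI / 4) <= PI / 4 /\
    is_rot (theta - IZR k * (PI / 4)) rho.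

(* [is_Rot p m rho]: some choice of trajectory, representative in [calQ] and
   angle leads from the point [m] to the value [rho]. *)
Definition is_Rot (p : C -> Chat) (m : C * C) (rho : RZ) : Prop :=
  exists (I : R -> Prop) (gam : R -> C * C) (q a : C) (theta : R),
    trajectory I gam /\ I 0 /\ gam 0 = m /\
    velocity_in_Q p (fun t => g (gam t)) 0 q a /\
    has_angle a theta /\ is_rot_mod theta rho.

(* Main.v *)
(* The generalized inverse of the lift of T_theta is a continuous, monotone, degree-one map,
   Lipschitz uniformly in theta, and depends uniformly continuously on tan theta; hence its
   rotation number exists and is uniformly continuous in theta, and it is an integer at both
   ends of the interval, so that it descends to the circle of angles mod pi/4.

   Since the projection x / y of a trajectory has velocity d(x,y) = 2 pi x (y - x) / y, and the
   identification is (anti)conformal, the angle of its velocity mod pi/4 depends on the initial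
   point m only, and multiplying m by lambda rotates it by + or - arg lambda.  It is locally
   constant along a trajectory, which is affine in charts, hence constant.

   Continuity: the solution starting at m0 is a power series with geometrically bounded
   coefficients (the field is quadratic), so it makes sense for small complex times s.  As
   x / y moves with nonzero complex velocity, every point m1 near m0 equals, up to a factor mu
   close to 1, the value of this solution at some small s; equivalently, the real trajectory
   from s m0 is at s mu m1 at time 1.  Constancy along that trajectory and the behaviour under
   scaling give that the angles at m0 and m1 differ by arg mu. *)
Require Import Defs.
From Stdlib Require Import ZArith ClassicalEpsilon FunctionalExtensionality
  PropExtensionality ProofIrrelevance.

(** * Rotation numbers *)

(** Two obstacles shape the proof. The lift [Ttilde] jumps, and the places of its jumps move with
    theta, so its iterates cannot be compared uniformly for nearby theta. Its left inverse fills the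
    jumps with constant pieces and can be; the price is a sign, rot being minus the rotation number
    [rho] of the inverse. Secondly, conformality gives only a derivative at the centre of each
    chart. Reading continuity of the angle directly from the charts would require that this
    derivative varies continuously, that is, some Cauchy theory. Angles are therefore compared in
    two situations only: for two curves through the same point of the surface, where the unknown
    derivative cancels, and along one geodesic, which is affine in charts. Scaling provides the
    former, trajectories the latter, and the passage between nearby initial points is built from
    these two alone. *)

Definition monotone (h : R -> R) : Prop := forall x y, x <= y -> h x <= h y.
Definition degree_one (h : R -> R) : Prop := forall x, h (x + 1) = h x + 1.

Lemma Int_part_bounds (x : R) : IZR (Int_part x) <= x < IZR (Int_part x) + 1.
Proof. destruct (base_Int_part x); lra. Qed.

Lemma Int_part_eq (x : R) (k : Z) : IZR k <= x < IZR k + 1 -> Int_part x = k.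
Proof.
intros H; assert (H' := Int_part_bounds x).
assert (H1 : (Int_part x < k + 1)%Z) by (apply lt_IZR; rewrite plus_IZR; lra).
assert (H2 : (k < Int_part x + 1)%Z) by (apply lt_IZR; rewrite plus_IZR; lra).
lia.
Qed.

Lemma degree_one_nat (h : R -> R) : degree_one h ->
  forall n x, h (x + INR n) = h x + INR n.
Proof.
intros Hd; induction n as [|n IH]; intros x.
- simpl; rewrite !Rplus_0_r; reflexivity.
- rewrite S_INR; replace (x + (INR n + 1)) with (x + INR n + 1) by ring.
  rewrite Hd, IH; ring.
Qed.

Lemma degree_one_Z (h : R -> R) : degree_one h ->
  forall k x, h (x + IZR k) = h x + IZR k.
Proof.
intros Hd k x; destruct (Z.le_gt_cases 0 k) as [Hk0 | Hk0].
- rewrite <- (Z2Nat.id k), <- INR_IZR_INZ by lia; apply degree_one_nat, Hd.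
- assert (Hk : IZR k = - INR (Z.to_nat (- k))).
  { rewrite INR_IZR_INZ, Z2Nat.id, opp_IZR by lia; ring. }
  rewrite Hk; set (n := Z.to_nat (- k)).
  assert (H := degree_one_nat h Hd n (x + - INR n)).
  replace (x + - INR n + INR n) with x in H by ring; lra.
Qed.

Lemma iter_monotone (h : R -> R) : monotone h -> forall n, monotone (Nat.iter n h).
Proof. intros Hm n; induction n as [|n IH]; intros x y H; simpl; auto. Qed.

Lemma iter_degree_one (h : R -> R) : degree_one h -> forall n, degree_one (Nat.iter n h).
Proof.
intros Hd n; induction n as [|n IH]; intros x; simpl; [reflexivity|].
now rewrite IH, Hd.
Qed.

(** The displacement is 1-periodic, and going up from y to the next integer translate of x costs at
    most one unit by monotonicity. *)
Lemma displacement_le (h : R -> R) : monotone h -> degree_one h ->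
  forall x y, h y - y <= h x - x + 1.
Proof.
intros Hm Hd x y; set (k := Int_part (y - x)).
assert (Hk := Int_part_bounds (y - x)); fold k in Hk.
assert (H : h y <= h (x + IZR (k + 1))) by (apply Hm; rewrite plus_IZR; lra).
rewrite (degree_one_Z h Hd), plus_IZR in H; lra.
Qed.

Lemma iter_mul (h : R -> R) (n m : nat) (x : R) :
  Nat.iter (m * n) h x = Nat.iter m (Nat.iter n h) x.
Proof.
induction m as [|m IH]; [reflexivity|].
change (S m * n)%nat with (n + m * n)%nat; rewrite Nat.iter_add, IH; reflexivity.
Qed.

Lemma displacement_iter (h : R -> R) : monotone h -> degree_one h ->
  forall m, Rabs (Nat.iter m h 0 - INR m * h 0) <= INR m.
Proof.
intros Hm Hd m; induction m as [|m IH].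
- simpl; rewrite Rmult_0_l, Rminus_0_r, Rabs_R0; lra.
- rewrite S_INR; simpl.
  assert (H1 := displacement_le h Hm Hd 0 (Nat.iter m h 0)).
  assert (H2 := displacement_le h Hm Hd (Nat.iter m h 0) 0).
  apply Rabs_le_between in IH; apply Rabs_le_between; lra.
Qed.

(** With d n = h^n(0), [displacement_iter] applied to the n-th iterate puts d(mn)/(mn) within 1/n of
    d(n)/n, and by symmetry within 1/m of d(m)/m. So the intervals [(d n - 1)/n, (d n + 1)/n] meet
    pairwise, and the supremum of their left ends lies in all of them. Passing from 0 to x costs one
    more unit, whence the bound 2. *)
Lemma rotation_number (h : R -> R) : monotone h -> degree_one h ->
  {rho : R | forall n x, Rabs (Nat.iter n h x - x - INR n * rho) <= 2}.
Proof.
intros Hm Hd.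
set (d := fun n => Nat.iter n h 0).
assert (Hd1 : forall n m, Rabs (d (m * n)%nat - INR m * d n) <= INR m).
{ intros n m; unfold d; rewrite iter_mul.
  apply displacement_iter; [apply iter_monotone | apply iter_degree_one]; assumption. }
assert (Hcmp : forall n m, (0 < n)%nat -> (0 < m)%nat ->
  (d n - 1) / INR n <= (d m + 1) / INR m).
{ intros n m Hn Hm0; apply lt_INR in Hn; apply lt_INR in Hm0; simpl in Hn, Hm0.
  assert (H1 := Hd1 n m); assert (H2 := Hd1 m n).
  rewrite Nat.mul_comm in H2.
  apply Rabs_le_between in H1; apply Rabs_le_between in H2.
  apply Rmult_le_reg_r with (INR n); [lra|]; apply Rmult_le_reg_r with (INR m); [lra|].
  replace ((d n - 1) / INR n * INR n * INR m) with (INR m * d n - INR m) by (field; lra).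
  replace ((d m + 1) / INR m * INR n * INR m) with (INR n * d m + INR n) by (field; lra).
  lra. }
destruct (completeness (fun r => exists n, (0 < n)%nat /\ r = (d n - 1) / INR n))
  as [rho [Hub Hlub]].
- exists ((d 1%nat + 1) / INR 1); intros r [n [Hn ->]]; apply Hcmp; [exact Hn | lia].
- exists ((d 1%nat - 1) / INR 1), 1%nat; split; [lia | reflexivity].
- exists rho; intros n x.
  destruct n as [|n].
  { simpl; rewrite Rmult_0_l, Rminus_0_r, Rminus_diag, Rabs_R0; lra. }
  assert (Hn : 0 < INR (S n)) by (apply lt_0_INR; lia).
  assert (H1 : (d (S n) - 1) / INR (S n) <= rho).
  { apply Hub; exists (S n); split; [lia | reflexivity]. }
  assert (H2 : rho <= (d (S n) + 1) / INR (S n)).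
  { apply Hlub; intros r [k [Hk ->]]; apply Hcmp; [exact Hk | lia]. }
  apply Rmult_le_compat_r with (r := INR (S n)) in H1; [|lra].
  apply Rmult_le_compat_r with (r := INR (S n)) in H2; [|lra].
  unfold Rdiv in H1, H2; rewrite Rmult_assoc, Rinv_l, Rmult_1_r in H1, H2 by lra.
  assert (Hm' := iter_monotone h Hm (S n)); assert (Hd' := iter_degree_one h Hd (S n)).
  assert (H3 := displacement_le _ Hm' Hd' 0 x); assert (H4 := displacement_le _ Hm' Hd' x 0).
  unfold d in H1, H2; apply Rabs_le_between; lra.
Qed.


(** * The inverse lift and its dependence on tan theta *)

Fixpoint geom_sum (L : R) (n : nat) : R :=
  match n with O => 0 | S k => 1 + L * geom_sum L k end.

Lemma geom_sum_nonneg (L : R) (n : nat) : 0 <= L -> 0 <= geom_sum L n.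
Proof. intros HL; induction n; simpl; [lra | nra]. Qed.

Lemma iter_close (h1 h2 : R -> R) (L e : R) : 0 <= L ->
  (forall x y, Rabs (h1 x - h1 y) <= L * Rabs (x - y)) ->
  (forall x, Rabs (h1 x - h2 x) <= e) ->
  forall n x, Rabs (Nat.iter n h1 x - Nat.iter n h2 x) <= geom_sum L n * e.
Proof.
intros HL HLip He n x; induction n as [|n IH]; simpl.
- rewrite Rminus_diag, Rabs_R0; lra.
- set (a := Nat.iter n h1 x) in *; set (b := Nat.iter n h2 x) in *.
  replace (h1 a - h2 b) with ((h1 a - h1 b) + (h1 b - h2 b)) by ring.
  eapply Rle_trans; [apply Rabs_triang|].
  assert (H1 := HLip a b); assert (H2 := He b).
  assert (H3 := Rmult_le_compat_l L _ _ HL IH); lra.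
Qed.

Lemma clamp_between (lo hi x y : R) : lo <= hi -> x <= y ->
  0 <= Rmax lo (Rmin y hi) - Rmax lo (Rmin x hi) <= y - x.
Proof.
intros H1 H2; unfold Rmax, Rmin; repeat destruct Rle_dec; lra.
Qed.

(* [inv_cell t] maps the two branches of [T] back; with [alpha t = Ttilde 0] and
   [gap t = Ttilde s - Ttilde 0], the map [inv_lift t] below is the continuous
   monotone left inverse of [Ttilde], constant over its jumps. *)
Definition alpha (t : R) : R := 1 - (4 * t - 1) / 16.
Definition gap (t : R) : R := (9 - 6 * t) / 16.
Definition inv_cell (t v : R) : R :=
  Rmax 0 (Rmin (16 * v) (2 * t - 1)) + Rmax 0 (Rmin (16 * (v - gap t)) (2 - 2 * t)).
Definition inv_lift (t y : R) : R :=
  IZR (Int_part (y - alpha t)) + inv_cell t (frac_part (y - alpha t)).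

(** Each of the two clamped branches has slope 0 or 16. The branches never rise simultaneously, but
    adding the two bounds is good enough. *)
Lemma inv_cell_between (t v w : R) : 1 / 2 <= t <= 1 -> v <= w ->
  0 <= inv_cell t w - inv_cell t v <= 32 * (w - v).
Proof.
intros Ht H; unfold inv_cell.
assert (H1 := clamp_between 0 (2 * t - 1) (16 * v) (16 * w)).
assert (H2 := clamp_between 0 (2 - 2 * t) (16 * (v - gap t)) (16 * (w - gap t))).
lra.
Qed.

Lemma inv_cell_0 (t : R) : 1 / 2 <= t <= 1 -> inv_cell t 0 = 0.
Proof.
intros Ht; unfold inv_cell, gap, Rmax, Rmin; repeat destruct Rle_dec; lra.
Qed.

Lemma inv_cell_1 (t : R) : 1 / 2 <= t <= 1 -> inv_cell t 1 = 1.
Proof.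
intros Ht; unfold inv_cell, gap, Rmax, Rmin; repeat destruct Rle_dec; lra.
Qed.

Lemma inv_lift_between (t x y : R) : 1 / 2 <= t <= 1 -> x <= y ->
  0 <= inv_lift t y - inv_lift t x <= 32 * (y - x).
Proof.
intros Ht H; unfold inv_lift.
set (v := x - alpha t); set (w := y - alpha t).
assert (Hv := Int_part_bounds v); assert (Hw := Int_part_bounds w).
assert (Hvw : w - v = y - x) by (unfold v, w; ring).
rewrite <- Hvw; assert (Hle : v <= w) by lra.
clearbody v w; clear x y H Hvw.
unfold frac_part.
assert (H0 := inv_cell_0 t Ht); assert (H1 := inv_cell_1 t Ht).
set (k := Int_part v) in *; set (l := Int_part w) in *.
(* In different cells the path from v to w is cut at the end of the cell of v and at the start of
   that of w, where [inv_cell] is 1 and 0; every full cell in between gains exactly 1. *)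
destruct (Z.lt_ge_cases k l) as [Hkl | Hkl].
- assert (H2 := inv_cell_between t 0 (w - IZR l) Ht ltac:(lra)).
  assert (H3 := inv_cell_between t (v - IZR k) 1 Ht ltac:(lra)).
  assert (H4 : IZR k + 1 <= IZR l) by (rewrite <- plus_IZR; apply IZR_le; lia).
  lra.
- assert (Hlk : (l < k + 1)%Z \/ (k <= l)%Z) by lia.
  assert (H4 : IZR l <= IZR k) by (apply IZR_le; lia).
  assert (H5 : (k < l + 1)%Z) by (apply lt_IZR; rewrite plus_IZR; lra).
  assert (H6 : k = l) by lia.
  rewrite H6 in *.
  assert (H2 := inv_cell_between t (v - IZR l) (w - IZR l) Ht ltac:(lra)); lra.
Qed.

Lemma inv_lift_monotone (t : R) : 1 / 2 <= t <= 1 -> monotone (inv_lift t).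
Proof. intros Ht x y H; assert (H' := inv_lift_between t x y Ht H); lra. Qed.

Lemma inv_lift_lipschitz (t x y : R) : 1 / 2 <= t <= 1 ->
  Rabs (inv_lift t x - inv_lift t y) <= 32 * Rabs (x - y).
Proof.
intros Ht; destruct (Rle_dec x y) as [H | H].
- assert (H' := inv_lift_between t x y Ht H).
  rewrite (Rabs_left1 (x - y)) by lra; apply Rabs_le_between; lra.
- assert (H' := inv_lift_between t y x Ht ltac:(lra)).
  rewrite (Rabs_right (x - y)) by lra; apply Rabs_le_between; lra.
Qed.

Lemma inv_lift_eq (t y : R) (k : Z) : IZR k <= y - alpha t < IZR k + 1 ->
  inv_lift t y = IZR k + inv_cell t (y - alpha t - IZR k).
Proof.
intros H; unfold inv_lift, frac_part; now rewrite (Int_part_eq _ k H).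
Qed.

Lemma inv_lift_degree_one (t : R) : degree_one (inv_lift t).
Proof.
intros y; assert (H := Int_part_bounds (y - alpha t)); revert H.
set (k := Int_part (y - alpha t)); intros H.
rewrite (inv_lift_eq t y k H), (inv_lift_eq t (y + 1) (k + 1)) by (rewrite plus_IZR; lra).
rewrite plus_IZR.
replace (y + 1 - alpha t - (IZR k + 1)) with (y - alpha t - IZR k) by ring; ring.
Qed.

Lemma inv_lift_param (t u y : R) : 1 / 2 <= t <= 1 -> 1 / 2 <= u <= 1 ->
  Rabs (inv_lift t y - inv_lift u y) <= 20 * Rabs (t - u).
Proof.
intros Ht Hu.
assert (Hcell : forall v, Rabs (inv_cell t v - inv_cell u v) <= 12 * Rabs (t - u)).
{ intros v; unfold inv_cell, gap, Rmax, Rmin, Rabs.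
  repeat destruct Rle_dec; repeat destruct Rcase_abs; lra. }
(* [y'] has the same position in its cell for u as y has for t. The first difference then only
   changes the cell map (12), the second is a shift by (t - u) / 4 under the Lipschitz constant 32
   (8 more). *)
set (y' := y - alpha t + alpha u).
replace (inv_lift t y - inv_lift u y)
  with ((inv_lift t y - inv_lift u y') + (inv_lift u y' - inv_lift u y)) by ring.
eapply Rle_trans; [apply Rabs_triang|].
assert (H1 : Rabs (inv_lift t y - inv_lift u y') <= 12 * Rabs (t - u)).
{ unfold inv_lift.
  replace (y' - alpha u) with (y - alpha t) by (unfold y'; ring).
  set (v := y - alpha t).
  replace (IZR (Int_part v) + inv_cell t (frac_part v) -
    (IZR (Int_part v) + inv_cell u (frac_part v)))
    with (inv_cell t (frac_part v) - inv_cell u (frac_part v)) by ring.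
  apply Hcell. }
assert (H2 := inv_lift_lipschitz u y' y Hu).
replace (y' - y) with ((t - u) / 4) in H2 by (unfold y', alpha; field).
unfold Rdiv in H2; rewrite Rabs_mult, (Rabs_right (/ 4)) in H2 by lra.
lra.
Qed.

Lemma inv_lift_Ttilde (theta x : R) : 1 / 2 <= tan theta <= 1 ->
  inv_lift (tan theta) (Ttilde theta x) = x.
Proof.
intros Ht; unfold Ttilde, T, s_of, frac_part; set (t := tan theta) in *.
assert (Hx := Int_part_bounds x); set (k := Int_part x) in *.
destruct (Rlt_dec (x - IZR k) (2 * t - 1)).
- rewrite (inv_lift_eq _ _ k) by (unfold alpha; lra).
  unfold inv_cell, gap, alpha, Rmax, Rmin; repeat destruct Rle_dec; lra.
- rewrite (inv_lift_eq _ _ k) by (unfold alpha; lra).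
  unfold inv_cell, gap, alpha, Rmax, Rmin; repeat destruct Rle_dec; lra.
Qed.

(** The bounds are tan theta_tilde and tan (pi/4). Clamping makes [rho] total and constant on the
    angles below theta_tilde, where rot is 0 by convention. *)
Definition tclamp (t : R) : R := Rmax (1 / 2) (Rmin t 1).

Lemma tclamp_range (t : R) : 1 / 2 <= tclamp t <= 1.
Proof. unfold tclamp, Rmax, Rmin; repeat destruct Rle_dec; lra. Qed.

Lemma tclamp_lipschitz (t u : R) : Rabs (tclamp t - tclamp u) <= Rabs (t - u).
Proof.
unfold tclamp, Rmax, Rmin, Rabs; repeat destruct Rle_dec; repeat destruct Rcase_abs; lra.
Qed.

Definition rho (t : R) : R :=
  proj1_sig (rotation_number (inv_lift (tclamp t))
    (inv_lift_monotone _ (tclamp_range t)) (inv_lift_degree_one _)).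

Lemma rho_spec (t : R) (n : nat) (x : R) :
  Rabs (Nat.iter n (inv_lift (tclamp t)) x - x - INR n * rho t) <= 2.
Proof. unfold rho; destruct rotation_number as [r Hr]; simpl; apply Hr. Qed.

Lemma bounded_multiples (a c : R) : (forall n, Rabs (INR n * a) <= c) -> a = 0.
Proof.
intros H; apply Rabs_eq_0; destruct (Req_dec (Rabs a) 0) as [E | E]; [exact E|].
assert (Ha : 0 < Rabs a) by (assert (H' := Rabs_pos a); lra).
destruct (INR_archimed (Rabs a) c Ha) as [n Hn].
assert (H' := H n); rewrite Rabs_mult, (Rabs_right (INR n)) in H'
  by (apply Rle_ge, pos_INR).
nra.
Qed.

Lemma rho_of_periodic (t x : R) (k : Z) :
  inv_lift (tclamp t) x = x + IZR k -> rho t = IZR k.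
Proof.
intros H; cut (IZR k - rho t = 0); [lra|].
apply bounded_multiples with 2; intros n.
assert (Hn : Nat.iter n (inv_lift (tclamp t)) x = x + INR n * IZR k).
{ induction n as [|n IH]; [simpl; ring|].
  rewrite S_INR; simpl; rewrite IH.
  rewrite INR_IZR_INZ, <- mult_IZR, (degree_one_Z _ (inv_lift_degree_one _)), H, mult_IZR.
  ring. }
assert (H' := rho_spec t n x); rewrite Hn in H'.
replace (INR n * (IZR k - rho t)) with (x + INR n * IZR k - x - INR n * rho t) by ring.
exact H'.
Qed.

(** At t = 1/2 the first branch has shrunk to nothing, and the second has a fixed point on the
    circle: [Ttilde] sends 1/3 to 4/3. *)
Lemma rho_left (t : R) : t <= 1 / 2 -> rho t = -1.
Proof.
intros Ht; apply (rho_of_periodic t (4 / 3) (-1)).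
replace (tclamp t) with (1 / 2) by
  (unfold tclamp, Rmax, Rmin; repeat destruct Rle_dec; lra).
rewrite (inv_lift_eq _ _ 0) by (unfold alpha; lra).
unfold inv_cell, gap, alpha, Rmax, Rmin; repeat destruct Rle_dec; lra.
Qed.

(** At t = 1 only the first branch x / 16 + 13 / 16 remains; its fixed point is 13 / 15. *)
Lemma rho_right (t : R) : 1 <= t -> rho t = 0.
Proof.
intros Ht; apply (rho_of_periodic t (13 / 15) 0).
replace (tclamp t) with 1 by
  (unfold tclamp, Rmax, Rmin; repeat destruct Rle_dec; lra).
rewrite (inv_lift_eq _ _ 0) by (unfold alpha; lra).
unfold inv_cell, gap, alpha, Rmax, Rmin; repeat destruct Rle_dec; lra.
Qed.

(** By [rho_spec], n |rho t - rho u| is at most 2 + 2 plus the distance of the n-th iterates of 0.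
    First n is chosen with n eps > 5, then del so small that this distance is below 1. *)
Lemma rho_uniform (eps : R) : 0 < eps ->
  exists del, 0 < del /\ forall t u, Rabs (t - u) < del -> Rabs (rho t - rho u) < eps.
Proof.
intros He.
destruct (INR_archimed eps 5 He) as [n Hn].
assert (Hn0 : 0 < INR n) by nra.
assert (HS := geom_sum_nonneg 32 n ltac:(lra)); set (S := geom_sum 32 n) in *.
exists (/ (20 * (S + 1))); split; [apply Rinv_0_lt_compat; lra|].
intros t u H.
assert (Hcl := iter_close (inv_lift (tclamp t)) (inv_lift (tclamp u)) 32
  (20 * Rabs (t - u)) ltac:(lra)
  (fun x y => inv_lift_lipschitz _ x y (tclamp_range t))).
assert (Hp : forall x, Rabs (inv_lift (tclamp t) x - inv_lift (tclamp u) x)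
  <= 20 * Rabs (t - u)).
{ intros x; eapply Rle_trans; [apply inv_lift_param; apply tclamp_range|].
  assert (H' := tclamp_lipschitz t u); lra. }
specialize (Hcl Hp n 0); fold S in Hcl.
assert (H1 := rho_spec t n 0); assert (H2 := rho_spec u n 0).
assert (H3 : S * (20 * Rabs (t - u)) < 1).
{ assert (H' : Rabs (t - u) * (20 * (S + 1)) < 1).
  { apply Rmult_lt_reg_r with (/ (20 * (S + 1))); [apply Rinv_0_lt_compat; lra|].
    rewrite Rmult_assoc, Rinv_r by lra; lra. }
  assert (H'' := Rabs_pos (t - u)); nra. }
set (a := Nat.iter n (inv_lift (tclamp t)) 0) in *.
set (b := Nat.iter n (inv_lift (tclamp u)) 0) in *.
apply Rmult_lt_reg_l with (INR n); [exact Hn0|].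
rewrite <- (Rabs_right (INR n)) at 1 by lra; rewrite <- Rabs_mult.
apply Rle_lt_trans with 5; [|lra].
apply Rabs_le_between in H1; apply Rabs_le_between in H2; apply Rabs_le_between in Hcl.
apply Rabs_le_between; lra.
Qed.

(** [rho_spec] is used at the point Ttilde^n(x), which n steps of the left inverse bring back to x;
    this is where the sign comes from. *)
Lemma Ttilde_limit (theta x : R) : 1 / 2 <= tan theta <= 1 ->
  is_lim_seq (fun n => Nat.iter n (Ttilde theta) x / INR n) (Finite (- rho (tan theta))).
Proof.
intros Ht; set (t := tan theta) in *.
assert (Hc : tclamp t = t) by (unfold tclamp, Rmax, Rmin; repeat destruct Rle_dec; lra).
assert (Hinv : forall n y, Nat.iter n (inv_lift t) (Nat.iter n (Ttilde theta) y) = y).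
{ intros n; induction n as [|n IH]; intros y; [reflexivity|].
  rewrite Nat.iter_succ_r; simpl (Nat.iter (S n) (Ttilde theta) y).
  unfold t; rewrite inv_lift_Ttilde by exact Ht; apply IH. }
assert (Hb : forall n, Rabs (Nat.iter n (Ttilde theta) x + INR n * rho t) <= 2 + Rabs x).
{ intros n; assert (H := rho_spec t n (Nat.iter n (Ttilde theta) x)).
  rewrite Hc, Hinv in H.
  replace (Nat.iter n (Ttilde theta) x + INR n * rho t)
    with (- (x - Nat.iter n (Ttilde theta) x - INR n * rho t) + x) by ring.
  eapply Rle_trans; [apply Rabs_triang|]; rewrite Rabs_Ropp; lra. }
apply is_lim_seq_spec; intros eps; simpl.
destruct (INR_archimed eps (2 + Rabs x) (cond_pos eps)) as [N HN].
exists (S N); intros n Hn.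
assert (Hn0 : INR N < INR n) by (apply lt_INR; lia).
assert (HN0 := pos_INR N).
apply Rmult_lt_reg_l with (INR n); [lra|].
rewrite <- (Rabs_right (INR n)) at 1 by lra; rewrite <- Rabs_mult.
replace (INR n * (Nat.iter n (Ttilde theta) x / INR n - - rho t))
  with (Nat.iter n (Ttilde theta) x + INR n * rho t) by (field; lra).
eapply Rle_lt_trans; [apply Hb|]; assert (H := cond_pos eps); nra.
Qed.

(** * The value rot on the circle of angles modulo pi/4 *)

Lemma tan_le (x y : R) : 0 <= x -> x <= y -> y <= PI / 4 -> tan x <= tan y.
Proof.
intros Hx Hxy Hy; assert (Hpi := PI_RGT_0).
destruct Hxy as [H | ->]; [|lra].
apply Rlt_le, tan_increasing; lra.
Qed.

Lemma tan_range (x : R) : 0 <= x <= PI / 4 -> 0 <= tan x <= 1.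
Proof.
intros Hx; rewrite <- tan_0, <- tan_PI4; split; apply tan_le; lra.
Qed.

Lemma tan_theta_tilde : tan theta_tilde = 1 / 2.
Proof.
unfold theta_tilde; rewrite <- atan_inv by lra; rewrite tan_atan; lra.
Qed.

Lemma theta_tilde_range : 0 < theta_tilde < PI / 4.
Proof.
unfold theta_tilde; rewrite <- atan_inv by lra; rewrite <- atan_0, <- atan_1.
split; apply atan_increasing; lra.
Qed.

Lemma tan_lipschitz (x y : R) : 0 <= x <= PI / 4 -> 0 <= y <= PI / 4 ->
  Rabs (tan x - tan y) <= 2 * Rabs (x - y).
Proof.
assert (Hpi := PI_RGT_0).
intros Hx Hy.
destruct (MVT_gen tan y x (fun c => tan c ^ 2 + 1)) as [c [Hc ->]].
- intros z Hz; apply is_derive_tan, Rgt_not_eq, cos_gt_0;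
  revert Hz; unfold Rmin, Rmax; destruct Rle_dec; lra.
- intros z Hz; apply continuity_pt_filterlim, (ex_derive_continuous tan).
  eexists; apply is_derive_tan, Rgt_not_eq, cos_gt_0;
  revert Hz; unfold Rmin, Rmax; destruct Rle_dec; lra.
- rewrite Rabs_mult; apply Rmult_le_compat_r; [apply Rabs_pos|].
  assert (H : 0 <= tan c <= 1).
  { apply tan_range; revert Hc; unfold Rmin, Rmax; destruct Rle_dec; lra. }
  apply Rabs_le_between; nra.
Qed.

Lemma RZ_eq (X Y : RZ) : coset X = coset Y -> X = Y.
Proof.
destruct X as [X HX], Y as [Y HY]; simpl; intros ->; f_equal; apply proof_irrelevance.
Qed.

Lemma class_mod1_shift (r : R) (k : Z) : class_mod1 (r + IZR k) = class_mod1 r.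
Proof.
apply RZ_eq; simpl; apply functional_extensionality; intros s.
apply propositional_extensionality; split; intros [l ->].
- exists (k + l)%Z; rewrite plus_IZR; ring.
- exists (l - k)%Z; rewrite minus_IZR; ring.
Qed.

Lemma RZ_ball_class (x y e : R) : Rabs (y - x) < e ->
  RZ_ball (class_mod1 x) e (class_mod1 y).
Proof.
intros H; exists x, y; split; [|split; [|exact H]]; exists 0%Z; simpl; ring.
Qed.

(** One formula covers both clauses of [is_rot]: where rot is 0 by convention, [rho] equals -1 or 0
    and so vanishes in R/Z. *)
Lemma is_rot_iff (theta : R) (r : RZ) : 0 <= theta <= PI / 4 ->
  (is_rot theta r <-> r = class_mod1 (- rho (tan theta))).
Proof.
intros Hth; assert (Htt := theta_tilde_range); assert (Hpi := PI_RGT_0).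
assert (H01 : class_mod1 1 = class_mod1 0)
  by (rewrite <- (class_mod1_shift 0 1); f_equal; simpl; ring).
destruct (Rle_dec theta theta_tilde) as [Hle | Hgt].
- rewrite rho_left by (rewrite <- tan_theta_tilde; apply tan_le; lra).
  replace (- -1) with 1 by ring; rewrite H01; split.
  + intros [[H _] | [_ H]]; [lra | exact H].
  + intros H; right; split; [left; lra | exact H].
- destruct (Req_dec theta (PI / 4)) as [-> | Hne].
  + rewrite rho_right by (rewrite tan_PI4; lra); rewrite Ropp_0; split.
    * intros [[H _] | [_ H]]; [lra | exact H].
    * intros H; right; split; [right; reflexivity | exact H].
  + assert (Ht : 1 / 2 <= tan theta <= 1).
    { rewrite <- tan_theta_tilde, <- tan_PI4; split; apply tan_le; lra. }
    split.
    * intros [[_ [s [-> Hs]]] | [H _]]; [|lra].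
      f_equal; assert (H1 := Ttilde_limit theta 0 Ht).
      apply is_lim_seq_unique in H1; assert (H2 := is_lim_seq_unique _ _ (Hs 0)).
      rewrite H1 in H2; injection H2; auto.
    * intros ->; left; split; [lra|].
      exists (- rho (tan theta)); split; [reflexivity|].
      intros x; apply Ttilde_limit, Ht.
Qed.

Lemma is_rot_mod_shift (theta : R) (k : Z) (r : RZ) :
  is_rot_mod theta r -> is_rot_mod (theta + IZR k * (PI / 4)) r.
Proof.
intros [l [H1 H2]]; exists (l + k)%Z.
replace (theta + IZR k * (PI / 4) - IZR (l + k) * (PI / 4))
  with (theta - IZR l * (PI / 4)) by (rewrite plus_IZR; ring).
split; assumption.
Qed.

Lemma is_rot_mod_exists (theta : R) : exists r, is_rot_mod theta r.
Proof.
assert (Hpi := PI_RGT_0).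
set (k := Int_part (theta / (PI / 4))); assert (Hk := Int_part_bounds (theta / (PI / 4))).
fold k in Hk.
assert (E : theta = theta / (PI / 4) * (PI / 4)) by (field; lra).
assert (H : 0 <= theta - IZR k * (PI / 4) <= PI / 4) by (rewrite E; nra).
exists (class_mod1 (- rho (tan (theta - IZR k * (PI / 4))))), k.
split; [exact H | now apply is_rot_iff].
Qed.

Lemma rho_tan_uniform (eps : R) : 0 < eps -> exists eta, 0 < eta /\
  forall u v, 0 <= u <= PI / 4 -> 0 <= v <= PI / 4 -> Rabs (u - v) < eta ->
  Rabs (rho (tan u) - rho (tan v)) < eps.
Proof.
intros He; destruct (rho_uniform eps He) as [del [Hd H]].
exists (del / 2); split; [lra|]; intros u v Hu Hv Huv.
apply H; assert (H' := tan_lipschitz u v Hu Hv); lra.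
Qed.

Lemma is_rot_mod_uniform (eps : R) : 0 < eps -> exists eta, 0 < eta /\
  forall theta theta' r r', is_rot_mod theta r -> is_rot_mod theta' r' ->
  Rabs (theta' - theta) < eta -> RZ_ball r eps r'.
Proof.
intros He; assert (Hpi := PI_RGT_0).
destruct (rho_tan_uniform (eps / 2) ltac:(lra)) as [eta [Heta H]].
exists (Rmin eta (PI / 4)); split; [apply Rmin_pos; lra|].
(* Crossing a multiple of pi/4 upwards: rho jumps from 0 to -1. *)
assert (Hcross : forall u u', 0 <= u <= PI / 4 -> 0 <= u' <= PI / 4 ->
  Rabs (u' + PI / 4 - u) < eta ->
  RZ_ball (class_mod1 (- rho (tan u))) eps (class_mod1 (- rho (tan u')))).
{ intros u u' Hu Hu' Huu; apply Rabs_lt_between in Huu.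
  assert (H1 := H u (PI / 4) Hu ltac:(lra)
    ltac:(apply Rabs_lt_between; lra)).
  assert (H2 := H u' 0 Hu' ltac:(lra) ltac:(apply Rabs_lt_between; lra)).
  rewrite (rho_right (tan (PI / 4))) in H1 by (rewrite tan_PI4; lra).
  rewrite (rho_left (tan 0)) in H2 by (rewrite tan_0; lra).
  rewrite <- (class_mod1_shift (- rho (tan u')) (-1)).
  apply RZ_ball_class; apply Rabs_lt_between in H1; apply Rabs_lt_between in H2.
  apply Rabs_lt_between; lra. }
intros theta theta' r r' [k [Hk Hr]] [k' [Hk' Hr']] Hth.
apply (is_rot_iff _ _ Hk) in Hr; apply (is_rot_iff _ _ Hk') in Hr'; subst r r'.
assert (Hth1 : Rabs (theta' - theta) < eta) by (eapply Rlt_le_trans; [exact Hth | apply Rmin_l]).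
assert (Hth2 : Rabs (theta' - theta) < PI / 4)
  by (eapply Rlt_le_trans; [exact Hth | apply Rmin_r]).
clear Hth; set (u := theta - IZR k * (PI / 4)) in *.
set (u' := theta' - IZR k' * (PI / 4)) in *.
assert (E : theta' - theta = u' - u + IZR (k' - k) * (PI / 4))
  by (unfold u, u'; rewrite minus_IZR; ring).
rewrite E in Hth1, Hth2.
(* Angles less than pi/4 apart are reduced by the same or by adjacent multiples of pi/4. *)
assert (Hcases : (k' - k = 0 \/ k' - k = 1 \/ k' - k = -1)%Z).
{ apply Rabs_lt_between in Hth2.
  assert (H1 : (k' - k < 2)%Z) by (apply lt_IZR; nra).
  assert (H2 : (-2 < k' - k)%Z) by (apply lt_IZR; nra).
  lia. }
destruct Hcases as [Hc | [Hc | Hc]]; rewrite Hc in Hth1; simpl in Hth1.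
- apply RZ_ball_class.
  replace (- rho (tan u') - - rho (tan u)) with (rho (tan u) - rho (tan u')) by ring.
  eapply Rlt_trans; [apply H; trivial|lra].
  rewrite Rabs_minus_sym; replace (u' - u) with (u' - u + 0 * (PI / 4)) by ring; exact Hth1.
- apply Hcross; trivial.
  replace (u' + PI / 4 - u) with (u' - u + 1 * (PI / 4)) by ring; exact Hth1.
- apply RZ_ball_sym, Hcross; trivial.
  rewrite Rabs_minus_sym.
  replace (u' - (u + PI / 4)) with (u' - u + -1 * (PI / 4)) by ring; exact Hth1.
Qed.

(** Only a multiple of pi/4 has two reductions, 0 and pi/4; there [rho] takes the values -1 and 0,
    equal in R/Z. *)
Lemma is_rot_mod_unique (theta : R) (r r' : RZ) :
  is_rot_mod theta r -> is_rot_mod theta r' -> r = r'.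
Proof.
assert (Hpi := PI_RGT_0).
assert (H01 : class_mod1 (- rho (tan (PI / 4))) = class_mod1 (- rho (tan 0))).
{ rewrite rho_right, rho_left by (rewrite ?tan_PI4, ?tan_0; lra).
  rewrite <- (class_mod1_shift (- 0) 1); f_equal; simpl; ring. }
intros [k [Hk Hr]] [k' [Hk' Hr']].
apply (is_rot_iff _ _ Hk) in Hr; apply (is_rot_iff _ _ Hk') in Hr'; subst r r'.
assert (Hcases : (k' - k = 0 \/ k' - k = 1 \/ k' - k = -1)%Z).
{ assert (H1 : (k' - k < 2)%Z) by (apply lt_IZR; rewrite minus_IZR; nra).
  assert (H2 : (-2 < k' - k)%Z) by (apply lt_IZR; rewrite minus_IZR; nra).
  lia. }
destruct Hcases as [Hc | [Hc | Hc]].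
- replace k' with k by lia; reflexivity.
- replace k' with (k + 1)%Z in * by lia; rewrite plus_IZR in *.
  replace (theta - IZR k * (PI / 4)) with (PI / 4) by lra.
  replace (theta - (IZR k + 1) * (PI / 4)) with 0 by lra; exact H01.
- replace k with (k' + 1)%Z in * by lia; rewrite plus_IZR in *.
  replace (theta - IZR k' * (PI / 4)) with (PI / 4) by lra.
  replace (theta - (IZR k' + 1) * (PI / 4)) with 0 by lra; symmetry; exact H01.
Qed.

(** * Trajectories *)

Notation is_derive_RC f t l :=
  (is_derive (K := R_AbsRing) (V := C_R_NormedModule) f t l).

Lemma is_derive_RC_iff (f : R -> C) (t : R) (l : C) :
  is_derive_RC f t l <->
  is_derive (fun s => Re (f s)) t (Re l) /\ is_derive (fun s => Im (f s)) t (Im l).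
Proof.
split.
- intros H; split.
  + apply (filterdiff_comp' f (fun z : C_R_NormedModule => fst z) t _ (fun z => fst z) H).
    apply filterdiff_linear, (is_linear_fst (U := R_NormedModule) (V := R_NormedModule)).
  + apply (filterdiff_comp' f (fun z : C_R_NormedModule => snd z) t _ (fun z => snd z) H).
    apply filterdiff_linear, (is_linear_snd (U := R_NormedModule) (V := R_NormedModule)).
- intros [H1 H2].
  assert (H3 := is_derive_scal_l (V := C_R_NormedModule) _ t _ (RtoC 1) H1).
  assert (H4 := is_derive_scal_l (V := C_R_NormedModule) _ t _ Ci H2).
  assert (H := is_derive_plus _ _ _ _ _ H3 H4).
  assert (E : forall x y : R,
    plus (scal (V := C_R_NormedModule) x (RtoC 1)) (scal (V := C_R_NormedModule) y Ci) = (x, y)).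
  { intros x y; apply injective_projections; cbn; ring. }
  rewrite E in H; destruct l as [lx ly]; revert H; apply is_derive_ext.
  intros s; rewrite E; unfold Re, Im; symmetry; apply surjective_pairing.
Qed.

Lemma is_derive_RC_unique (f : R -> C) (t : R) (l l' : C) :
  is_derive_RC f t l -> is_derive_RC f t l' -> l = l'.
Proof.
intros [H1 H2]%is_derive_RC_iff [H1' H2']%is_derive_RC_iff.
apply is_derive_unique in H1, H2, H1', H2'.
apply injective_projections; [now rewrite H1 in H1' | now rewrite H2 in H2'].
Qed.

Lemma is_derive_RC_plus (f h : R -> C) (t : R) (l k : C) :
  is_derive_RC f t l -> is_derive_RC h t k ->
  is_derive_RC (fun s => f s + h s)%C t (l + k)%C.
Proof. intros H1 H2; apply (is_derive_plus f h t l k H1 H2). Qed.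

Lemma is_derive_RC_minus (f h : R -> C) (t : R) (l k : C) :
  is_derive_RC f t l -> is_derive_RC h t k ->
  is_derive_RC (fun s => f s - h s)%C t (l - k)%C.
Proof. intros H1 H2; apply (is_derive_minus f h t l k H1 H2). Qed.

Lemma is_derive_RC_mult (f h : R -> C) (t : R) (l k : C) :
  is_derive_RC f t l -> is_derive_RC h t k ->
  is_derive_RC (fun s => f s * h s)%C t (l * h t + f t * k)%C.
Proof.
intros [H1 H2]%is_derive_RC_iff [H3 H4]%is_derive_RC_iff.
assert (Hm : forall u v : R -> R, forall du dv, is_derive u t du -> is_derive v t dv ->
  is_derive (fun s => u s * v s) t (du * v t + u t * dv)).
{ intros u v du dv Hu Hv; apply (is_derive_mult u v t du dv Hu Hv); intros; apply Rmult_comm. }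
apply is_derive_RC_iff; split.
- assert (H := is_derive_minus _ _ _ _ _ (Hm _ _ _ _ H1 H3) (Hm _ _ _ _ H2 H4)).
  replace (Re (l * h t + f t * k)%C) with
    (minus (Re l * Re (h t) + Re (f t) * Re k) (Im l * Im (h t) + Im (f t) * Im k)); [exact H|].
  unfold minus, plus, opp, Re, Im; simpl; ring.
- assert (H := is_derive_plus _ _ _ _ _ (Hm _ _ _ _ H1 H4) (Hm _ _ _ _ H2 H3)).
  replace (Im (l * h t + f t * k)%C) with
    (plus (Re l * Im (h t) + Re (f t) * Im k) (Im l * Re (h t) + Im (f t) * Re k)); [exact H|].
  unfold plus, Re, Im; simpl; ring.
Qed.

Lemma is_derive_RC_const (c : C) (t : R) : is_derive_RC (fun _ => c) t (RtoC 0).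
Proof. apply (is_derive_const (K := R_AbsRing) (V := C_R_NormedModule) c t). Qed.

Lemma is_derive_RC_cmult (c : C) (f : R -> C) (t : R) (l : C) :
  is_derive_RC f t l -> is_derive_RC (fun s => c * f s)%C t (c * l)%C.
Proof.
intros H; assert (H' := is_derive_RC_mult _ _ _ _ _ (is_derive_RC_const c t) H).
replace (c * l)%C with (0 * f t + c * l)%C by ring; exact H'.
Qed.

Lemma is_derive_RC_affine (a b : C) (t : R) :
  is_derive_RC (fun s => RtoC s * a + b)%C t a.
Proof.
apply is_derive_RC_iff; split; unfold Re, Im; simpl.
- evar_last; [auto_derive; auto|ring].
- evar_last; [auto_derive; auto|ring].
Qed.

Lemma is_derive_RC_shift (f : R -> C) (s t : R) (l : C) :
  is_derive_RC f (t + s) l -> is_derive_RC (fun u => f (u + s)) t l.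
Proof.
intros H.
assert (Hs : is_derive (fun u : R => u + s) t 1) by (auto_derive; auto).
assert (H' := is_derive_comp f (fun u => u + s) t l 1 H Hs).
replace l with (scal (V := C_R_NormedModule) 1 l); [exact H'|].
apply injective_projections; cbn; ring.
Qed.

(** * Uniqueness of solutions and invariance of the three lines *)

(** N exp(-Kt) is nonincreasing to the right of t0 and N exp(Kt) is nondecreasing to its left, while
    N is nonnegative. The mean value identity [HMVT] is stated for a rate c in order to serve both
    sides. *)
Lemma gronwall_zero (N dN : R -> R) (K lo hi t0 : R) :
  (forall t, lo <= t <= hi -> is_derive N t (dN t)) ->
  (forall t, lo <= t <= hi -> 0 <= N t /\ Rabs (dN t) <= K * N t) ->
  lo <= t0 <= hi -> N t0 = 0 -> forall t, lo <= t <= hi -> N t = 0.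
Proof.
intros HN HK Ht0 HN0 t Ht.
assert (HMVT : forall c a b, lo <= a <= b -> b <= hi -> exists x, lo <= x <= hi /\
  N b * exp (c * b) - N a * exp (c * a) = (dN x + c * N x) * (exp (c * x) * (b - a))).
{ intros c a b Ha Hb.
  destruct (MVT_gen (fun s => N s * exp (c * s)) a b
    (fun s => (dN s + c * N s) * exp (c * s))) as [x [Hx Heq]].
  - intros x Hx; rewrite Rmin_left, Rmax_right in Hx by lra.
    assert (HNx := HN x ltac:(lra)).
    evar_last; [apply (is_derive_mult N (fun s => exp (c * s)));
      [exact HNx | | intros; apply Rmult_comm]|].
    + auto_derive; [trivial | reflexivity].
    + unfold plus, mult; simpl; ring.
  - intros x Hx; rewrite Rmin_left, Rmax_right in Hx by lra.
    assert (HNx := HN x ltac:(lra)).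
    apply continuity_pt_filterlim, (continuous_mult N (fun s => exp (c * s))).
    + apply (ex_derive_continuous N); eexists; exact HNx.
    + apply (ex_derive_continuous (fun s => exp (c * s))); auto_derive; trivial.
  - rewrite Rmin_left, Rmax_right in Hx by lra.
    exists x; split; [lra|]; simpl in Heq; rewrite Heq; ring. }
assert (HNt := proj1 (HK t Ht)).
destruct (Rle_dec t0 t) as [Hle | Hgt].
- destruct (HMVT (- K) t0 t ltac:(lra) ltac:(lra)) as [x [Hx E]].
  destruct (HK x Hx) as [_ H']; apply Rabs_le_between in H'.
  rewrite HN0, Rmult_0_l in E.
  assert (He := exp_pos (- K * t)); assert (He' := exp_pos (- K * x)).
  assert (0 <= (- (dN x + - K * N x)) * (exp (- K * x) * (t - t0))).
  { apply Rmult_le_pos; [lra | apply Rmult_le_pos; lra]. }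
  nra.
- destruct (HMVT K t t0 ltac:(lra) ltac:(lra)) as [x [Hx E]].
  destruct (HK x Hx) as [_ H']; apply Rabs_le_between in H'.
  rewrite HN0, Rmult_0_l in E.
  assert (He := exp_pos (K * t)); assert (He' := exp_pos (K * x)).
  assert (0 <= (dN x + K * N x) * (exp (K * x) * (t0 - t))).
  { apply Rmult_le_pos; [lra | apply Rmult_le_pos; lra]. }
  nra.
Qed.

Lemma Cmod_sqr (z : C) : Cmod z * Cmod z = Re z * Re z + Im z * Im z.
Proof.
replace (Cmod z * Cmod z) with (Cmod z ^ 2) by ring; rewrite Cmod2_alt; ring.
Qed.

Lemma is_derive_Cmod_sqr (f : R -> C) (t : R) (l : C) : is_derive_RC f t l ->
  is_derive (fun s => Cmod (f s) * Cmod (f s)) t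
    (2 * (Re (f t) * Re l + Im (f t) * Im l)).
Proof.
intros [H1 H2]%is_derive_RC_iff.
apply is_derive_ext with (fun s => Re (f s) * Re (f s) + Im (f s) * Im (f s)).
{ intros u; now rewrite Cmod_sqr. }
assert (Hm : forall u : R -> R, forall du, is_derive u t du ->
  is_derive (fun s => u s * u s) t (2 * (u t * du))).
{ intros u du Hu; evar_last;
  [apply (is_derive_mult u u t du du Hu Hu); intros; apply Rmult_comm|].
  unfold plus, mult; simpl; ring. }
evar_last; [exact (is_derive_plus _ _ _ _ _ (Hm _ _ H1) (Hm _ _ H2))|].
unfold plus; simpl; ring.
Qed.

Lemma Re_conj_mult_le (z w : C) :
  Rabs (Re z * Re w + Im z * Im w) <= Cmod z * Cmod w.
Proof.
rewrite <- (Cmod_conj z), <- Cmod_mult.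
replace (Re z * Re w + Im z * Im w) with (Re (Cconj z * w)).
- eapply Rle_trans; [apply Rmax_l | apply Rmax_Cmod].
- unfold Re, Im, Cconj; simpl; ring.
Qed.

(** The Gronwall argument is applied to N = |f1|^2 + |f2|^2, for which |N'| <= 2 M (|f1| + |f2|)^2
    <= 4 M N. *)
Lemma linear_system_zero (f1 f2 a b c d : R -> C) (lo hi t0 M : R) :
  (forall t, lo <= t <= hi ->
    is_derive_RC f1 t (a t * f1 t + b t * f2 t)%C /\
    is_derive_RC f2 t (c t * f1 t + d t * f2 t)%C) ->
  (forall t, lo <= t <= hi ->
    Cmod (a t) <= M /\ Cmod (b t) <= M /\ Cmod (c t) <= M /\ Cmod (d t) <= M) ->
  lo <= t0 <= hi -> f1 t0 = RtoC 0 -> f2 t0 = RtoC 0 ->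
  forall t, lo <= t <= hi -> f1 t = RtoC 0 /\ f2 t = RtoC 0.
Proof.
intros Hf HM Ht0 Hz1 Hz2 t Ht.
set (N := fun s => Cmod (f1 s) * Cmod (f1 s) + Cmod (f2 s) * Cmod (f2 s)).
set (g1 := fun s => (a s * f1 s + b s * f2 s)%C).
set (g2 := fun s => (c s * f1 s + d s * f2 s)%C).
set (dN := fun s => 2 * (Re (f1 s) * Re (g1 s) + Im (f1 s) * Im (g1 s)) +
  2 * (Re (f2 s) * Re (g2 s) + Im (f2 s) * Im (g2 s))).
assert (HNt : N t = 0).
{ apply (gronwall_zero N dN (4 * M) lo hi t0); trivial.
  - intros s Hs; destruct (Hf s Hs) as [H1 H2].
    exact (is_derive_plus _ _ _ _ _ (is_derive_Cmod_sqr _ _ _ H1)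
      (is_derive_Cmod_sqr _ _ _ H2)).
  - intros s Hs; destruct (HM s Hs) as [Ha [Hb [Hc Hd]]].
    unfold N, dN; assert (P1 := Cmod_ge_0 (f1 s)); assert (P2 := Cmod_ge_0 (f2 s)).
    assert (PM := Cmod_ge_0 (a s)).
    assert (B : forall u v, Cmod u <= M -> Cmod v <= M ->
      Cmod (u * f1 s + v * f2 s)%C <= M * (Cmod (f1 s) + Cmod (f2 s))).
    { intros u v Hu Hv; eapply Rle_trans; [apply Cmod_triangle|]; rewrite !Cmod_mult; nra. }
    assert (B1 : Cmod (g1 s) <= M * (Cmod (f1 s) + Cmod (f2 s))) by (apply B; trivial).
    assert (B2 : Cmod (g2 s) <= M * (Cmod (f1 s) + Cmod (f2 s))) by (apply B; trivial).
    split; [nra|].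
    eapply Rle_trans; [apply Rabs_triang|].
    rewrite !Rabs_mult, (Rabs_right 2) by lra.
    assert (C1 := Re_conj_mult_le (f1 s) (g1 s)).
    assert (C2 := Re_conj_mult_le (f2 s) (g2 s)).
    assert (D1 := Rmult_le_compat_l _ _ _ P1 B1).
    assert (D2 := Rmult_le_compat_l _ _ _ P2 B2).
    set (x := Cmod (f1 s)) in *; set (y := Cmod (f2 s)) in *.
    assert (HM0 : 0 <= M) by lra.
    assert (0 <= M * ((x - y) * (x - y))) by (apply Rmult_le_pos; [lra | apply Rle_0_sqr]).
    nra.
  - unfold N; rewrite Hz1, Hz2, Cmod_0; ring. }
unfold N in HNt; assert (P1 := Cmod_ge_0 (f1 t)); assert (P2 := Cmod_ge_0 (f2 t)).
split; apply Cmod_eq_0; nra.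
Qed.

Definition c1 : C := (RtoC (PI / 2) + Ci * RtoC (ln 2))%C.
Definition c2 : C := (RtoC (3 * PI / 4) - Ci * RtoC (ln 2 / 2))%C.
Definition c3 : C := (RtoC (3 * PI / 2) - Ci * RtoC (ln 2))%C.
Definition c4 : C := (RtoC (5 * PI / 4) + Ci * RtoC (ln 2 / 2))%C.

Lemma v1_eq (x y : C) : v1 x y = (- c1 * (x * x) + c2 * (x * y))%C.
Proof. reflexivity. Qed.

Lemma v2_eq (x y : C) : v2 x y = (c3 * (x * y) + - c4 * (y * y))%C.
Proof. unfold v2; fold c3 c4; ring. Qed.

(** This relation makes x - y divide v1 - v2, with quotient -c1 x - c4 y, so that the line x = y is
    invariant. *)
Lemma c3_minus_c2 : (c3 - c2 = c4 - c1)%C.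
Proof. unfold c1, c2, c3, c4; apply injective_projections; simpl; field. Qed.

Lemma solution_bounded (I : R -> Prop) (gam : R -> C * C) (lo hi : R) :
  solution I gam -> I lo -> I hi -> exists M, forall t, lo <= t <= hi ->
    Cmod (fst (gam t)) <= M /\ Cmod (snd (gam t)) <= M.
Proof.
intros [[_ HI] Hs] Hlo Hhi.
destruct (Rle_dec lo hi) as [Hle | Hgt]; [|exists 0; intros t Ht; lra].
set (N := fun t => Cmod (fst (gam t)) * Cmod (fst (gam t))
  + Cmod (snd (gam t)) * Cmod (snd (gam t))).
destruct (continuity_ab_maj N lo hi Hle) as [tm [Hmax _]].
- intros t Ht; destruct (Hs t) as [H1 H2].
  { apply (HI lo t hi); trivial. }
  apply continuity_pt_filterlim, (ex_derive_continuous N); eexists.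
  exact (is_derive_plus _ _ _ _ _ (is_derive_Cmod_sqr _ _ _ H1)
    (is_derive_Cmod_sqr _ _ _ H2)).
(* A modulus is at most 1 plus its square. *)
- exists (1 + N tm); intros t Ht; assert (H := Hmax t Ht); unfold N in H at 1.
  assert (P1 := Cmod_ge_0 (fst (gam t))); assert (P2 := Cmod_ge_0 (snd (gam t))).
  split; nra.
Qed.

(** The field being quadratic, the difference of two solutions satisfies a linear system whose
    coefficients involve the solutions and are bounded between t0 and t: x^2 - x'^2 = (x + x')(x -
    x') and xy - x'y' = y (x - x') + x' (y - y'). *)
Lemma solution_unique (I J : R -> Prop) (gam gam' : R -> C * C) (t0 t : R) :
  solution I gam -> solution J gam' -> I t0 -> J t0 -> gam t0 = gam' t0 ->
  I t -> J t -> gam t = gam' t.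
Proof.
intros HI HJ It0 Jt0 E0 It Jt.
set (lo := Rmin t0 t); set (hi := Rmax t0 t).
assert (Hlo : I lo /\ J lo) by (unfold lo, Rmin; destruct Rle_dec; auto).
assert (Hhi : I hi /\ J hi) by (unfold hi, Rmax; destruct Rle_dec; auto).
destruct (solution_bounded I gam lo hi HI (proj1 Hlo) (proj1 Hhi)) as [M1 HM1].
destruct (solution_bounded J gam' lo hi HJ (proj2 Hlo) (proj2 Hhi)) as [M2 HM2].
destruct HI as [[_ HI] HsI], HJ as [[_ HJ] HsJ].
assert (Hrange : forall s, lo <= s <= hi -> I s /\ J s).
{ intros s Hs; split; [apply (HI lo s hi) | apply (HJ lo s hi)]; tauto. }
set (f1 := fun s => (fst (gam s) - fst (gam' s))%C).
set (f2 := fun s => (snd (gam s) - snd (gam' s))%C).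
set (K := Cmod c1 + Cmod c2 + Cmod c3 + Cmod c4).
assert (Q1 := Cmod_ge_0 c1); assert (Q2 := Cmod_ge_0 c2).
assert (Q3 := Cmod_ge_0 c3); assert (Q4 := Cmod_ge_0 c4).
destruct (linear_system_zero f1 f2
  (fun s => - c1 * (fst (gam s) + fst (gam' s)) + c2 * snd (gam s))%C
  (fun s => c2 * fst (gam' s))%C
  (fun s => c3 * snd (gam s))%C
  (fun s => c3 * fst (gam' s) - c4 * (snd (gam s) + snd (gam' s)))%C
  lo hi t0 (K * (2 * M1 + 2 * M2))) with (t := t) as [Z1 Z2].
- intros s Hs; destruct (Hrange s Hs) as [Is Js].
  destruct (HsI s Is) as [D1 D2]; destruct (HsJ s Js) as [D1' D2'].
  rewrite v1_eq in D1, D1'; rewrite v2_eq in D2, D2'; split.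
  + evar_last; [exact (is_derive_RC_minus _ _ _ _ _ D1 D1')|]; unfold f1, f2; ring.
  + evar_last; [exact (is_derive_RC_minus _ _ _ _ _ D2 D2')|]; unfold f1, f2; ring.
- intros s Hs; destruct (HM1 s Hs) as [B1 B2]; destruct (HM2 s Hs) as [B3 B4].
  assert (P1 := Cmod_ge_0 (fst (gam s))); assert (P2 := Cmod_ge_0 (snd (gam s))).
  assert (P3 := Cmod_ge_0 (fst (gam' s))); assert (P4 := Cmod_ge_0 (snd (gam' s))).
  set (M := 2 * M1 + 2 * M2).
  assert (Hsum : forall z w, Cmod z <= M -> Cmod w <= M -> forall u v,
    Cmod u + Cmod v <= K -> Cmod (u * z + v * w)%C <= K * M).
  { intros z w Hz Hw u v Huv; eapply Rle_trans; [apply Cmod_triangle|].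
    rewrite !Cmod_mult; assert (U := Cmod_ge_0 u); assert (V := Cmod_ge_0 v).
    assert (Z := Cmod_ge_0 z).
    apply Rle_trans with ((Cmod u + Cmod v) * M); [nra|].
    apply Rmult_le_compat_r; lra. }
  assert (T1 : Cmod (fst (gam s) + fst (gam' s))%C <= M)
    by (eapply Rle_trans; [apply Cmod_triangle | unfold M; lra]).
  assert (T2 : Cmod (snd (gam s) + snd (gam' s))%C <= M)
    by (eapply Rle_trans; [apply Cmod_triangle | unfold M; lra]).
  assert (E : forall u v : C, (u * v = u * v + 0 * v)%C) by (intros; ring).
  repeat split.
  + apply Hsum; [exact T1 | unfold M; lra | rewrite Cmod_opp; unfold K; lra].
  + rewrite E; apply Hsum; [unfold M; lra | unfold M; lra | rewrite Cmod_0; unfold K; lra].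
  + rewrite E; apply Hsum; [unfold M; lra | unfold M; lra | rewrite Cmod_0; unfold K; lra].
  + replace (c3 * fst (gam' s) - c4 * (snd (gam s) + snd (gam' s)))%C
      with (c3 * fst (gam' s) + (- c4) * (snd (gam s) + snd (gam' s)))%C by ring.
    apply Hsum; [unfold M; lra | exact T2 | rewrite Cmod_opp; unfold K; lra].
- unfold lo, hi; split; [apply Rmin_l | apply Rmax_l].
- unfold f1; rewrite E0; ring.
- unfold f2; rewrite E0; ring.
- unfold lo, hi; split; [apply Rmin_r | apply Rmax_r].
- apply injective_projections; unfold f1, f2 in *.
  + rewrite <- (Cplus_0_r (fst (gam' t))), <- Z1; ring.
  + rewrite <- (Cplus_0_r (snd (gam' t))), <- Z2; ring.
Qed.

(** The functions x, y and x - y satisfy such an equation along a solution. In [linear_system_zero]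
    the second unknown is simply a copy of f. *)
Lemma linear_zero (I : R -> Prop) (gam : R -> C * C) (f : R -> C) (a b : C) (t0 t : R) :
  solution I gam ->
  (forall s, I s -> is_derive_RC f s ((a * fst (gam s) + b * snd (gam s)) * f s)%C) ->
  I t0 -> I t -> f t0 = RtoC 0 -> f t = RtoC 0.
Proof.
intros Hs Hf It0 It E0.
set (lo := Rmin t0 t); set (hi := Rmax t0 t).
assert (Hlo : I lo) by (unfold lo, Rmin; destruct Rle_dec; auto).
assert (Hhi : I hi) by (unfold hi, Rmax; destruct Rle_dec; auto).
destruct (solution_bounded I gam lo hi Hs Hlo Hhi) as [M HM].
assert (HI := proj2 (proj1 Hs)).
apply (linear_system_zero f f (fun s => a * fst (gam s) + b * snd (gam s))%C (fun _ => RtoC 0)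
  (fun s => a * fst (gam s) + b * snd (gam s))%C (fun _ => RtoC 0) lo hi t0
  ((Cmod a + Cmod b) * M)); trivial.
- intros s Hss; assert (H := Hf s (HI lo s hi Hlo Hhi Hss)).
  split; (evar_last; [exact H | simpl; ring]).
- intros s Hss; destruct (HM s Hss) as [B1 B2].
  assert (P1 := Cmod_ge_0 (fst (gam s))); assert (P2 := Cmod_ge_0 (snd (gam s))).
  assert (Q1 := Cmod_ge_0 a); assert (Q2 := Cmod_ge_0 b).
  assert (B : Cmod (a * fst (gam s) + b * snd (gam s))%C <= (Cmod a + Cmod b) * M).
  { eapply Rle_trans; [apply Cmod_triangle|]; rewrite !Cmod_mult; nra. }
  rewrite Cmod_0; repeat split; trivial; apply Rmult_le_pos; lra.
- unfold lo, hi; split; [apply Rmin_l | apply Rmax_l].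
- unfold lo, hi; split; [apply Rmin_r | apply Rmax_r].
Qed.

Lemma calC_invariant (I : R -> Prop) (gam : R -> C * C) (t0 t : R) :
  solution I gam -> I t0 -> I t -> ~ calC (gam t0) -> ~ calC (gam t).
Proof.
intros Hs It0 It H0 [H | [H | H]]; apply H0.
- left; apply (linear_zero I gam (fun s => fst (gam s)) (- c1) c2 t t0); trivial.
  intros s Is; destruct (proj2 Hs s Is) as [D _]; rewrite v1_eq in D.
  evar_last; [exact D | ring].
- right; left.
  assert (Z : (fst (gam t0) - snd (gam t0) = 0)%C).
  { apply (linear_zero I gam (fun s => fst (gam s) - snd (gam s))%C (- c1) (- c4) t t0); trivial.
    - intros s Is; destruct (proj2 Hs s Is) as [D1 D2]; rewrite v1_eq in D1; rewrite v2_eq in D2.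
      evar_last; [exact (is_derive_RC_minus _ _ _ _ _ D1 D2)|].
      replace c3 with ((c3 - c2) + c2)%C by ring; rewrite c3_minus_c2.
      ring.
    - rewrite H; ring. }
  rewrite <- (Cplus_0_r (snd (gam t0))), <- Z; ring.
- right; right; apply (linear_zero I gam (fun s => snd (gam s)) c3 (- c4) t t0); trivial.
  intros s Is; destruct (proj2 Hs s Is) as [_ D]; rewrite v2_eq in D.
  evar_last; [exact D | ring].
Qed.

(** * Time shifts and maximal solutions *)

Lemma solution_shift (I : R -> Prop) (gam : R -> C * C) (s : R) :
  solution I gam -> solution (fun t => I (t + s)) (fun t => gam (t + s)).
Proof.
intros [[Ho HI] Hd]; split; [split|].
- apply (open_comp (fun t : R => t + s) I); [|exact Ho].
  intros x _; apply (ex_derive_continuous (fun t : R => t + s)); auto_derive; trivial.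
- intros a b c Ha Hc Hb; apply (HI (a + s) (b + s) (c + s)); trivial; lra.
- intros t It; destruct (Hd (t + s) It) as [D1 D2]; split.
  + apply (is_derive_RC_shift (fun u => fst (gam u))), D1.
  + apply (is_derive_RC_shift (fun u => snd (gam u))), D2.
Qed.

Lemma trajectory_shift (I : R -> Prop) (gam : R -> C * C) (s : R) :
  trajectory I gam -> trajectory (fun t => I (t + s)) (fun t => gam (t + s)).
Proof.
intros [Hs Hmax]; split; [now apply solution_shift|].
intros J gam' HJ Hext t Jt.
apply (Hmax (fun t => J (t + - s)) (fun t => gam' (t + - s))).
- now apply solution_shift.
- intros u Iu.
  replace u with (u + - s + s) in Iu by ring.
  destruct (Hext (u + - s) Iu) as [H1 H2]; split; [exact H1|].
  rewrite H2; f_equal; ring.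
- replace (t + s + - s) with t by ring; exact Jt.
Qed.

(** The maximal solution is the union of all solutions that take the value m at time 0; by
    uniqueness they agree where they overlap, so the choice made by [epsilon] is forced. *)
Lemma trajectory_extending (J : R -> Prop) (gam : R -> C * C) :
  solution J gam -> J 0 -> exists I gam',
    trajectory I gam' /\ forall t, J t -> I t /\ gam' t = gam t.
Proof.
intros HJ J0; set (m := gam 0).
set (P := fun t w => exists J' gam', solution J' gam' /\ J' 0 /\ gam' 0 = m /\ J' t /\
  gam' t = w).
set (I := fun t => exists w, P t w).
set (gm := fun t => epsilon (inhabits m) (P t)).
assert (Hgm : forall t w, P t w -> gm t = w).
{ intros t w Hw.
  assert (H : P t (gm t)) by (apply epsilon_spec; now exists w).
  destruct Hw as [J1 [g1 [S1 [Z1 [E1 [T1 <-]]]]]], H as [J2 [g2 [S2 [Z2 [E2 [T2 <-]]]]]].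
  apply (solution_unique J2 J1 g2 g1 0 t); trivial; congruence. }
assert (HJI : forall J' gam', solution J' gam' -> J' 0 -> gam' 0 = m ->
  forall t, J' t -> I t /\ gm t = gam' t).
{ intros J' gam' S Z E t T.
  assert (HP : P t (gam' t)) by (exists J', gam'; auto).
  split; [now exists (gam' t) | now apply Hgm]. }
exists I, gm; split; [|apply HJI; trivial].
split; [split; [split|]|].
- intros t [w [J' [gam' [S [Z [E [T _]]]]]]].
  destruct (proj1 (proj1 S) t T) as [e He]; exists e; intros s Hss.
  apply (HJI J' gam'); trivial; now apply He.
- intros a b c [w [J1 [g1 [S1 [Z1 [E1 [T1 _]]]]]]] [w' [J2 [g2 [S2 [Z2 [E2 [T2 _]]]]]]] Hb.
  (* All the domains contain 0, so the one that reaches the endpoint on the same side of 0 as b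
     contains b. *)
  destruct (Rle_dec b 0) as [Hb0 | Hb0].
  + apply (HJI J1 g1); trivial; apply (proj2 (proj1 S1) a b 0); trivial; lra.
  + apply (HJI J2 g2); trivial; apply (proj2 (proj1 S2) 0 b c); trivial; lra.
- intros t [w [J' [gam' [S [Z [E [T _]]]]]]].
  assert (Hloc : locally t (fun s => gam' s = gm s)).
  { destruct (proj1 (proj1 S) t T) as [e He]; exists e; intros s Hss.
    symmetry; apply (HJI J' gam'); trivial; now apply He. }
  destruct (proj2 S t T) as [D1 D2]; rewrite <- (locally_singleton _ _ Hloc).
  split; (eapply is_derive_ext_loc; [|eassumption]);
    (eapply filter_imp; [|exact Hloc]); simpl; intros s Hss; now rewrite Hss.
- intros J' gam' S Hext t T.
  destruct (HJI J gam HJ J0 eq_refl 0 J0) as [I0 E0].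
  destruct (Hext 0 I0) as [Z E].
  apply (HJI J' gam'); trivial; now rewrite E, E0.
Qed.

(** * The velocity of x / y *)

Lemma is_derive_RC_inv (f : R -> C) (t : R) (l : C) :
  is_derive_RC f t l -> f t <> RtoC 0 ->
  is_derive_RC (fun s => / f s)%C t (- l / (f t * f t))%C.
Proof.
intros H Hf; assert (HN := is_derive_Cmod_sqr f t l H).
apply is_derive_RC_iff in H as [H1 H2].
assert (Hpos : Cmod (f t) * Cmod (f t) <> 0).
{ apply Cmod_gt_0 in Hf; nra. }
assert (D1 := is_derive_div _ _ _ _ _ H1 HN Hpos).
assert (D2 := is_derive_div _ _ _ _ _ (is_derive_opp _ _ _ H2) HN Hpos).
apply is_derive_RC_iff; rewrite !Cmod_sqr in *.
assert (E : Re (f t) ^ 2 + Im (f t) ^ 2 <> 0) by (simpl; lra).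
assert (E' : Re (f t * f t) ^ 2 + Im (f t * f t) ^ 2 <> 0).
{ replace (Re (f t * f t) ^ 2 + Im (f t * f t) ^ 2)
    with ((Re (f t) ^ 2 + Im (f t) ^ 2) ^ 2) by (unfold Re, Im; simpl; ring).
  now apply pow_nonzero. }
split.
- eapply is_derive_ext; [|evar_last; [exact D1|]].
  + intros s; simpl; rewrite Cmod_sqr; unfold Cinv, Re, Im; simpl.
    f_equal; ring.
  + cbv beta; rewrite !Cmod_sqr; unfold Re, Im in *; simpl in *; field; split; lra.
- eapply is_derive_ext; [|evar_last; [exact D2|]].
  + intros s; simpl; rewrite Cmod_sqr; unfold Cinv, opp, Re, Im; simpl.
    f_equal; ring.
  + cbv beta; rewrite !Cmod_sqr; unfold opp, Re, Im in *; simpl in *; field; split; lra.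
Qed.

Definition g_speed (m : C * C) : C :=
  (RtoC (2 * PI) * fst m * (snd m - fst m) / snd m)%C.

(** The quotient rule leaves -(c1 + c3) x^2 / y + (c2 + c4) x; the logarithms cancel in both sums,
    which equal 2 pi. *)
Lemma g_speed_eq (x y : C) : y <> RtoC 0 ->
  (v1 x y * / y + x * (- v2 x y / (y * y)) = g_speed (x, y))%C.
Proof.
intros Hy; rewrite v1_eq, v2_eq; unfold g_speed; simpl fst; simpl snd.
assert (E1 : (- c1 - c3 = - RtoC (2 * PI))%C).
{ unfold c1, c3; apply injective_projections; simpl; field. }
assert (E2 : (c2 + c4 = RtoC (2 * PI))%C).
{ unfold c2, c4; apply injective_projections; simpl; field. }
replace ((- c1 * (x * x) + c2 * (x * y)) * / y + x * (- (c3 * (x * y) + - c4 * (y * y)) / (y * y)))%C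
  with (((- c1 - c3) * (x * x) + (c2 + c4) * (x * y)) / y)%C by (field; exact Hy).
rewrite E1, E2; field; exact Hy.
Qed.

Lemma is_derive_g (I : R -> Prop) (gam : R -> C * C) (t : R) :
  solution I gam -> I t -> snd (gam t) <> RtoC 0 ->
  is_derive_RC (fun s => g (gam s)) t (g_speed (gam t)).
Proof.
intros Hs It Hy; destruct (proj2 Hs t It) as [D1 D2].
evar_last; [exact (is_derive_RC_mult _ _ _ _ _ D1 (is_derive_RC_inv _ _ _ D2 Hy))|].
simpl; rewrite g_speed_eq by exact Hy; now rewrite <- surjective_pairing.
Qed.

Lemma g_speed_neq_0 (m : C * C) : ~ calC m -> g_speed m <> RtoC 0.
Proof.
destruct m as [x y]; unfold calC, g_speed; simpl; intros H.
assert (Hx : x <> RtoC 0) by tauto.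
assert (Hy : y <> RtoC 0) by tauto.
assert (Hxy : (y - x)%C <> RtoC 0).
{ intros E; apply H; right; left; rewrite <- (Cplus_0_l x), <- E; ring. }
assert (Hpi : RtoC (2 * PI) <> RtoC 0).
{ intros E; injection E; assert (P := PI_RGT_0); lra. }
unfold Cdiv; repeat apply Cmult_neq_0; trivial.
intros E; apply C1_nz; rewrite <- (Cinv_r y Hy), E; ring.
Qed.

Lemma g_speed_scale (lam : C) (m : C * C) : lam <> RtoC 0 -> snd m <> RtoC 0 ->
  g_speed (lam * fst m, lam * snd m)%C = (lam * g_speed m)%C.
Proof. intros Hl Hy; unfold g_speed; simpl; field; auto. Qed.

Lemma g_scale (lam : C) (m : C * C) : lam <> RtoC 0 -> snd m <> RtoC 0 ->
  g (lam * fst m, lam * snd m)%C = g m.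
Proof. intros Hl Hy; unfold g; simpl; field; auto. Qed.

Lemma calC_scale (lam : C) (m : C * C) : lam <> RtoC 0 -> ~ calC m ->
  ~ calC (lam * fst m, lam * snd m)%C.
Proof.
intros Hl H; unfold calC; simpl; intros [E | [E | E]]; apply H.
- left; destruct (Ceq_dec (fst m) 0) as [|N]; [assumption|].
  now destruct (Cmult_neq_0 _ _ Hl N).
- right; left; replace (fst m) with (/ lam * (lam * fst m))%C by (field; exact Hl).
  rewrite E; field; exact Hl.
- right; right; destruct (Ceq_dec (snd m) 0) as [|N]; [assumption|].
  now destruct (Cmult_neq_0 _ _ Hl N).
Qed.

(** * Power series solutions *)

Lemma Cmod_le_Re_Im (z : C) : Cmod z <= Rabs (Re z) + Rabs (Im z).
Proof.
assert (H := Cmod_sqr z); assert (P := Cmod_ge_0 z).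
assert (P1 := Rabs_pos (Re z)); assert (P2 := Rabs_pos (Im z)).
apply Rsqr_incr_0_var; [unfold Rsqr | lra].
rewrite H.
assert (E1 : Re z * Re z = Rabs (Re z) * Rabs (Re z))
  by (rewrite <- Rabs_mult, Rabs_right; [reflexivity | apply Rle_ge, Rle_0_sqr]).
assert (E2 : Im z * Im z = Rabs (Im z) * Rabs (Im z))
  by (rewrite <- Rabs_mult, Rabs_right; [reflexivity | apply Rle_ge, Rle_0_sqr]).
rewrite E1, E2; nra.
Qed.

Lemma Rabs_Re_le (z : C) : Rabs (Re z) <= Cmod z.
Proof. eapply Rle_trans; [apply Rmax_l | apply Rmax_Cmod]. Qed.

Lemma Rabs_Im_le (z : C) : Rabs (Im z) <= Cmod z.
Proof. eapply Rle_trans; [apply Rmax_r | apply Rmax_Cmod]. Qed.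

Definition summable (u : nat -> C) : Prop := ex_series (fun n => Cmod (u n)).
Definition cseries (u : nat -> C) : C :=
  (Series (fun n => Re (u n)), Series (fun n => Im (u n))).

Lemma summable_Re (u : nat -> C) : summable u -> ex_series (fun n => Re (u n)).
Proof. apply (ex_series_le (K := R_AbsRing) (V := R_CompleteNormedModule));
  intros n; apply Rabs_Re_le. Qed.

Lemma summable_Im (u : nat -> C) : summable u -> ex_series (fun n => Im (u n)).
Proof. apply (ex_series_le (K := R_AbsRing) (V := R_CompleteNormedModule));
  intros n; apply Rabs_Im_le. Qed.

Lemma summable_le (u : nat -> C) (b : nat -> R) :
  (forall n, Cmod (u n) <= b n) -> ex_series b -> summable u.
Proof.
intros H; apply (ex_series_le (K := R_AbsRing) (V := R_CompleteNormedModule)).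
intros n; unfold norm; simpl; unfold abs; simpl.
rewrite Rabs_right by (apply Rle_ge, Cmod_ge_0); apply H.
Qed.

Lemma cseries_bound (u : nat -> C) (b : nat -> R) :
  (forall n, Cmod (u n) <= b n) -> ex_series b -> Cmod (cseries u) <= 2 * Series b.
Proof.
intros H Hb; eapply Rle_trans; [apply Cmod_le_Re_Im|].
assert (Hn : forall w : nat -> R, (forall n, Rabs (w n) <= Cmod (u n)) ->
  Rabs (Series w) <= Series b).
{ intros w Hw.
  assert (Hwb : ex_series (fun n => Rabs (w n))).
  { apply (ex_series_le (K := R_AbsRing) (V := R_CompleteNormedModule)) with b; [|exact Hb].
    intros n; unfold norm; simpl; unfold abs; simpl; rewrite Rabs_Rabsolu.
    eapply Rle_trans; [apply Hw | apply H]. }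
  eapply Rle_trans; [apply Series_Rabs, Hwb|].
  apply Series_le; [|exact Hb].
  intros n; split; [apply Rabs_pos | eapply Rle_trans; [apply Hw | apply H]]. }
assert (H1 := Hn (fun n => Re (u n)) (fun n => Rabs_Re_le _)).
assert (H2 := Hn (fun n => Im (u n)) (fun n => Rabs_Im_le _)).
unfold cseries; simpl; lra.
Qed.

Lemma cseries_minus (u w : nat -> C) : summable u -> summable w ->
  cseries (fun n => u n - w n)%C = (cseries u - cseries w)%C.
Proof.
intros Hu Hw; apply injective_projections; simpl.
- apply (Series_minus (fun n => Re (u n)) (fun n => Re (w n))); apply summable_Re; assumption.
- apply (Series_minus (fun n => Im (u n)) (fun n => Im (w n))); apply summable_Im; assumption.
Qed.

Lemma cseries_scal (a : C) (u : nat -> C) : summable u ->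
  cseries (fun n => a * u n)%C = (a * cseries u)%C.
Proof.
intros Hu; assert (Hr := summable_Re u Hu); assert (Hi := summable_Im u Hu).
assert (S : forall (c : R) v, ex_series v -> ex_series (fun n => c * v n)).
{ intros c v; apply (ex_series_scal (K := R_AbsRing) (V := R_NormedModule)). }
apply injective_projections; simpl; rewrite <- !Series_scal_l.
- apply (Series_minus (fun n => fst a * Re (u n)) (fun n => snd a * Im (u n))); auto.
- apply (Series_plus (fun n => fst a * Im (u n)) (fun n => snd a * Re (u n))); auto.
Qed.

Lemma cseries_ext (u w : nat -> C) : (forall n, u n = w n) -> cseries u = cseries w.
Proof. intros H; apply injective_projections; simpl; apply Series_ext; intros n; now rewrite H. Qed.

(** * Cauchy products and power series in real time *)

Fixpoint csum (f : nat -> C) (n : nat) : C :=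
  match n with O => f O | S k => (csum f k + f (S k))%C end.

Definition conv (u w : nat -> C) (n : nat) : C := csum (fun k => u k * w (n - k)%nat)%C n.

Lemma csum_ext (f h : nat -> C) (n : nat) :
  (forall k, (k <= n)%nat -> f k = h k) -> csum f n = csum h n.
Proof.
induction n as [|n IH]; intros H; simpl; [apply H; lia|].
rewrite IH, H by (intros; auto with arith); reflexivity.
Qed.

Lemma csum_scal (a : C) (f : nat -> C) (n : nat) :
  csum (fun k => a * f k)%C n = (a * csum f n)%C.
Proof. induction n as [|n IH]; simpl; [reflexivity | rewrite IH; ring]. Qed.

Lemma csum_bound (f : nat -> C) (b : R) (n : nat) :
  (forall k, (k <= n)%nat -> Cmod (f k) <= b) -> Cmod (csum f n) <= INR (S n) * b.
Proof.
induction n as [|n IH]; intros H.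
- simpl; rewrite Rmult_1_l; apply H; lia.
- simpl csum; eapply Rle_trans; [apply Cmod_triangle|].
  assert (H1 := IH ltac:(intros; apply H; lia)).
  assert (H2 := H (S n) ltac:(lia)).
  rewrite (S_INR (S n)); lra.
Qed.

(** The factor n + 1 is harmless: it cancels the division by n + 1 in the recursion for the
    coefficients of the solution. *)
Lemma conv_bound (u w : nat -> C) (R0 M : R) (n : nat) : 0 <= R0 -> 0 <= M ->
  (forall k, (k <= n)%nat -> Cmod (u k) <= R0 * M ^ k /\ Cmod (w k) <= R0 * M ^ k) ->
  Cmod (conv u w n) <= INR (S n) * (R0 * R0 * M ^ n).
Proof.
intros HR HM H; apply csum_bound; intros k Hk; rewrite Cmod_mult.
destruct (H k Hk) as [H1 _]; destruct (H (n - k)%nat ltac:(lia)) as [_ H2].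
replace (R0 * R0 * M ^ n) with ((R0 * M ^ k) * (R0 * M ^ (n - k))).
- apply Rmult_le_compat; trivial; apply Cmod_ge_0.
- replace n with (k + (n - k))%nat at 2 by lia; rewrite pow_add; ring.
Qed.

Lemma Re_conv (u w : nat -> C) (n : nat) : Re (conv u w n) =
  PS_minus (PS_mult (fun k => Re (u k)) (fun k => Re (w k)))
           (PS_mult (fun k => Im (u k)) (fun k => Im (w k))) n.
Proof.
assert (H : forall j, Re (csum (fun k => u k * w (n - k)%nat)%C j) =
  sum_f_R0 (fun k => Re (u k) * Re (w (n - k)%nat)) j -
  sum_f_R0 (fun k => Im (u k) * Im (w (n - k)%nat)) j).
{ intros j; induction j as [|j IH]; [apply re_mult|].
  assert (Hp : forall a b, Re (a + b)%C = Re a + Re b) by reflexivity.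
  cbn [csum sum_f_R0]; rewrite Hp, IH, re_mult; ring. }
apply H.
Qed.

Lemma Im_conv (u w : nat -> C) (n : nat) : Im (conv u w n) =
  PS_plus (PS_mult (fun k => Re (u k)) (fun k => Im (w k)))
           (PS_mult (fun k => Im (u k)) (fun k => Re (w k))) n.
Proof.
assert (H : forall j, Im (csum (fun k => u k * w (n - k)%nat)%C j) =
  sum_f_R0 (fun k => Re (u k) * Im (w (n - k)%nat)) j +
  sum_f_R0 (fun k => Im (u k) * Re (w (n - k)%nat)) j).
{ intros j; induction j as [|j IH]; [apply im_mult|].
  assert (Hp : forall a b, Im (a + b)%C = Im a + Im b) by reflexivity.
  cbn [csum sum_f_R0]; rewrite Hp, IH, im_mult; ring. }
apply H.
Qed.

Definition geom_bounded (R0 M : R) (u : nat -> C) : Prop :=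
  forall n, Cmod (u n) <= R0 * M ^ n.

(** Time is real here, so the theory of real power series applies to each component. Complex times
    appear only as sums [cseries] of u n * s^n. *)
Definition cpower (u : nat -> C) (t : R) : C :=
  (PSeries (fun n => Re (u n)) t, PSeries (fun n => Im (u n)) t).

Lemma CV_radius_geom (a : nat -> R) (R0 M t : R) : 0 < M ->
  (forall n, Rabs (a n) <= R0 * M ^ n) -> Rabs t * M < 1 ->
  Rbar_lt (Rabs t) (CV_radius a).
Proof.
intros HM Ha Ht.
apply Rbar_lt_le_trans with (Finite (/ M)).
- simpl; apply Rmult_lt_reg_r with M; [exact HM|]; rewrite Rinv_l by lra; exact Ht.
- apply (proj1 (CV_radius_bounded a)); exists R0; intros n.
  rewrite Rabs_mult, <- RPow_abs, (Rabs_right (/ M))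
    by (apply Rle_ge, Rlt_le, Rinv_0_lt_compat, HM).
  rewrite pow_inv by lra.
  assert (P : 0 < M ^ n) by (apply pow_lt, HM).
  apply Rmult_le_reg_r with (M ^ n); [exact P|].
  rewrite Rmult_assoc, Rinv_l by lra; rewrite Rmult_1_r; apply Ha.
Qed.

Lemma cpower_ext (u w : nat -> C) (t : R) : (forall n, u n = w n) -> cpower u t = cpower w t.
Proof.
intros H; apply injective_projections; simpl; apply PSeries_ext; intros n; now rewrite H.
Qed.

Section Bounded.

Context (R0 M t : R) (HM : 0 < M) (Ht : Rabs t * M < 1).

Lemma geom_bounded_Re (u : nat -> C) : geom_bounded R0 M u ->
  Rbar_lt (Rabs t) (CV_radius (fun n => Re (u n))).
Proof.
intros H; apply (CV_radius_geom _ R0 M); trivial.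
intros n; eapply Rle_trans; [apply Rabs_Re_le | apply H].
Qed.

Lemma geom_bounded_Im (u : nat -> C) : geom_bounded R0 M u ->
  Rbar_lt (Rabs t) (CV_radius (fun n => Im (u n))).
Proof.
intros H; apply (CV_radius_geom _ R0 M); trivial.
intros n; eapply Rle_trans; [apply Rabs_Im_le | apply H].
Qed.

Lemma cpower_derive (u : nat -> C) : geom_bounded R0 M u ->
  is_derive_RC (cpower u) t (cpower (fun n => RtoC (INR (S n)) * u (S n))%C t).
Proof.
intros H; apply is_derive_RC_iff; split.
- evar_last; [apply is_derive_PSeries, (geom_bounded_Re u H)|].
  apply PSeries_ext; intros n; unfold PS_derive; rewrite re_scal_l; ring.
- evar_last; [apply is_derive_PSeries, (geom_bounded_Im u H)|].
  apply PSeries_ext; intros n; unfold PS_derive; rewrite im_scal_l; ring.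
Qed.

Lemma cpower_conv (u w : nat -> C) : geom_bounded R0 M u -> geom_bounded R0 M w ->
  cpower (conv u w) t = (cpower u t * cpower w t)%C.
Proof.
intros Hu Hw.
assert (R1 := geom_bounded_Re u Hu); assert (I1 := geom_bounded_Im u Hu).
assert (R2 := geom_bounded_Re w Hw); assert (I2 := geom_bounded_Im w Hw).
apply injective_projections; simpl.
- rewrite (PSeries_ext _ _ t (Re_conv u w)), PSeries_minus by
    (apply ex_pseries_mult; assumption).
  now rewrite !PSeries_mult by assumption.
- rewrite (PSeries_ext _ _ t (Im_conv u w)), PSeries_plus by
    (apply ex_pseries_mult; assumption).
  now rewrite !PSeries_mult by assumption.
Qed.

Lemma cpower_comb (a b : C) (u w : nat -> C) :
  (forall v, v = u \/ v = w -> ex_pseries (fun n => Re (v n)) t /\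
    ex_pseries (fun n => Im (v n)) t) ->
  cpower (fun n => a * u n + b * w n)%C t = (a * cpower u t + b * cpower w t)%C.
Proof.
intros H; destruct (H u (or_introl eq_refl)) as [R1 I1].
destruct (H w (or_intror eq_refl)) as [R2 I2].
assert (S : forall (c : R) (v : nat -> R), ex_pseries v t -> ex_pseries (PS_scal c v) t).
{ intros c v Hv; apply (ex_pseries_scal (K := R_AbsRing) (V := R_NormedModule)); [|exact Hv].
  apply Rmult_comm. }
apply injective_projections; simpl.
- rewrite <- !PSeries_scal, <- !PSeries_minus, <- PSeries_plus; auto.
  + apply ex_pseries_minus; auto.
  + apply ex_pseries_minus; auto.
- rewrite <- !PSeries_scal, <- !PSeries_plus; auto.
  + apply ex_pseries_plus; auto.
  + apply ex_pseries_plus; auto.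
Qed.

Lemma conv_ex (u w : nat -> C) : geom_bounded R0 M u -> geom_bounded R0 M w ->
  ex_pseries (fun n => Re (conv u w n)) t /\ ex_pseries (fun n => Im (conv u w n)) t.
Proof.
intros Hu Hw.
assert (R1 := geom_bounded_Re u Hu); assert (I1 := geom_bounded_Im u Hu).
assert (R2 := geom_bounded_Re w Hw); assert (I2 := geom_bounded_Im w Hw).
split.
- eapply ex_pseries_ext; [intros n; symmetry; apply Re_conv|].
  apply ex_pseries_minus; apply ex_pseries_mult; assumption.
- eapply ex_pseries_ext; [intros n; symmetry; apply Im_conv|].
  apply ex_pseries_plus; apply ex_pseries_mult; assumption.
Qed.

End Bounded.

(** * The power series solution *)

(** The coefficients of t^n in the differential equation, solved for those of index n + 1 of the
    solution. *)
Definition next_coef (f : nat -> C * C) (n : nat) : C * C :=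
  let x := fun k => fst (f k) in
  let y := fun k => snd (f k) in
  (/ RtoC (INR (S n)) * (- c1 * conv x x n + c2 * conv x y n),
   / RtoC (INR (S n)) * (c3 * conv x y n + - c4 * conv y y n))%C.

(* [prefix m n] is correct up to index [n]. *)
Fixpoint prefix (m : C * C) (n : nat) : nat -> C * C :=
  match n with
  | O => fun _ => m
  | S j => fun k => if Nat.leb k j then prefix m j k else next_coef (prefix m j) j
  end.

Definition coef (m : C * C) (n : nat) : C * C := prefix m n n.

Lemma prefix_coef (m : C * C) (n k : nat) : (k <= n)%nat -> prefix m n k = coef m k.
Proof.
induction n as [|n IH]; intros Hk.
- now replace k with O by lia.
- cbn [prefix]; destruct (Nat.leb_spec k n) as [H | H]; [now apply IH|].
  replace k with (S n) by lia; unfold coef; cbn [prefix].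
  destruct (Nat.leb_spec (S n) n); [lia | reflexivity].
Qed.

Lemma next_coef_ext (f h : nat -> C * C) (n : nat) :
  (forall k, (k <= n)%nat -> f k = h k) -> next_coef f n = next_coef h n.
Proof.
intros H; unfold next_coef, conv.
assert (E : forall p q : C * C -> C, csum (fun k => p (f k) * q (f (n - k)%nat))%C n =
  csum (fun k => p (h k) * q (h (n - k)%nat))%C n).
{ intros p q; apply csum_ext; intros k Hk; rewrite !H by lia; reflexivity. }
now rewrite (E fst fst), (E fst snd), (E snd snd).
Qed.

Lemma coef_S (m : C * C) (n : nat) : coef m (S n) = next_coef (coef m) n.
Proof.
unfold coef at 1; cbn [prefix]; destruct (Nat.leb_spec (S n) n); [lia|].
apply next_coef_ext; intros k Hk; now apply prefix_coef.
Qed.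

Definition Kv : R := Cmod c1 + Cmod c2 + Cmod c3 + Cmod c4.

Lemma Kv_pos : 0 < Kv.
Proof.
assert (H : 0 < Cmod c1).
{ apply Cmod_gt_0; intros E; assert (E' : fst c1 = 0) by (rewrite E; reflexivity).
  unfold c1 in E'; simpl in E'; assert (P := PI_RGT_0); lra. }
unfold Kv; assert (P2 := Cmod_ge_0 c2); assert (P3 := Cmod_ge_0 c3).
assert (P4 := Cmod_ge_0 c4); lra.
Qed.

Lemma INR_S_neq_0 (n : nat) : RtoC (INR (S n)) <> RtoC 0.
Proof. intros E; apply (not_0_INR (S n)); [lia|].
apply (f_equal fst E). Qed.

(** The geometric bound reproduces itself: with M = Kv R0, the recursion gives at most Kv (n + 1)
    R0^2 M^n / (n + 1) = R0 M^(n+1). *)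
Lemma coef_bound (m : C * C) (R0 : R) : 0 < R0 -> Cmod (fst m) <= R0 -> Cmod (snd m) <= R0 ->
  forall n, Cmod (fst (coef m n)) <= R0 * (Kv * R0) ^ n /\
            Cmod (snd (coef m n)) <= R0 * (Kv * R0) ^ n.
Proof.
intros HR Hx Hy n; assert (HK := Kv_pos).
induction n as [n IH] using lt_wf_ind; destruct n as [|n].
- simpl; rewrite Rmult_1_r; auto.
- rewrite coef_S; set (M := Kv * R0) in *.
  assert (HM : 0 < M) by (unfold M; nra).
  assert (Hc : forall p q : C * C -> C, (p = fst \/ p = snd) -> (q = fst \/ q = snd) ->
    Cmod (conv (fun k => p (coef m k)) (fun k => q (coef m k)) n) <=
    INR (S n) * (R0 * R0 * M ^ n)).
  { intros p q Hp Hq; apply conv_bound; [lra | lra|]; intros k Hk.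
    destruct (IH k ltac:(lia)) as [B1 B2].
    destruct Hp as [-> | ->], Hq as [-> | ->]; auto. }
  assert (Hn : 0 < INR (S n)) by (apply lt_0_INR; lia).
  assert (E : R0 * M ^ S n = / INR (S n) * (Kv * (INR (S n) * (R0 * R0 * M ^ n)))).
  { simpl pow; unfold M at 1; field; lra. }
  assert (Hinv : Cmod (/ RtoC (INR (S n))) = / INR (S n)).
  { rewrite Cmod_inv by apply INR_S_neq_0; rewrite Cmod_R, Rabs_right; lra. }
  assert (Q1 := Cmod_ge_0 c1); assert (Q2 := Cmod_ge_0 c2).
  assert (Q3 := Cmod_ge_0 c3); assert (Q4 := Cmod_ge_0 c4).
  set (B := INR (S n) * (R0 * R0 * M ^ n)) in *.
  assert (HB : 0 <= B).
  { unfold B; apply Rmult_le_pos; [lra|]; apply Rmult_le_pos; [nra|]; apply pow_le; lra. }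
  assert (Hcomb : forall a b z w, Cmod z <= B -> Cmod w <= B -> Cmod a + Cmod b <= Kv ->
    Cmod (/ RtoC (INR (S n)) * (a * z + b * w)) <= R0 * M ^ S n).
  { intros a b z w Hz Hw Hab; rewrite E, Cmod_mult, Hinv.
    apply Rmult_le_compat_l; [apply Rlt_le, Rinv_0_lt_compat, Hn|].
    eapply Rle_trans; [apply Cmod_triangle|]; rewrite !Cmod_mult.
    assert (A := Cmod_ge_0 a); assert (A' := Cmod_ge_0 b).
    apply Rle_trans with ((Cmod a + Cmod b) * B); [nra|]; apply Rmult_le_compat_r; lra. }
  split; unfold next_coef; simpl fst; simpl snd; apply Hcomb.
  + apply (Hc fst fst); auto.
  + apply (Hc fst snd); auto.
  + rewrite Cmod_opp; unfold Kv; lra.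
  + apply (Hc fst snd); auto.
  + apply (Hc snd snd); auto.
  + rewrite Cmod_opp; unfold Kv; lra.
Qed.

Definition flow (m : C * C) (t : R) : C * C :=
  (cpower (fun n => fst (coef m n)) t, cpower (fun n => snd (coef m n)) t).

Lemma flow_0 (m : C * C) : flow m 0 = m.
Proof.
destruct m as [x y]; unfold flow, cpower; rewrite !PSeries_0; simpl.
now destruct x, y.
Qed.

Lemma flow_solution (m : C * C) (R0 : R) :
  0 < R0 -> Cmod (fst m) <= R0 -> Cmod (snd m) <= R0 ->
  solution (fun t => Rabs t * (Kv * R0) < 1) (flow m).
Proof.
intros HR Hx Hy; assert (HK := Kv_pos); set (M := Kv * R0).
assert (HM : 0 < M) by (unfold M; nra).
assert (Hb := coef_bound m R0 HR Hx Hy); fold M in Hb.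
assert (Gx : geom_bounded R0 M (fun n => fst (coef m n))) by (intros n; apply Hb).
assert (Gy : geom_bounded R0 M (fun n => snd (coef m n))) by (intros n; apply Hb).
split; [split|].
- apply (open_comp (fun t : R => Rabs t * M) (fun y => y < 1)); [|apply open_lt].
  intros x _; apply (continuous_mult (fun t : R => Rabs t) (fun _ => M));
    [apply continuous_Rabs | apply continuous_const].
- intros a b c Ha Hc Hbt.
  assert (Rabs b <= Rmax (Rabs a) (Rabs c)).
  { unfold Rmax, Rabs; repeat destruct Rcase_abs; destruct Rle_dec; lra. }
  revert H; unfold Rmax; destruct Rle_dec; intros H; nra.
- intros t Ht; simpl; split.
  + evar_last; [exact (cpower_derive R0 M t HM Ht _ Gx)|].
    rewrite v1_eq, <- !(cpower_conv R0 M t HM Ht) by assumption.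
    rewrite <- cpower_comb.
    * apply cpower_ext; intros n; assert (Hn := INR_S_neq_0 n).
      rewrite coef_S; unfold next_coef; cbv zeta; cbn [fst snd].
      set (N := RtoC (INR (S n))) in *; field; exact Hn.
    * intros v [-> | ->]; apply (conv_ex R0 M t HM Ht); assumption.
  + evar_last; [exact (cpower_derive R0 M t HM Ht _ Gy)|].
    rewrite v2_eq, <- !(cpower_conv R0 M t HM Ht) by assumption.
    rewrite <- cpower_comb.
    * apply cpower_ext; intros n; assert (Hn := INR_S_neq_0 n).
      rewrite coef_S; unfold next_coef; cbv zeta; cbn [fst snd].
      set (N := RtoC (INR (S n))) in *; field; exact Hn.
    * intros v [-> | ->]; apply (conv_ex R0 M t HM Ht); assumption.
Qed.

Lemma solution_exists (m : C * C) : exists J gam, solution J gam /\ J 0 /\ gam 0 = m.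
Proof.
set (R0 := 1 + Cmod (fst m) + Cmod (snd m)).
assert (P1 := Cmod_ge_0 (fst m)); assert (P2 := Cmod_ge_0 (snd m)).
exists (fun t => Rabs t * (Kv * R0) < 1), (flow m); split; [|split].
- apply flow_solution; unfold R0; lra.
- rewrite Rabs_R0; lra.
- apply flow_0.
Qed.

Lemma trajectory_exists (m : C * C) : exists I gam, trajectory I gam /\ I 0 /\ gam 0 = m.
Proof.
destruct (solution_exists m) as [J [gam [HJ [J0 E]]]].
destruct (trajectory_extending J gam HJ J0) as [I [gam' [HI H]]].
exists I, gam'; destruct (H 0 J0) as [I0 E0]; rewrite E0; auto.
Qed.

(** * Complex time and the trajectory connecting two directions *)

Lemma cpow_diff_bound (s s' : C) (r : R) (n : nat) : Cmod s <= r -> Cmod s' <= r ->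
  Cmod (Cpow s (S n) - Cpow s' (S n))%C <= INR (S n) * r ^ n * Cmod (s - s')%C.
Proof.
intros Hs Hs'; assert (P := Cmod_ge_0 s); assert (D := Cmod_ge_0 (s - s')%C).
assert (Hpow : forall k, Cmod (Cpow s k) <= r ^ k).
{ intros k; rewrite Cmod_pow; apply pow_incr; lra. }
induction n as [|n IH].
- simpl; rewrite !Cmult_1_r; lra.
- replace (Cpow s (S (S n)) - Cpow s' (S (S n)))%C
    with ((s - s') * Cpow s (S n) + s' * (Cpow s (S n) - Cpow s' (S n)))%C
    by (simpl; ring).
  eapply Rle_trans; [apply Cmod_triangle|]; rewrite !Cmod_mult.
  assert (H1 := Hpow (S n)); assert (P' := Cmod_ge_0 s').
  assert (H2 : Cmod s' * Cmod (Cpow s (S n) - Cpow s' (S n))%C <=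
    r * (INR (S n) * r ^ n * Cmod (s - s')%C)).
  { apply Rmult_le_compat; trivial; apply Cmod_ge_0. }
  rewrite (S_INR (S n)).
  assert (H3 : Cmod (s - s')%C * Cmod (Cpow s (S n)) <= Cmod (s - s')%C * r ^ S n).
  { apply Rmult_le_compat_l; trivial. }
  simpl pow in *; lra.
Qed.

Lemma half_geom : ex_series (fun n => (1 / 2) ^ n) /\ Series (fun n => (1 / 2) ^ n) = 2.
Proof.
assert (H : Rabs (1 / 2) < 1) by (rewrite Rabs_right; lra).
split; [now apply ex_series_geom | rewrite Series_geom by exact H; field].
Qed.

Lemma series_summable (u : nat -> C) (R0 M r : R) (s : C) : 0 <= R0 -> 0 <= M ->
  geom_bounded R0 M u -> Cmod s <= r -> 4 * (M * r) <= 1 ->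
  summable (fun n => u n * Cpow s n)%C.
Proof.
intros HR HM Hu Hs Hr.
apply summable_le with (fun n => R0 * (1 / 2) ^ n).
- intros n; rewrite Cmod_mult, Cmod_pow; assert (P := Cmod_ge_0 s).
  apply Rle_trans with (R0 * M ^ n * Cmod s ^ n).
  + apply Rmult_le_compat_r; [apply pow_le, P | apply Hu].
  + rewrite Rmult_assoc, <- Rpow_mult_distr; apply Rmult_le_compat_l; [exact HR|].
    apply pow_incr; nra.
- apply (ex_series_scal (K := R_AbsRing) (V := R_NormedModule)), half_geom.
Qed.

Lemma INR_le_pow2 (k : nat) : INR (S (S k)) <= 2 * 2 ^ k.
Proof.
induction k as [|k IH]; [simpl; lra|].
rewrite S_INR; simpl pow; assert (H := pow_R1_Rle 2 k ltac:(lra)); lra.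
Qed.

(** Strict differentiability at 0, with an error proportional to r: the slope estimate needed for a
    contraction. Only indices n + 2 contribute, each at most B (n + 2) (M r)^n with n + 2 <= 2 * 2^n
    and M r <= 1/4, hence below 4 B / 2^n. The majorant 16 B / 2^n over all indices sums to 32 B,
    and [cseries_bound] doubles it. *)
Lemma series_strict_derivative (u : nat -> C) (R0 M r : R) (s s' : C) : 0 <= R0 -> 0 <= M ->
  geom_bounded R0 M u -> Cmod s <= r -> Cmod s' <= r -> 4 * (M * r) <= 1 ->
  Cmod (cseries (fun n => u n * Cpow s n) - cseries (fun n => u n * Cpow s' n)
    - u 1%nat * (s - s'))%C <= 64 * R0 * M * M * r * Cmod (s - s')%C.
Proof.
intros HR HM Hu Hs Hs' Hr.
assert (S1 := series_summable u R0 M r s HR HM Hu Hs Hr).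
assert (S2 := series_summable u R0 M r s' HR HM Hu Hs' Hr).
rewrite <- cseries_minus by assumption.
(* The linear term, written as a series supported at index 1, so that the whole left-hand side
   becomes a single series. *)
set (d := fun n => match n with 1%nat => u 1%nat * (s - s') | _ => RtoC 0 end%C).
assert (Hd : summable d /\ cseries d = (u 1%nat * (s - s'))%C).
{ assert (Hfin : forall a : nat -> R, a 0%nat = 0 -> (forall n, a (S (S n)) = 0) ->
    is_series a (a 1%nat)).
  { intros a H0 H2; change (is_lim_seq (sum_n a) (Finite (a 1%nat))).
    apply is_lim_seq_ext_loc with (fun _ => a 1%nat); [|apply is_lim_seq_const].
    exists 1%nat; intros n Hn; destruct n as [|n]; [lia|]; clear Hn.
    induction n as [|n IH]; [rewrite sum_Sn, sum_O, H0; unfold plus; simpl; ring|].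
    rewrite sum_Sn, <- IH, H2; unfold plus; simpl; ring. }
  split.
  - eexists; apply (Hfin (fun n => Cmod (d n))); simpl; intros; apply Cmod_0.
  - apply injective_projections; simpl; apply is_series_unique.
    + apply (Hfin (fun n => Re (d n))); simpl; reflexivity.
    + apply (Hfin (fun n => Im (d n))); simpl; reflexivity. }
destruct Hd as [Sd Ed]; rewrite <- Ed.
assert (S12 : summable (fun n => u n * Cpow s n - u n * Cpow s' n)%C).
{ apply summable_le with (fun n => Cmod (u n * Cpow s n) + Cmod (u n * Cpow s' n)).
  - intros n; eapply Rle_trans; [apply Cmod_triangle|]; rewrite Cmod_opp; lra.
  - now apply (ex_series_plus (K := R_AbsRing) (V := R_NormedModule)). }
rewrite <- cseries_minus by assumption.
set (D := Cmod (s - s')%C); assert (HD := Cmod_ge_0 (s - s')%C); fold D in HD.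
assert (Hr0 : 0 <= r) by (assert (P := Cmod_ge_0 s); lra).
set (B := R0 * M * M * r * D).
assert (HB : 0 <= B) by (unfold B; repeat apply Rmult_le_pos; assumption).
eapply Rle_trans; [apply cseries_bound with (b := fun n => 16 * B * (1 / 2) ^ n)|].
- intros n; destruct n as [|[|n]].
  + simpl; replace (u 0%nat * 1 - u 0%nat * 1 - 0)%C with (RtoC 0) by ring.
    rewrite Cmod_0; lra.
  + simpl; replace (u 1%nat * (s * 1) - u 1%nat * (s' * 1) - u 1%nat * (s - s'))%C
      with (RtoC 0) by ring.
    rewrite Cmod_0; lra.
  + unfold d; replace (u (S (S n)) * Cpow s (S (S n)) - u (S (S n)) * Cpow s' (S (S n)) - 0)%C
      with (u (S (S n)) * (Cpow s (S (S n)) - Cpow s' (S (S n))))%C by ring.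
    rewrite Cmod_mult.
    apply Rle_trans with ((R0 * M ^ S (S n)) * (INR (S (S n)) * r ^ S n * D)).
    { apply Rmult_le_compat; try apply Cmod_ge_0; [apply Hu|].
      now apply (cpow_diff_bound s s' r (S n)). }
    replace (R0 * M ^ S (S n) * (INR (S (S n)) * r ^ S n * D))
      with (B * (INR (S (S n)) * (M * r) ^ n))
      by (unfold B; rewrite Rpow_mult_distr; simpl pow; ring).
    replace (16 * B * (1 / 2) ^ S (S n)) with (B * (4 * (1 / 2) ^ n)) by (simpl; field).
    apply Rmult_le_compat_l; [exact HB|].
    assert (Hq : 0 <= M * r <= 1 / 4) by (split; [apply Rmult_le_pos; lra | lra]).
    assert (Hq1 := pow_incr (M * r) (1 / 4) n Hq).
    assert (Hq0 := pow_le (M * r) n (proj1 Hq)).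
    assert (Hn := INR_le_pow2 n); assert (H2 := pow_lt 2 n ltac:(lra)).
    assert (E : 2 ^ n * (1 / 4) ^ n = (1 / 2) ^ n).
    { rewrite <- Rpow_mult_distr; f_equal; field. }
    assert (H12 := pow_lt (1 / 2) n ltac:(lra)).
    apply Rle_trans with (2 * 2 ^ n * (1 / 4) ^ n); [|lra].
    apply Rmult_le_compat; trivial; apply pos_INR.
- apply (ex_series_scal (K := R_AbsRing) (V := R_NormedModule)), half_geom.
- rewrite (Series_scal_l (16 * B) (fun n => (1 / 2) ^ n)), (proj2 half_geom); unfold B; lra.
Qed.

(** Banach's theorem on a disc. The disc is preserved because r/2 + r/2 = r, and the limit of the
    iterates from 0 is the sum of their successive differences. *)
Lemma contraction_fixed_point (N : C -> C) (r : R) : 0 < r ->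
  (forall s s', Cmod s <= r -> Cmod s' <= r ->
    Cmod (N s - N s')%C <= 1 / 2 * Cmod (s - s')%C) ->
  Cmod (N 0%C) <= r / 2 -> exists s, Cmod s <= r /\ N s = s.
Proof.
intros Hr HN H0.
assert (Hball : forall s, Cmod s <= r -> Cmod (N s) <= r).
{ intros s Hs; replace (N s) with ((N s - N 0%C) + N 0%C)%C by ring.
  eapply Rle_trans; [apply Cmod_triangle|].
  assert (H := HN s 0%C Hs ltac:(rewrite Cmod_0; lra)).
  replace (s - 0)%C with s in H by ring; lra. }
set (it := fun n => Nat.iter n N 0%C).
assert (Hit : forall n, Cmod (it n) <= r).
{ intros n; induction n as [|n IH]; [unfold it; simpl; rewrite Cmod_0; lra | apply Hball, IH]. }
set (d := fun n => (it (S n) - it n)%C).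
assert (Hd : forall n, Cmod (d n) <= r * (1 / 2) ^ n).
{ intros n; induction n as [|n IH].
  - unfold d, it; simpl; replace (N 0 - 0)%C with (N 0%C) by ring; lra.
  - unfold d; eapply Rle_trans; [exact (HN (it (S n)) (it n) (Hit _) (Hit _))|].
    fold (d n); simpl pow; lra. }
assert (Sd : summable d).
{ apply summable_le with (fun n => r * (1 / 2) ^ n); [exact Hd|].
  apply (ex_series_scal (K := R_AbsRing) (V := R_NormedModule)), half_geom. }
set (L := cseries d).
(* Here p stands for the real or the imaginary part; additivity lets the series of differences
   telescope. *)
assert (HL : forall p : C -> R, (forall z w, p (z - w)%C = p z - p w) ->
  forall l, is_series (fun n => p (d n)) l -> p 0%C = 0 -> is_lim_seq (fun n => p (it n)) l).
{ intros p Hp l Hl Hp0; apply is_lim_seq_incr_1.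
  eapply is_lim_seq_ext; [|exact Hl].
  intros n; induction n as [|n IH].
  - rewrite sum_O; unfold d; rewrite Hp; unfold it at 2; simpl; rewrite Hp0; ring.
  - rewrite sum_Sn, IH; unfold d, plus; simpl; rewrite Hp; simpl; ring. }
assert (HRe : is_lim_seq (fun n => Re (it n)) (Re L)).
{ apply HL; [reflexivity | apply Series_correct, summable_Re, Sd | reflexivity]. }
assert (HIm : is_lim_seq (fun n => Im (it n)) (Im L)).
{ apply HL; [reflexivity | apply Series_correct, summable_Im, Sd | reflexivity]. }
assert (Hclose : forall eps, 0 < eps -> exists n0, forall n, (n0 <= n)%nat ->
  Cmod (it n - L)%C < eps).
{ apply is_lim_seq_spec in HRe; apply is_lim_seq_spec in HIm; intros eps He; set (e2 := mkposreal (eps / 2) ltac:(lra)).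
  destruct (HRe e2) as [n1 H1].
  destruct (HIm e2) as [n2 H2].
  exists (n1 + n2)%nat; intros n Hn.
  assert (H1' := H1 n ltac:(lia)); assert (H2' := H2 n ltac:(lia)); simpl in H1', H2'.
  eapply Rle_lt_trans; [apply Cmod_le_Re_Im|].
  unfold Re, Im, Rminus in *; simpl; lra. }
assert (HLr : Cmod L <= r).
{ apply Rnot_lt_le; intros Hlt.
  destruct (Hclose (Cmod L - r) ltac:(lra)) as [n Hn].
  assert (H1 := Hn n (le_n n)); assert (H2 := Hit n).
  assert (H3 := Cmod_triangle (it n) (- (it n - L))%C); rewrite Cmod_opp in H3.
  replace (it n + - (it n - L))%C with L in H3 by ring; lra. }
exists L; split; [exact HLr|].
assert (HE : Cmod (N L - L)%C = 0).
{ apply Rle_antisym; [|apply Cmod_ge_0]; apply Rnot_lt_le; intros Hlt.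
  destruct (Hclose (Cmod (N L - L)%C / 2) ltac:(lra)) as [n Hn].
  assert (H1 := Hn n (le_n n)); assert (H2 := Hn (S n) (le_S _ _ (le_n n))).
  assert (H3 := HN (it n) L (Hit n) HLr).
  change (N (it n)) with (it (S n)) in H3.
  assert (H4 := Cmod_triangle (it (S n) - L)%C (- (it (S n) - N L))%C); rewrite Cmod_opp in H4.
  replace (it (S n) - L + - (it (S n) - N L))%C with (N L - L)%C in H4 by ring; lra. }
apply Cmod_eq_0 in HE; rewrite <- (Cplus_0_r L) at 2; rewrite <- HE; ring.
Qed.

Lemma conv_scale (s : C) (u w : nat -> C) (n : nat) :
  conv (fun k => Cpow s (S k) * u k)%C (fun k => Cpow s (S k) * w k)%C n =
  (Cpow s (S (S n)) * conv u w n)%C.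
Proof.
unfold conv; rewrite <- csum_scal; apply csum_ext; intros k Hk.
replace (S (S n)) with (S k + S (n - k))%nat by lia; rewrite Cpow_add_r; ring.
Qed.

(** For a quadratic field s * gam (s * t) is a solution whenever gam is. On coefficients this is an
    algebraic identity, so it holds for complex s although solutions are known in real time only. *)
Lemma coef_scale (s : C) (m : C * C) (n : nat) :
  coef (s * fst m, s * snd m)%C n =
  (Cpow s (S n) * fst (coef m n), Cpow s (S n) * snd (coef m n))%C.
Proof.
induction n as [n IH] using lt_wf_ind; destruct n as [|n].
- unfold coef; simpl; f_equal; ring.
- rewrite !coef_S.
  rewrite (next_coef_ext _ (fun k => (Cpow s (S k) * fst (coef m k),
    Cpow s (S k) * snd (coef m k))%C)) by (intros; apply IH; lia).
  unfold next_coef; cbv zeta; cbn [fst snd]; rewrite !conv_scale; f_equal; ring.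
Qed.

Lemma flow_scale_1 (s : C) (m : C * C) (R0 M : R) : 0 <= R0 -> 0 <= M ->
  geom_bounded R0 M (fun n => fst (coef m n)) -> geom_bounded R0 M (fun n => snd (coef m n)) ->
  4 * (M * Cmod s) <= 1 ->
  flow (s * fst m, s * snd m)%C 1 =
  (s * cseries (fun n => fst (coef m n) * Cpow s n),
   s * cseries (fun n => snd (coef m n) * Cpow s n))%C.
Proof.
intros HR HM Hx Hy Hs.
assert (Hc : forall u, cpower u 1 = cseries u).
{ intros u; apply injective_projections; simpl; apply Series_ext; intros n;
  rewrite pow1; ring. }
unfold flow; rewrite !Hc.
rewrite <- !cseries_scal by
  (apply (series_summable _ R0 M (Cmod s)); trivial; lra).
f_equal; apply cseries_ext; intros n; rewrite coef_scale; simpl; ring.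
Qed.

Lemma coef_1 (m : C * C) : coef m 1 = (v1 (fst m) (snd m), v2 (fst m) (snd m)).
Proof.
rewrite coef_S, v1_eq, v2_eq; unfold next_coef, conv, coef; simpl.
f_equal; field; apply C1_nz.
Qed.

Lemma eventually_small (a b : R) : 0 < b -> exists r, 0 < r /\
  forall s, 0 <= s <= r -> a * s <= b.
Proof.
intros Hb; assert (Ha := Rabs_pos a).
exists (b / (Rabs a + 1)); split.
- apply Rdiv_lt_0_compat; lra.
- intros s Hs; apply Rle_trans with (Rabs a * s).
  { apply Rmult_le_compat_r; [lra | apply Rle_abs]. }
  assert (E : b = (Rabs a + 1) * (b / (Rabs a + 1))) by (field; lra).
  rewrite E; nra.
Qed.

(* The direction of [m1] is reached from a complex multiple of [m0]: by homogeneity the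
   trajectories from [s * m0] at time 1 are [s] times the complex-time flow of [m0] at [s],
   whose projection to [x / y] has nonzero derivative at [s = 0]. *)
Lemma trajectory_connect (m0 : C * C) (eps : R) : ~ calC m0 -> 0 < eps ->
  exists del, 0 < del /\ forall m1 : C * C,
  Cmod (fst m1 - fst m0)%C <= del -> Cmod (snd m1 - snd m0)%C <= del ->
  exists s mu : C, Cmod (mu - 1)%C < eps /\
    ((s = RtoC 0 /\ m0 = (mu * fst m1, mu * snd m1)%C) \/
     (s <> RtoC 0 /\ exists J gam, solution J gam /\ J 0 /\ J 1 /\
       gam 0 = (s * fst m0, s * snd m0)%C /\
       gam 1 = (s * (mu * fst m1), s * (mu * snd m1))%C)).
Proof.
intros Hm0 Heps.
set (x0 := fst m0); set (y0 := snd m0).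
assert (Hy0 : y0 <> RtoC 0) by (intros E; apply Hm0; right; right; exact E).
assert (Ny0 := proj1 (Cmod_gt_0 _) Hy0).
set (R0 := Cmod x0 + Cmod y0); set (M := Kv * R0).
assert (Nx0 := Cmod_ge_0 x0); assert (HK := Kv_pos).
assert (HR : 0 < R0) by (unfold R0; lra).
assert (HM : 0 < M) by (unfold M; nra).
assert (Hb := coef_bound m0 R0 HR ltac:(unfold R0, x0 in *; lra) ltac:(unfold R0, y0 in *; lra)).
fold M in Hb.
assert (Gx : geom_bounded R0 M (fun n => fst (coef m0 n))) by (intros n; apply Hb).
assert (Gy : geom_bounded R0 M (fun n => snd (coef m0 n))) by (intros n; apply Hb).
set (X := fun s => cseries (fun n => fst (coef m0 n) * Cpow s n)%C).
set (Y := fun s => cseries (fun n => snd (coef m0 n) * Cpow s n)%C).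
set (X1 := fst (coef m0 1)); set (Y1 := snd (coef m0 1)).
assert (BX1 : Cmod X1 <= R0 * M) by (assert (H := Gx 1%nat); simpl in H; rewrite Rmult_1_r in H; exact H).
assert (BY1 : Cmod Y1 <= R0 * M) by (assert (H := Gy 1%nat); simpl in H; rewrite Rmult_1_r in H; exact H).
(* D / y0^2 is the velocity of x / y at m0, which does not vanish off [calC]. *)
set (D := (X1 * y0 - x0 * Y1)%C).
assert (HD : 0 < Cmod D).
{ apply Cmod_gt_0; intros E; apply (g_speed_neq_0 m0 Hm0).
  rewrite (surjective_pairing m0), <- g_speed_eq by exact Hy0.
  fold x0 y0; unfold D, X1, Y1 in E; rewrite coef_1 in E; simpl in E; fold x0 y0 in E.
  replace (v1 x0 y0 * / y0 + x0 * (- v2 x0 y0 / (y0 * y0)))%C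
    with ((v1 x0 y0 * y0 - x0 * v2 x0 y0) / (y0 * y0))%C by (field; exact Hy0).
  rewrite E; field; exact Hy0. }
set (d := Cmod D) in *; set (E := 64 * R0 * M * M).
assert (HE : 0 <= E) by (unfold E; repeat apply Rmult_le_pos; lra).
destruct (eventually_small (4 * M) 1 ltac:(lra)) as [r1 [Pr1 Hr1]].
destruct (eventually_small (2 * R0 * E) (d / 4) ltac:(lra)) as [r2 [Pr2 Hr2]].
destruct (eventually_small (R0 * M + E) (eps * Cmod y0 / 8) ltac:(nra)) as [r3 [Pr3 Hr3]].
(* Here [r1] ensures convergence, [r2] keeps the nonlinear error of H below d / 4, and [r3] keeps Y
   s close to y0. *)
set (r := Rmin 1 (Rmin r1 (Rmin r2 r3))).
assert (Pr : 0 < r) by (unfold r; repeat apply Rmin_pos; lra).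
assert (Lr : r <= 1 /\ r <= r1 /\ r <= r2 /\ r <= r3).
{ unfold r, Rmin; repeat destruct Rle_dec; lra. }
specialize (Hr1 r ltac:(lra)); specialize (Hr2 r ltac:(lra)); specialize (Hr3 r ltac:(lra)).
destruct (eventually_small (2 * R0 * M) (d / 4) ltac:(lra)) as [e1 [Pe1 He1]].
destruct (eventually_small R0 (d * r / 2) ltac:(nra)) as [e2 [Pe2 He2]].
destruct (eventually_small 1 (eps * Cmod y0 / 8) ltac:(nra)) as [e3 [Pe3 He3]].
(* Here [e1] bounds by d / 4 the error of using D instead of the derivative belonging to m1, [e2]
   makes H 0 at most d r / 2, and [e3] keeps y1 close to y0. The first two bounds give |x1| + |y1|
   <= 2 R0 and |y1| >= |y0| / 2. *)
set (del := Rmin (R0 / 2) (Rmin (Cmod y0 / 2) (Rmin e1 (Rmin e2 e3)))).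
assert (Pdel : 0 < del) by (unfold del; repeat apply Rmin_pos; lra).
assert (Ldel : del <= R0 / 2 /\ del <= Cmod y0 / 2 /\ del <= e1 /\ del <= e2 /\ del <= e3).
{ unfold del, Rmin; repeat destruct Rle_dec; lra. }
specialize (He1 del ltac:(lra)); specialize (He2 del ltac:(lra)); specialize (He3 del ltac:(lra)).
exists del; split; [exact Pdel|]; intros m1 Hx1 Hy1.
fold x0 in Hx1; fold y0 in Hy1; set (x1 := fst m1) in *; set (y1 := snd m1) in *.
assert (Bx1 : Cmod x1 <= Cmod x0 + del).
{ replace x1 with (x0 + (x1 - x0))%C by ring; eapply Rle_trans; [apply Cmod_triangle | lra]. }
assert (By1 : Cmod y1 <= Cmod y0 + del).
{ replace y1 with (y0 + (y1 - y0))%C by ring; eapply Rle_trans; [apply Cmod_triangle | lra]. }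
assert (By1' : Cmod y0 / 2 <= Cmod y1).
{ assert (H := Cmod_triangle y1 (- (y1 - y0))%C); rewrite Cmod_opp in H.
  replace (y1 + - (y1 - y0))%C with y0 in H by ring; lra. }
assert (Ny1 : y1 <> RtoC 0) by (apply Cmod_gt_0; lra).
assert (HXs := fun s s' Hs Hs' => series_strict_derivative _ R0 M r s s'
  (Rlt_le _ _ HR) (Rlt_le _ _ HM) Gx Hs Hs' ltac:(lra)).
assert (HYs := fun s s' Hs Hs' => series_strict_derivative _ R0 M r s s'
  (Rlt_le _ _ HR) (Rlt_le _ _ HM) Gy Hs Hs' ltac:(lra)).
cbv beta in HXs, HYs; fold E in HXs, HYs.
assert (HS0 : forall p : C * C -> C, cseries (fun n => p (coef m0 n) * Cpow 0 n)%C = p m0).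
{ intros p.
  assert (Hz : forall a : nat -> R, (forall n, a (S n) = 0) -> Series a = a 0%nat).
  { intros a Ha; apply is_series_unique; change (is_lim_seq (sum_n a) (Finite (a 0%nat))).
    apply is_lim_seq_ext with (fun _ => a 0%nat); [|apply is_lim_seq_const].
    intros n; induction n as [|n IH]; [now rewrite sum_O|].
    rewrite sum_Sn, <- IH, Ha; unfold plus; simpl; ring. }
  unfold cseries; rewrite !Hz.
  - unfold coef; simpl; destruct (p m0) as [a b]; simpl; f_equal; ring.
  - intros n; simpl; ring.
  - intros n; simpl; ring. }
assert (HX0 : X 0%C = x0) by (apply (HS0 fst)).
assert (HY0 : Y 0%C = y0) by (apply (HS0 snd)).
(* A zero s of H says that (X s, Y s) is proportional to m1. The estimate below says that H has
   slope D up to an error of d / 2. *)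
set (H := fun s => (X s * y1 - x1 * Y s)%C).
assert (HH : forall s s', Cmod s <= r -> Cmod s' <= r ->
  Cmod (H s - H s' - D * (s - s'))%C <= d / 2 * Cmod (s - s')%C).
{ intros s s' Hs Hs'; assert (A1 := HXs s s' Hs Hs'); assert (A2 := HYs s s' Hs Hs').
  fold (X s) (X s') (X1) in A1; fold (Y s) (Y s') (Y1) in A2.
  assert (PD := Cmod_ge_0 (s - s')%C).
  replace (H s - H s' - D * (s - s'))%C with
    (y1 * (X s - X s' - X1 * (s - s')) + (- x1) * (Y s - Y s' - Y1 * (s - s')) +
     ((X1 * (y1 - y0)) * (s - s') + (- Y1 * (x1 - x0)) * (s - s')))%C
    by (unfold H, D; ring).
  eapply Rle_trans; [apply Cmod_triangle|].
  eapply Rle_trans; [apply Rplus_le_compat; apply Cmod_triangle|].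
  rewrite !Cmod_mult, !Cmod_opp.
  set (del' := Cmod (s - s')%C) in *.
  assert (F1 : Cmod y1 * Cmod (X s - X s' - X1 * (s - s'))%C <= Cmod y1 * (E * r * del'))
    by (apply Rmult_le_compat_l; [apply Cmod_ge_0 | exact A1]).
  assert (F2 : Cmod x1 * Cmod (Y s - Y s' - Y1 * (s - s'))%C <= Cmod x1 * (E * r * del'))
    by (apply Rmult_le_compat_l; [apply Cmod_ge_0 | exact A2]).
  assert (F3 : Cmod X1 * Cmod (y1 - y0)%C * del' <= R0 * M * del * del').
  { apply Rmult_le_compat_r; [exact PD|]; apply Rmult_le_compat; trivial; apply Cmod_ge_0. }
  assert (F4 : Cmod Y1 * Cmod (x1 - x0)%C * del' <= R0 * M * del * del').
  { apply Rmult_le_compat_r; [exact PD|]; apply Rmult_le_compat; trivial; apply Cmod_ge_0. }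
  assert (F5 : (Cmod y1 + Cmod x1) * (E * r * del') <= 2 * R0 * (E * r * del')).
  { apply Rmult_le_compat_r; [|unfold R0 in *; lra].
    apply Rmult_le_pos; [apply Rmult_le_pos; lra | exact PD]. }
  assert (F6 : (2 * R0 * E * r + 2 * R0 * M * del) * del' <= d / 2 * del')
    by (apply Rmult_le_compat_r; lra).
  lra. }
assert (HDn : D <> RtoC 0) by (apply Cmod_gt_0, HD).
(* Newton's iteration with the derivative frozen at D; its fixed points are the zeros of H. *)
destruct (contraction_fixed_point (fun s => s - H s / D)%C r Pr) as [s [Hs Hfix]].
- intros s s' Hs Hs'; assert (A := HH s s' Hs Hs').
  replace (s - H s / D - (s' - H s' / D))%C with (- (H s - H s' - D * (s - s')) / D)%C
    by (field; exact HDn).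
  rewrite Cmod_div by exact HDn; rewrite Cmod_opp; fold d.
  apply Rmult_le_reg_r with d; [exact HD|].
  unfold Rdiv at 1; rewrite Rmult_assoc, Rinv_l by lra; lra.
- assert (EH : H 0%C = (x0 * (y1 - y0) + - ((x1 - x0) * y0))%C)
    by (unfold H; rewrite HX0, HY0; ring).
  replace (0 - H 0 / D)%C with (- H 0%C / D)%C by (field; exact HDn).
  rewrite Cmod_div by exact HDn; rewrite Cmod_opp; fold d.
  apply Rmult_le_reg_r with d; [exact HD|].
  unfold Rdiv at 1; rewrite Rmult_assoc, Rinv_l by lra; rewrite EH, Rmult_1_r.
  eapply Rle_trans; [apply Cmod_triangle|]; rewrite Cmod_opp, !Cmod_mult.
  assert (F1 : Cmod x0 * Cmod (y1 - y0)%C <= Cmod x0 * del)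
    by (apply Rmult_le_compat_l; lra).
  assert (F2 : Cmod (x1 - x0)%C * Cmod y0 <= del * Cmod y0)
    by (apply Rmult_le_compat_r; lra).
  unfold R0 in He2; lra.
- assert (HHs : H s = RtoC 0).
  { replace (H s) with ((s - (s - H s / D)) * D)%C by (field; exact HDn).
    rewrite Hfix; ring. }
  set (mu := (Y s / y1)%C).
  assert (EY : Y s = (mu * y1)%C) by (unfold mu; field; exact Ny1).
  assert (EX : X s = (mu * x1)%C).
  { replace (X s) with ((H s + x1 * Y s) / y1)%C by (unfold H; field; exact Ny1).
    rewrite HHs; unfold mu; field; exact Ny1. }
  exists s, mu; split.
  + assert (A := HYs s 0%C Hs ltac:(rewrite Cmod_0; lra)).
    fold (Y s) (Y 0%C) Y1 in A; rewrite HY0 in A.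
    replace (s - 0)%C with s in A by ring.
    assert (PS := Cmod_ge_0 s).
    assert (B1 : Cmod (Y s - y0)%C <= (R0 * M + E) * r).
    { replace (Y s - y0)%C with ((Y s - y0 - Y1 * s) + Y1 * s)%C by ring.
      eapply Rle_trans; [apply Cmod_triangle|]; rewrite Cmod_mult.
      assert (Cmod Y1 * Cmod s <= R0 * M * r)
        by (apply Rmult_le_compat; trivial; apply Cmod_ge_0).
      assert (E * r * Cmod s <= E * r * r)
        by (apply Rmult_le_compat_l; [apply Rmult_le_pos; lra | exact Hs]).
      assert (E * r * r <= E * r)
        by (rewrite <- (Rmult_1_r (E * r)) at 2; apply Rmult_le_compat_l;
            [apply Rmult_le_pos; lra | lra]).
      lra. }
    assert (B2 : Cmod (Y s - y1)%C <= eps * Cmod y0 / 4).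
    { replace (Y s - y1)%C with ((Y s - y0) + - (y1 - y0))%C by ring.
      eapply Rle_trans; [apply Cmod_triangle|]; rewrite Cmod_opp; lra. }
    replace (mu - 1)%C with ((Y s - y1) / y1)%C by (unfold mu; field; exact Ny1).
    rewrite Cmod_div by exact Ny1.
    apply Rmult_lt_reg_r with (Cmod y1); [lra|].
    unfold Rdiv at 1; rewrite Rmult_assoc, Rinv_l by lra; rewrite Rmult_1_r.
    eapply Rle_lt_trans; [exact B2|]; nra.
  (* For s = 0 the trajectory from s * m0 would sit at the origin, and m0 is itself the required
     multiple of m1. *)
  + destruct (Ceq_dec s 0%C) as [Es | Es].
    * left; split; [exact Es|]; rewrite Es in EX, EY.
      rewrite HX0 in EX; rewrite HY0 in EY.
      apply injective_projections; simpl; assumption.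
    * right; split; [exact Es|].
      assert (Ps := proj1 (Cmod_gt_0 _) Es).
      set (R1 := Cmod s * R0); assert (HR1 : 0 < R1) by (unfold R1; nra).
      exists (fun t => Rabs t * (Kv * R1) < 1), (flow (s * x0, s * y0)%C).
      split; [|split; [|split; [|split]]].
      -- apply flow_solution; trivial; simpl; rewrite Cmod_mult; unfold R1;
         apply Rmult_le_compat_l; unfold R0; lra.
      -- rewrite Rabs_R0; lra.
      -- rewrite Rabs_R1; replace (1 * (Kv * R1)) with (M * Cmod s)
           by (unfold M, R1; ring).
         assert (M * Cmod s <= M * r) by (apply Rmult_le_compat_l; lra); lra.
      -- apply flow_0.
      -- unfold x0, y0; rewrite (flow_scale_1 s m0 R0 M); try assumption; try lra.
         ++ fold (X s) (Y s); rewrite EX, EY; reflexivity.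
         ++ assert (M * Cmod s <= M * r) by (apply Rmult_le_compat_l; lra); lra.
Qed.

(** * Angles *)

Lemma has_angle_polar (r theta : R) (a : C) : 0 < r ->
  a = (r * cos theta, r * sin theta) -> has_angle a theta.
Proof.
intros Hr Ha.
assert (E : Cmod a = r).
{ assert (H := Cmod_sqr a); rewrite Ha in H at 3 4 5 6; unfold Re, Im in H; simpl in H.
  assert (P := Cmod_ge_0 a); assert (S := sin2_cos2 theta); unfold Rsqr in S; nra. }
split; [|now rewrite E].
apply Cmod_gt_0; lra.
Qed.

Lemma has_angle_mult (a b : C) (s t : R) :
  has_angle a s -> has_angle b t -> has_angle (a * b)%C (s + t).
Proof.
intros [Na Ea] [Nb Eb]; apply Cmod_gt_0 in Na; apply Cmod_gt_0 in Nb.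
apply has_angle_polar with (Cmod a * Cmod b); [nra|].
rewrite Ea at 1; rewrite Eb at 1; rewrite cos_plus, sin_plus.
apply injective_projections; simpl; ring.
Qed.

Lemma has_angle_conj (a : C) (t : R) : has_angle a t -> has_angle (Cconj a) (- t).
Proof.
intros [Na Ea]; apply Cmod_gt_0 in Na.
apply has_angle_polar with (Cmod a); [exact Na|].
rewrite Ea at 1; rewrite cos_neg, sin_neg; unfold Cconj; simpl; f_equal; ring.
Qed.

Lemma has_angle_inv (a : C) (t : R) : has_angle a t -> has_angle (/ a)%C (- t).
Proof.
intros [Na Ea]; assert (Pa := proj1 (Cmod_gt_0 _) Na).
apply has_angle_polar with (/ Cmod a); [now apply Rinv_0_lt_compat|].
rewrite cos_neg, sin_neg.
set (b := (/ Cmod a * cos t, / Cmod a * - sin t) : C).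
assert (E : (a * b = 1)%C).
{ rewrite Ea at 1; assert (S := sin2_cos2 t); unfold Rsqr in S.
  apply injective_projections; simpl.
  - transitivity (sin t * sin t + cos t * cos t); [field; lra | exact S].
  - field; lra. }
transitivity (/ a * (a * b))%C; [rewrite E; ring | field; exact Na].
Qed.

Lemma unit_circle_angle (x y : R) : x * x + y * y = 1 -> exists t, x = cos t /\ y = sin t.
Proof.
intros H; assert (Hx : -1 <= x <= 1) by nra.
assert (Hs : sin (acos x) * sin (acos x) = y * y).
{ assert (S := sin2_cos2 (acos x)); unfold Rsqr in S; rewrite (cos_acos x Hx) in S; lra. }
assert (Hpos : 0 <= sin (acos x)).
{ destruct (acos_bound x); apply sin_ge_0; assumption. }
destruct (Rle_dec 0 y) as [Hy | Hy].
- exists (acos x); rewrite (cos_acos x Hx); split; [reflexivity | nra].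
- exists (- acos x); rewrite cos_neg, sin_neg, (cos_acos x Hx); split; [reflexivity | nra].
Qed.

Lemma has_angle_exists (a : C) : a <> RtoC 0 -> exists t, has_angle a t.
Proof.
intros Ha; assert (Pa := proj1 (Cmod_gt_0 _) Ha); assert (H := Cmod_sqr a).
destruct (unit_circle_angle (Re a / Cmod a) (Im a / Cmod a)) as [t [E1 E2]].
- transitivity ((Re a * Re a + Im a * Im a) / (Cmod a * Cmod a)); [field; lra|].
  rewrite <- H; field; lra.
- exists t; split; [exact Ha|]; rewrite <- E1, <- E2.
  apply injective_projections; unfold Re, Im; simpl; field; lra.
Qed.

(** The real part exceeds 1/2, so the arctangent of y / x is an angle of mu, and |y / x| < 2 |y|. *)
Lemma has_angle_near_1 (eps : R) : 0 < eps -> exists del, 0 < del /\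
  forall mu : C, Cmod (mu - 1)%C < del -> exists t, has_angle mu t /\ Rabs t < eps.
Proof.
intros He.
destruct (proj1 (filterlim_locally _ _) (continuous_atan 0) (mkposreal eps He)) as [e1 He1].
exists (Rmin (1 / 2) (e1 / 2)); split; [apply Rmin_pos; [lra | apply Rdiv_lt_0_compat;
  [apply cond_pos | lra]]|].
intros mu Hmu.
assert (H1 : Cmod (mu - 1)%C < 1 / 2) by (eapply Rlt_le_trans; [exact Hmu | apply Rmin_l]).
assert (H2 : Cmod (mu - 1)%C < e1 / 2) by (eapply Rlt_le_trans; [exact Hmu | apply Rmin_r]).
assert (HR := Rabs_Re_le (mu - 1)%C); assert (HI := Rabs_Im_le (mu - 1)%C).
set (x := Re mu); set (y := Im mu).
replace (Re (mu - 1)%C) with (x - 1) in HR by (unfold x, Re; simpl; ring).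
replace (Im (mu - 1)%C) with y in HI by (unfold y, Im; simpl; ring).
assert (Hx : 1 / 2 < x).
{ assert (H3 : Rabs (x - 1) < 1 / 2) by lra; apply Rabs_lt_between in H3; lra. }
exists (atan (y / x)); split.
- assert (Hc := cos_atan (y / x)); set (w := sqrt (1 + Rsqr (y / x))) in *.
  assert (Hw : 0 < w) by (apply sqrt_lt_R0; assert (H := Rle_0_sqr (y / x)); lra).
  apply has_angle_polar with (x * w); [nra|].
  assert (Ec : w * cos (atan (y / x)) = 1).
  { rewrite Hc; field; lra. }
  apply injective_projections; simpl.
  + fold (Re mu); fold x; rewrite Rmult_assoc, Ec; ring.
  + fold (Im mu); fold y; replace (sin (atan (y / x))) with (cos (atan (y / x)) * (y / x)).
    * transitivity (x * (w * cos (atan (y / x))) * (y / x)); [rewrite Ec; field; lra | ring].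
    * rewrite <- (tan_atan (y / x)) at 2; unfold tan; field.
      intros E; rewrite E in Ec; lra.
- assert (Hball : ball 0 e1 (y / x)).
  { change (Rabs (y / x - 0) < e1); rewrite Rminus_0_r; unfold Rdiv; rewrite Rabs_mult.
    rewrite (Rabs_right (/ x)) by (apply Rle_ge, Rlt_le, Rinv_0_lt_compat; lra).
    apply Rmult_lt_reg_r with x; [lra|]; rewrite Rmult_assoc, Rinv_l by lra.
    assert (H := cond_pos e1); nra. }
  assert (H := He1 _ Hball); change (Rabs (atan (y / x) - atan 0) < eps) in H.
  now rewrite atan_0, Rminus_0_r in H.
Qed.

Definition angle_eq (s t : R) : Prop := exists k : Z, t = s + IZR k * (PI / 4).

Lemma angle_eq_refl (s : R) : angle_eq s s.
Proof. exists 0%Z; simpl; ring. Qed.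

Lemma angle_eq_sym (s t : R) : angle_eq s t -> angle_eq t s.
Proof. intros [k ->]; exists (- k)%Z; rewrite opp_IZR; ring. Qed.

Lemma angle_eq_trans (s t u : R) : angle_eq s t -> angle_eq t u -> angle_eq s u.
Proof. intros [k ->] [l ->]; exists (k + l)%Z; rewrite plus_IZR; ring. Qed.

Lemma has_angle_unique (a : C) (s t : R) : has_angle a s -> has_angle a t -> angle_eq s t.
Proof.
intros [Na E1] [_ E2]; apply Cmod_gt_0 in Na.
rewrite E1 in E2 at 1; injection E2; intros Hs Hc.
apply Rmult_eq_reg_l in Hs; [|lra]; apply Rmult_eq_reg_l in Hc; [|lra].
assert (H : sin ((t - s) / 2) = 0).
{ assert (Hcos : cos (t - s) = 1).
  { rewrite cos_minus, <- Hs, <- Hc; assert (S := sin2_cos2 s); unfold Rsqr in S; lra. }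
  replace (t - s) with (2 * ((t - s) / 2)) in Hcos by field.
  rewrite cos_2a_sin in Hcos; nra. }
(* A multiple of 2 pi is eight times as many multiples of pi/4. *)
apply sin_eq_0_0 in H; destruct H as [k Hk]; exists (8 * k)%Z.
rewrite mult_IZR; lra.
Qed.

(** * The affine surface *)

Lemma calQ_iff (x y : R) : calQ (x, y) <-> 0 <= x /\ y <= 1 /\ x - 1 <= y.
Proof.
split.
- intros [b [c [d [Hb [Hc [Hd [Hs E]]]]]]]; injection E; simpl; intros; lra.
- intros H; exists ((1 - y) / 2), (x / 2), ((1 + y - x) / 2).
  repeat split; try lra.
  unfold ptB, ptC, ptD; apply injective_projections; simpl; field.
Qed.

Lemma segAB_iff (x y : R) : seg ptA ptB (x, y) <-> x = 0 /\ -1 <= y <= 0.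
Proof.
split.
- intros [l [Hl E]]; injection E; simpl; intros; lra.
- intros H; exists (- y); split; [lra|].
  unfold ptA, ptB; apply injective_projections; simpl; lra.
Qed.

Lemma segAD_iff (x y : R) : seg ptA ptD (x, y) <-> x = 0 /\ 0 <= y <= 1.
Proof.
split.
- intros [l [Hl E]]; injection E; simpl; intros; lra.
- intros H; exists y; split; [lra|].
  unfold ptA, ptD; apply injective_projections; simpl; lra.
Qed.

Lemma segBC_iff (x y : R) : seg ptB ptC (x, y) <-> y = x - 1 /\ 0 <= x <= 2.
Proof.
split.
- intros [l [Hl E]]; injection E; simpl; intros; lra.
- intros H; exists (x / 2); split; [lra|].
  unfold ptB, ptC; apply injective_projections; simpl; lra.
Qed.

Lemma segCD_iff (x y : R) : seg ptC ptD (x, y) <-> y = 1 /\ 0 <= x <= 2.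
Proof.
split.
- intros [l [Hl E]]; injection E; simpl; intros; lra.
- intros H; exists (1 - x / 2); split; [lra|].
  unfold ptC, ptD; apply injective_projections; simpl; lra.
Qed.

Lemma glueB_eq (x y : R) : glueB (x, y) = (2 * x + 2 * y + 2, 1 - 2 * x + 2 * y).
Proof. unfold glueB; apply injective_projections; simpl; ring. Qed.

Lemma glueD_eq (x y : R) : glueD (x, y) = (2 - 2 * y, 1 + 2 * x).
Proof. unfold glueD; apply injective_projections; simpl; ring. Qed.

Lemma near_nonneg (f : C -> R) (w : C) : continuous f w ->
  locally w (fun w' => 0 <= f w' -> 0 <= f w).
Proof.
intros Hf; destruct (Rle_dec 0 (f w)) as [H | H]; [now apply filter_forall|].
assert (Hl : locally (f w) (fun y => y < 0)) by (apply (open_lt 0); lra).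
eapply filter_imp; [|exact (Hf _ Hl)]; simpl; intros; lra.
Qed.

(** Closedness of [calQ], an intersection of three half-planes, in the form used for charts:
    membership of the affine image of a point close enough to w passes to the image of w. *)
Lemma near_calQ (alpha beta w : C) :
  locally w (fun w' => calQ (alpha * w' + beta)%C -> calQ (alpha * w + beta)%C).
Proof.
set (L := fun (a b c : R) (w : C) =>
  a * Re (alpha * w + beta)%C + b * Im (alpha * w + beta)%C + c).
assert (HL : forall a b c, continuous (L a b c) w).
{ intros a b c.
  apply continuous_ext with (fun z : C => plus (plus
    (scal (a * Re alpha + b * Im alpha) (fst z)) (scal (b * Re alpha - a * Im alpha) (snd z)))
    (a * Re beta + b * Im beta + c)).
  { intros [x y]; unfold L, Re, Im, plus, scal; simpl; unfold mult; simpl; ring. }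
  apply (continuous_plus (V := R_NormedModule)); [|apply continuous_const].
  apply (continuous_plus (V := R_NormedModule)).
  - apply (continuous_scal_r (V := R_NormedModule)), continuous_fst.
  - apply (continuous_scal_r (V := R_NormedModule)), continuous_snd. }
assert (H1 := near_nonneg _ w (HL 1 0 0)); assert (H2 := near_nonneg _ w (HL 0 (-1) 1)).
assert (H3 := near_nonneg _ w (HL (-1) 1 1)).
generalize (filter_and _ _ H1 (filter_and _ _ H2 H3)); apply filter_imp.
intros w' [K1 [K2 K3]]; unfold L in K1, K2, K3.
destruct (alpha * w' + beta)%C as [x' y'], (alpha * w + beta)%C as [x y].
rewrite !calQ_iff; unfold Re, Im in *; simpl in *; lra.
Qed.

(** What the change of charts needs to know about [glueB] and [glueD], so that it is carried out
    once for both. The angles, -pi/4 and pi/2, are the reason for working modulo pi/4;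
    [gluing_sides] says that [calQ] and its copy across the side meet only along that side. *)
Record gluing (G : C -> C) (S S' : C -> Prop) : Prop := {
  gluing_affine : exists kappa beta k, has_angle kappa (IZR k * (PI / 4)) /\
    forall w, G w = (kappa * w + beta)%C;
  gluing_sides : forall w, calQ w -> calQ (G w) -> S w /\ S' (G w);
  gluing_glued : forall w, S w -> glued w (G w);
  gluing_unfold : forall q u w, S q -> calQ u -> u = G w -> unfolds q w u;
  gluing_unfold' : forall q u w, S' q -> calQ u -> w = G u -> unfolds q w u
}.

Lemma gluing_B : gluing glueB (seg ptA ptB) (seg ptB ptC).
Proof.
split.
- exists (RtoC 2 - RtoC 2 * Ci)%C, ((RtoC 2 - RtoC 2 * Ci) * Ci - Ci)%C, (-1)%Z; split.
  + replace (IZR (-1) * (PI / 4)) with (- (PI / 4)) by (simpl; ring).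
    assert (H2 := sqrt_lt_R0 2 ltac:(lra)).
    apply has_angle_polar with (2 * sqrt 2); [lra|].
    rewrite cos_neg, sin_neg, cos_PI4, sin_PI4.
    apply injective_projections; simpl; field; lra.
  + intros w; unfold glueB; ring.
- intros [x y]; rewrite glueB_eq, !calQ_iff, segAB_iff, segBC_iff; lra.
- intros w Hw; left; split; trivial.
- intros q u w Hq Hu ->; split; trivial; right; left; auto.
- intros q u w Hq Hu ->; split; trivial; right; right; left; auto.
Qed.

Lemma gluing_D : gluing glueD (seg ptA ptD) (seg ptC ptD).
Proof.
split.
- exists (RtoC 2 * Ci)%C, (Ci - RtoC 2 * Ci * Ci)%C, 2%Z; split.
  + replace (IZR 2 * (PI / 4)) with (PI / 2) by (simpl; field).
    apply has_angle_polar with 2; [lra|]; rewrite cos_PI2, sin_PI2.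
    apply injective_projections; simpl; ring.
  + intros w; unfold glueD; ring.
- intros [x y]; rewrite glueD_eq, !calQ_iff, segAD_iff, segCD_iff; lra.
- intros w Hw; right; split; trivial.
- intros q u w Hq Hu ->; split; trivial; right; right; right; left; auto.
- intros q u w Hq Hu ->; split; trivial; right; right; right; right; auto.
Qed.

(** Sides meet only at the excluded vertices, so a regular point is interior or on a single side.
    There one gluing applies in one direction, forward on AB and AD, backward on BC and CD. *)
Lemma unfolds_cases (q : C) : regular q ->
  (forall w u, unfolds q w u -> u = w) \/
  exists G S S', gluing G S S' /\
    ((forall w u, unfolds q w u -> u = w \/ u = G w) \/
     (forall w u, unfolds q w u -> u = w \/ w = G u)).
Proof.
destruct q as [x y]; intros [HQ [NA [NB [NC ND]]]].
assert (NA' : ~ (x = 0 /\ y = 0)) by (intros [-> ->]; now apply NA).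
assert (NB' : ~ (x = 0 /\ y = -1)) by (intros [-> ->]; now apply NB).
assert (NC' : ~ (x = 2 /\ y = 1)) by (intros [-> ->]; now apply NC).
assert (ND' : ~ (x = 0 /\ y = 1)) by (intros [-> ->]; now apply ND).
apply calQ_iff in HQ.
unfold unfolds; setoid_rewrite segAB_iff; setoid_rewrite segBC_iff.
setoid_rewrite segAD_iff; setoid_rewrite segCD_iff.
destruct (Req_dec x 0) as [Hx | Hx].
- right; destruct (Rle_dec y 0) as [Hy | Hy].
  + exists glueB, (seg ptA ptB), (seg ptB ptC); split; [apply gluing_B|left].
    intros w u [_ [H | [[_ H] | [[H _] | [[H _] | [H _]]]]]]; try tauto;
    exfalso; solve [lra | apply NA'; lra | apply NB'; lra | apply NC'; lra | apply ND'; lra].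
  + exists glueD, (seg ptA ptD), (seg ptC ptD); split; [apply gluing_D|left].
    intros w u [_ [H | [[H _] | [[H _] | [[_ H] | [H _]]]]]]; try tauto;
    exfalso; solve [lra | apply NA'; lra | apply NB'; lra | apply NC'; lra | apply ND'; lra].
- destruct (Req_dec y 1) as [Hy | Hy].
  + right; exists glueD, (seg ptA ptD), (seg ptC ptD); split; [apply gluing_D|right].
    intros w u [_ [H | [[H _] | [[H _] | [[H _] | [_ H]]]]]]; try tauto;
    exfalso; solve [lra | apply NA'; lra | apply NB'; lra | apply NC'; lra | apply ND'; lra].
  + destruct (Req_dec y (x - 1)) as [Hxy | Hxy].
    * right; exists glueB, (seg ptA ptB), (seg ptB ptC); split; [apply gluing_B|right].
      intros w u [_ [H | [[H _] | [[_ H] | [[H _] | [H _]]]]]]; try tauto;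
    exfalso; solve [lra | apply NA'; lra | apply NB'; lra | apply NC'; lra | apply ND'; lra].
    * left; intros w u [_ [H | [[H _] | [[H _] | [[H _] | [H _]]]]]]; trivial; exfalso; lra.
Qed.

Lemma unfolds_refl (q w : C) : calQ w -> unfolds q w w.
Proof. intros H; split; auto. Qed.

Lemma unfolds_same_point (q w u u' : C) : regular q ->
  unfolds q w u -> unfolds q w u' -> same_point u u'.
Proof.
intros Hq Hu Hu'; assert (Qu := proj1 Hu); assert (Qu' := proj1 Hu').
destruct (unfolds_cases q Hq) as [H | [G [S [S' [HG [H | H]]]]]].
- rewrite (H _ _ Hu), (H _ _ Hu'); apply rst_refl.
- destruct (H _ _ Hu) as [-> | ->], (H _ _ Hu') as [-> | ->]; try apply rst_refl.
  + apply rst_step, (gluing_glued _ _ _ HG), (gluing_sides _ _ _ HG); assumption.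
  + apply rst_sym, rst_step, (gluing_glued _ _ _ HG), (gluing_sides _ _ _ HG); assumption.
- destruct (gluing_affine _ _ _ HG) as [kappa [beta [k [[Hk _] Ha]]]].
  destruct (H _ _ Hu) as [-> | E], (H _ _ Hu') as [-> | E']; try apply rst_refl.
  + rewrite E' in Qu |- *; apply rst_sym, rst_step, (gluing_glued _ _ _ HG).
    apply (gluing_sides _ _ _ HG); assumption.
  + rewrite E in Qu' |- *; apply rst_step, (gluing_glued _ _ _ HG).
    apply (gluing_sides _ _ _ HG); assumption.
  + replace u with u'; [apply rst_refl|].
    rewrite E in E'; rewrite !Ha in E'.
    transitivity (/ kappa * (kappa * u' + beta - beta))%C; [field; exact Hk|].
    rewrite <- E'; field; exact Hk.
Qed.

(* Change of affine chart, from the one centred at [q] to the one centred at a point [u] of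
   [calQ] represented in the former. *)
Lemma unfolds_transition (q w u : C) : regular q -> unfolds q w u ->
  exists kappa beta k, has_angle kappa (IZR k * (PI / 4)) /\ u = (kappa * w + beta)%C /\
    locally w (fun w' => forall u', unfolds q w' u' -> unfolds u (kappa * w' + beta)%C u').
Proof.
intros Hq Hu; assert (Qu := proj1 Hu).
assert (H1 : has_angle 1%C (IZR 0 * (PI / 4))).
{ rewrite Rmult_0_l; apply has_angle_polar with 1; [lra|].
  rewrite cos_0, sin_0; apply injective_projections; simpl; ring. }
assert (Hid : forall z : C, (1 * z + 0)%C = z) by (intros; ring).
destruct (unfolds_cases q Hq) as [H | [G [S [S' [HG H]]]]].
- exists 1%C, 0%C, 0%Z; rewrite Hid; split; [exact H1 | split; [now apply H|]].
  apply filter_forall; intros w' u' Hu'; rewrite Hid, <- (H _ _ Hu').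
  apply unfolds_refl, Hu'.
- destruct (gluing_affine _ _ _ HG) as [kappa [beta [k [Hk Ha]]]].
  assert (Nk := proj1 Hk).
  assert (Hside := gluing_sides _ _ _ HG).
  assert (Hinv : forall z, (/ kappa * z + - (/ kappa * beta))%C = (/ kappa * (z - beta))%C)
    by (intros; ring).
  assert (HinvG : forall z, (/ kappa * G z + - (/ kappa * beta))%C = z)
    by (intros z; rewrite Ha; field; exact Nk).
  assert (HGinv : forall z, G (/ kappa * z + - (/ kappa * beta))%C = z)
    by (intros z; rewrite Ha; field; exact Nk).
  (* When u comes from one rule and a nearby u' from the other, these facts show that both rules
     apply at w itself. Then [gluing_sides] puts u on a side, and the chart at u has the rule that
     produces u'. *)
  assert (NQ := near_calQ 1 0 w); rewrite Hid in NQ.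
  assert (NG := near_calQ kappa beta w); rewrite <- Ha in NG.
  assert (NI := near_calQ (/ kappa) (- (/ kappa * beta)) w).
  destruct H as [H | H].
  + destruct (H _ _ Hu) as [E | E].
    * exists 1%C, 0%C, 0%Z; rewrite Hid; split; [exact H1 | split; [exact E|]].
      revert NG; apply filter_imp; intros w' NG u' Hu'; rewrite Hid.
      assert (Qu' := proj1 Hu'); destruct (H _ _ Hu') as [-> | E'].
      -- now apply unfolds_refl.
      -- apply (gluing_unfold _ _ _ HG); trivial; subst u.
         apply Hside; trivial; apply NG; rewrite <- Ha, <- E'; exact Qu'.
    * exists kappa, beta, k; rewrite <- Ha; split; [exact Hk | split; [exact E|]].
      revert NQ; apply filter_imp; intros w' NQ u' Hu'; rewrite Hid in NQ; rewrite <- Ha.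
      assert (Qu' := proj1 Hu'); destruct (H _ _ Hu') as [-> | ->].
      -- apply (gluing_unfold' _ _ _ HG); trivial; subst u; apply Hside; auto.
      -- now apply unfolds_refl.
  + assert (Hk' := has_angle_inv _ _ Hk).
    replace (- (IZR k * (PI / 4))) with (IZR (- k) * (PI / 4)) in Hk' by (rewrite opp_IZR; ring).
    destruct (H _ _ Hu) as [E | E].
    * exists 1%C, 0%C, 0%Z; rewrite Hid; split; [exact H1 | split; [exact E|]].
      revert NI; apply filter_imp; intros w' NI u' Hu'; rewrite Hid.
      assert (Qu' := proj1 Hu'); destruct (H _ _ Hu') as [-> | E'].
      -- now apply unfolds_refl.
      -- apply (gluing_unfold' _ _ _ HG); trivial; subst u.
         rewrite E', HinvG in NI; assert (Qi := NI Qu').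
         rewrite <- (HGinv w); apply Hside; [exact Qi | rewrite HGinv; exact Qu].
    * exists (/ kappa)%C, (- (/ kappa * beta))%C, (- k)%Z; split; [exact Hk' | split].
      { now rewrite E, HinvG. }
      revert NQ; apply filter_imp; intros w' NQ u' Hu'; rewrite Hid in NQ.
      assert (Qu' := proj1 Hu'); destruct (H _ _ Hu') as [-> | ->].
      -- apply (gluing_unfold _ _ _ HG); trivial; [|now rewrite HGinv].
         apply Hside; trivial; rewrite <- E; auto.
      -- rewrite HinvG; now apply unfolds_refl.
Qed.

(* A representative off [AB] and [AD], unique in each class. *)
Definition normal_form (z : C) : C :=
  if Rlt_dec 0 (fst z) then z else if Rle_dec (snd z) 0 then glueB z else glueD z.

(** Two coincidences make the normal form well defined: both gluings send A to C, and a glued point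
    still on the line BD is a fixed point B or D. *)
Lemma same_point_normal_form (z w : C) : same_point z w -> normal_form z = normal_form w.
Proof.
intros H; induction H as [z w H | z | z w _ IH | z w v _ IH1 _ IH2]; try congruence.
destruct z as [x y]; unfold normal_form.
destruct H as [[H ->] | [H ->]]; [apply segAB_iff in H | apply segAD_iff in H];
destruct H as [-> H]; rewrite ?glueB_eq, ?glueD_eq; cbn [fst snd];
(destruct (Rlt_dec 0 0); [lra|]); destruct (Rle_dec y 0); try lra;
(destruct Rlt_dec; [f_equal; lra|]); destruct Rle_dec; try lra;
rewrite ?glueB_eq, ?glueD_eq; f_equal; lra.
Qed.

(** [same_point] allows chains of gluings; equality of normal forms reduces any chain to at most one
    gluing. *)
Lemma same_point_unfolds (q q' : C) : calQ q -> calQ q' -> same_point q q' -> unfolds q q q'.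
Proof.
intros Qq Qq' H; apply same_point_normal_form in H; split; [exact Qq'|].
destruct q as [x y], q' as [x' y']; revert H; unfold normal_form; cbn [fst snd].
rewrite !glueB_eq, !glueD_eq; apply calQ_iff in Qq, Qq'.
rewrite segAB_iff, segBC_iff, segAD_iff, segCD_iff, ?glueB_eq, ?glueD_eq.
assert (E : forall a b c d : R, (a, b) = (c, d) -> a = c /\ b = d)
  by (intros a b c d H; injection H; auto).
destruct (Rlt_dec 0 x), (Rlt_dec 0 x');
  try destruct (Rle_dec y 0); try destruct (Rle_dec y' 0);
  intros H; assert (H' := E _ _ _ _ H); try (exfalso; lra);
  first
  [ left; f_equal; lra
  | right; left; split; [lra | now symmetry]
  | right; right; left; split; [lra | exact H]
  | right; right; right; left; split; [lra | now symmetry]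
  | right; right; right; right; split; [lra | exact H] ].
Qed.

(** * The angle of a trajectory *)

Lemma norm_RC (z : C) : norm (K := R_AbsRing) (V := C_R_NormedModule) z = Cmod z.
Proof.
unfold norm; simpl; unfold prod_norm, Cmod, norm; simpl; unfold abs; simpl.
f_equal; rewrite !Rmult_1_r, <- !Rabs_mult, !Rabs_right; trivial; apply Rle_ge, Rle_0_sqr.
Qed.

(** A complex differential is in particular a real one, so the real chain rule applies; [norm_RC]
    and [locally_C] match the norms and neighbourhoods of the two structures on C. *)
Lemma is_derive_C_comp (F : C -> C) (c : R -> C) (t : R) (l a : C) :
  is_derive (K := C_AbsRing) (V := C_NormedModule) F (c t) l ->
  is_derive_RC c t a -> is_derive_RC (fun s => F (c s)) t (l * a)%C.
Proof.
intros [_ HF] Hc.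
assert (HFR : filterdiff (K := R_AbsRing) (U := C_R_NormedModule) (V := C_R_NormedModule)
  F (locally (c t)) (fun y => (y * l)%C)).
{ split.
  - split.
    + intros x y; unfold plus; simpl; change ((x + y) * l = x * l + y * l)%C; ring.
    + intros k x; apply injective_projections; unfold scal; simpl; unfold prod_scal, scal;
      simpl; unfold mult; simpl; ring.
    + exists (1 + Cmod l); split; [assert (H := Cmod_ge_0 l); lra|].
      intros x; rewrite !norm_RC, Cmod_mult; assert (H := Cmod_ge_0 x); nra.
  - intros x Hx; apply (is_filter_lim_locally_unique (V := C_R_NormedModule)) in Hx.
    rewrite <- Hx; intros eps.
    assert (H := HF (c t) (fun P HP => HP) eps).
    apply locally_C in H; revert H; apply filter_imp; intros y Hy.
    rewrite !norm_RC; exact Hy. }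
assert (H := filterdiff_comp' c F t _ _ Hc HFR).
split; [apply is_linear_scal_l|].
destruct H as [_ H]; intros x Hx; specialize (H x Hx); intros eps.
generalize (H eps); apply filter_imp; intros s Hs.
assert (E : forall k : R, scal (V := C_R_NormedModule) k (l * a)%C
  = (scal (V := C_R_NormedModule) k a * l)%C).
{ intros k; apply injective_projections; unfold scal; simpl; unfold prod_scal, scal;
  simpl; unfold mult; simpl; ring. }
cbv beta; rewrite E; exact Hs.
Qed.

Lemma is_derive_RC_conj (f : R -> C) (t : R) (l : C) :
  is_derive_RC f t l -> is_derive_RC (fun s => Cconj (f s)) t (Cconj l).
Proof.
intros [H1 H2]%is_derive_RC_iff; apply is_derive_RC_iff; split; [exact H1|].
exact (is_derive_opp _ _ _ H2).
Qed.

Lemma is_derive_RC_continuous (f : R -> C) (t : R) (l : C) :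
  is_derive_RC f t l -> filterlim f (locally t) (locally (f t)).
Proof.
intros H; apply (ex_derive_continuous (V := C_R_NormedModule) f); now exists l.
Qed.

Lemma locally_preimage {U V : UniformSpace} (f : U -> V) (x : U) (P : V -> Prop) :
  filterlim f (locally x) (locally (f x)) -> locally (f x) P -> locally x (fun y => P (f y)).
Proof. intros H HP; exact (H P HP). Qed.

(** * Velocities and angles on the identified surface *)

Section Identification.

Context (p : C -> Chat) (Hp : identification p).

Lemma chart_functional (q w z z' : C) : chart p q w z -> chart p q w z' -> z = z'.
Proof.
intros [Hq [u [Hu E]]] [_ [u' [Hu' E']]].
assert (H := unfolds_same_point q w u u' Hq Hu Hu').
apply (id_fibers p Hp) in H; [|apply Hu | apply Hu'].
rewrite E, E' in H; now injection H.
Qed.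

Lemma chart_center (q z : C) : chart p q q z -> p q = Some z.
Proof.
intros [Hq [u [Hu <-]]]; apply (id_fibers p Hp); [apply Hq | apply Hu|].
apply (unfolds_same_point q q); trivial; apply unfolds_refl, Hq.
Qed.

Lemma velocity_center (del : R -> C) (t : R) (q a : C) :
  velocity_in_Q p del t q a -> regular q /\ p q = Some (del t).
Proof.
intros [c [Ec [Hc _]]]; apply locally_singleton in Hc; rewrite Ec in Hc.
split; [apply Hc | now apply chart_center].
Qed.

(** The vertices have only the values 0, 1 and infinity, C being glued to A; off [calC], x / y
    avoids them. *)
Lemma regular_of_value (u z : C) : calQ u -> p u = Some z -> z <> RtoC 0 -> z <> RtoC 1 ->
  regular u.
Proof.
intros Hu E Z0 Z1.
assert (QA : calQ ptA) by (apply calQ_iff; lra).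
assert (QC : calQ ptC) by (apply calQ_iff; lra).
assert (EC : p ptA = p ptC).
{ apply (id_fibers p Hp); trivial; apply rst_step; left; split.
  - apply segAB_iff; lra.
  - unfold ptA, ptC; rewrite glueB_eq; f_equal; ring. }
rewrite (id_A p Hp) in EC.
split; [exact Hu | repeat split]; intros ->.
- rewrite (id_A p Hp) in E; injection E; congruence.
- rewrite (id_B p Hp) in E; injection E; congruence.
- rewrite <- EC in E; injection E; congruence.
- rewrite (id_D p Hp) in E; discriminate.
Qed.

(** The factor l is the derivative of the chart at its centre q. It is chosen before the curve, so
    velocities of two curves through the same point can be compared. *)
Lemma conformal_velocity :
  (forall q, regular q -> exists l, forall del t a d, velocity_in_Q p del t q a ->
     is_derive_RC del t d -> d = (l * a)%C) \/
  (forall q, regular q -> exists l, forall del t a d, velocity_in_Q p del t q a ->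
     is_derive_RC del t d -> Cconj d = (l * a)%C).
Proof.
assert (Hloc : forall F q del t a c, locally q (fun w => chart p q w (F w)) -> c t = q ->
  locally t (fun s => chart p q (c s) (del s)) -> is_derive_RC c t a ->
  locally t (fun s => F (c s) = del s)).
{ intros F q del t a c HF Ec Hc Hd.
  assert (Hcont := is_derive_RC_continuous _ _ _ Hd).
  rewrite <- Ec in HF.
  generalize (filter_and _ _ (locally_preimage c t _ Hcont HF) Hc); apply filter_imp.
  intros s [H1 H2]; rewrite Ec in H1; exact (chart_functional _ _ _ _ H1 H2). }
destruct (id_conformal p Hp) as [H | H]; [left | right]; intros q Hq;
destruct (H q Hq) as [F [l [HF Hl]]]; exists l; intros del t a d [c [Ec [Hc Hd]]] Hdel;
assert (E := Hloc F q del t a c HF Ec Hc Hd); rewrite <- Ec in Hl;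
assert (HFc := is_derive_C_comp _ c t l a Hl Hd).
- apply (is_derive_RC_unique del t d); [exact Hdel|].
  exact (is_derive_ext_loc _ _ _ _ E HFc).
- apply (is_derive_RC_unique (fun s => Cconj (del s)) t); [now apply is_derive_RC_conj|].
  refine (is_derive_ext_loc _ _ _ _ _ HFc).
  revert E; apply filter_imp; intros s E; now rewrite E.
Qed.

(** Changing the representative of the point multiplies the velocity by the linear part of a change
    of chart. *)
Lemma velocity_transport (del : R -> C) (t : R) (q q' a : C) : regular q' ->
  velocity_in_Q p del t q a -> p q' = Some (del t) ->
  exists kappa k, has_angle kappa (IZR k * (PI / 4)) /\
    velocity_in_Q p del t q' (kappa * a)%C.
Proof.
intros Hq' Hv E'; destruct (velocity_center _ _ _ _ Hv) as [Hq E].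
assert (Hs : same_point q q').
{ apply (id_fibers p Hp); [apply Hq | apply Hq' | congruence]. }
destruct (unfolds_transition q q q' Hq) as [kappa [beta [k [Hk [Eq' Htr]]]]].
{ apply same_point_unfolds; [apply Hq | apply Hq' | exact Hs]. }
exists kappa, k; split; [exact Hk|].
destruct Hv as [c [Ec [Hc Hd]]].
exists (fun s => kappa * c s + beta)%C; split; [now rewrite Ec|split].
- assert (Hcont := is_derive_RC_continuous _ _ _ Hd).
  rewrite <- Ec in Htr at 1.
  generalize (filter_and _ _ (locally_preimage c t _ Hcont Htr) Hc); apply filter_imp.
  intros s [H1 [_ [u [Hu Eu]]]]; split; [exact Hq'|]; exists u; split; [|exact Eu].
  now apply H1.
- evar_last.
  + apply is_derive_RC_plus; [apply is_derive_RC_cmult, Hd | apply is_derive_RC_const].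
  + simpl; ring.
Qed.

(* The sign records whether [p] preserves or reverses the orientation. *)
Lemma velocity_angles : exists sgn : R, forall del1 t1 q1 a1 d1 th1 del2 t2 q2 a2 th2 lam phi,
  velocity_in_Q p del1 t1 q1 a1 -> velocity_in_Q p del2 t2 q2 a2 ->
  is_derive_RC del1 t1 d1 -> is_derive_RC del2 t2 (lam * d1)%C -> d1 <> RtoC 0 ->
  del1 t1 = del2 t2 -> has_angle lam phi -> has_angle a1 th1 -> has_angle a2 th2 ->
  angle_eq (th1 + sgn * phi) th2.
Proof.
(* The computation common to both orientations: [lam'] is lam or its conjugate, and the unknown l
   cancels. *)
assert (Hgen : forall l kappa a1 a2 lam' d k th1 th2 psi,
  d <> RtoC 0 -> d = (l * (kappa * a1))%C -> (lam' * d = l * a2)%C ->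
  has_angle kappa (IZR k * (PI / 4)) -> has_angle lam' psi -> has_angle a1 th1 ->
  has_angle a2 th2 -> angle_eq (th1 + psi) th2).
{ intros l kappa a1 a2 lam' d k th1 th2 psi Hd E1 E2 Hk Hpsi H1 H2.
  assert (Hl : l <> RtoC 0) by (intros ->; apply Hd; rewrite E1; ring).
  assert (E : a2 = (lam' * (kappa * a1))%C).
  { transitivity (/ l * (l * a2))%C; [field; exact Hl|].
    rewrite <- E2, E1; field; exact Hl. }
  assert (H := has_angle_mult _ _ _ _ Hpsi (has_angle_mult _ _ _ _ Hk H1)).
  rewrite <- E in H; apply (has_angle_unique _ _ _ H) in H2.
  apply angle_eq_trans with (psi + (IZR k * (PI / 4) + th1)); [|exact H2].
  exists k; ring. }
destruct conformal_velocity as [H | H]; [exists 1 | exists (-1)];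
intros del1 t1 q1 a1 d1 th1 del2 t2 q2 a2 th2 lam phi V1 V2 D1 D2 Nd E Hlam H1 H2;
destruct (velocity_center _ _ _ _ V2) as [Hq2 E2];
destruct (velocity_transport del1 t1 q1 q2 a1 Hq2 V1) as [kappa [k [Hk V1']]];
try congruence; destruct (H q2 Hq2) as [l Hl];
assert (F1 := Hl _ _ _ _ V1' D1); assert (F2 := Hl _ _ _ _ V2 D2).
- rewrite Rmult_1_l; eapply Hgen; eauto.
- replace (-1 * phi) with (- phi) by ring; rewrite Cmult_conj in F2.
  apply (Hgen l kappa a1 a2 (Cconj lam) (Cconj d1) k); trivial; [|now apply has_angle_conj].
  intros Z; apply Nd; rewrite <- (Cconj_conj d1), Z; apply injective_projections; simpl; ring.
Qed.

Context (Hgeod : sends_trajectories_to_geodesics p).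

Definition angle_at (m : C * C) (th : R) : Prop :=
  exists I gam q a, trajectory I gam /\ I 0 /\ gam 0 = m /\
    velocity_in_Q p (fun t => g (gam t)) 0 q a /\ has_angle a th.

Lemma is_Rot_iff (m : C * C) (r : RZ) :
  is_Rot p m r <-> exists th, angle_at m th /\ is_rot_mod th r.
Proof.
split.
- intros [I [gam [q [a [th [H1 [H2 [H3 [H4 [H5 H6]]]]]]]]]].
  exists th; split; [|exact H6]; exists I, gam, q, a; auto.
- intros [th [[I [gam [q [a [H1 [H2 [H3 [H4 H5]]]]]]]] H6]].
  exists I, gam, q, a, th; repeat (split; [assumption|]); assumption.
Qed.

Lemma trajectory_off_calC (I : R -> Prop) (gam : R -> C * C) (t0 : R) :
  trajectory I gam -> I t0 -> ~ calC (gam t0) -> forall t, I t -> ~ calC (gam t).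
Proof. intros [Hs _] I0 H0 t It; now apply (calC_invariant I gam t0 t). Qed.

Lemma affine_velocity (del : R -> C) (t0 : R) (q a b : C) :
  (RtoC t0 * a + b)%C = q -> locally t0 (fun t => chart p q (RtoC t * a + b)%C (del t)) ->
  velocity_in_Q p del t0 q a.
Proof.
intros Eq Hc; exists (fun t => RtoC t * a + b)%C.
split; [exact Eq | split; [exact Hc | apply is_derive_RC_affine]].
Qed.

Lemma angle_at_exists (m : C * C) : ~ calC m -> exists th, angle_at m th.
Proof.
intros Hm; destruct (trajectory_exists m) as [I [gam [HT [I0 E]]]].
destruct (Hgeod I gam HT) as [[_ Harc] _].
{ apply (trajectory_off_calC I gam 0 HT I0); now rewrite E. }
destruct (Harc 0 I0) as [q [a [b [Na [Eq Hc]]]]].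
destruct (has_angle_exists a Na) as [th Hth].
exists th, I, gam, q, a; repeat (split; [assumption|]); split; [|exact Hth].
now apply (affine_velocity _ 0 q a b).
Qed.

(** The sign is fixed before m and lam, since comparisons at different points are later combined.
    The case lam = 1 is uniqueness of the angle modulo pi/4. *)
Lemma angle_at_scale : exists sgn : R, forall m lam phi th th', ~ calC m ->
  has_angle lam phi -> angle_at m th -> angle_at (lam * fst m, lam * snd m)%C th' ->
  angle_eq (th + sgn * phi) th'.
Proof.
destruct velocity_angles as [sgn H]; exists sgn.
intros m lam phi th th' Hm Hlam [I [gam [q [a [HT [I0 [E [V Ha]]]]]]]]
  [I' [gam' [q' [a' [HT' [I0' [E' [V' Ha']]]]]]]].
assert (Hy : snd m <> RtoC 0) by (intros Z; apply Hm; right; right; exact Z).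
assert (Nl := proj1 Hlam).
assert (Hm' := calC_scale lam m Nl Hm).
refine (H _ _ _ _ (g_speed m) _ _ _ _ _ _ _ _ V V' _ _ (g_speed_neq_0 m Hm) _ Hlam Ha Ha').
- rewrite <- E; apply (is_derive_g I); trivial; [apply HT | now rewrite E].
- rewrite <- g_speed_scale by assumption; rewrite <- E'.
  apply (is_derive_g I'); trivial; [apply HT'|].
  rewrite E'; intros Z; apply Hm'; right; right; exact Z.
- cbv beta; rewrite E, E'; symmetry; now apply g_scale.
Qed.

Lemma angle_at_unique (m : C * C) (th th' : R) : ~ calC m ->
  angle_at m th -> angle_at m th' -> angle_eq th th'.
Proof.
intros Hm H H'; destruct angle_at_scale as [sgn Hs].
assert (H1 : has_angle 1%C 0).
{ apply has_angle_polar with 1; [lra|].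
  rewrite cos_0, sin_0; apply injective_projections; simpl; ring. }
assert (E : (1 * fst m, 1 * snd m)%C = m) by (destruct m; simpl; f_equal; ring).
rewrite <- E in H'; assert (K := Hs m 1%C 0 th th' Hm H1 H H').
now rewrite Rmult_0_r, Rplus_0_r in K.
Qed.

(** Connectedness of an interval obtained by calculus: the indicator function of P has derivative
    zero on I. *)
Lemma locally_constant (I : R -> Prop) (P : R -> Prop) (s t : R) : open_interval I ->
  (forall u, I u -> locally u (fun v => P v <-> P u)) -> I s -> I t -> P s -> P t.
Proof.
intros [_ HI] HP Is It Ps.
set (f := fun u => if excluded_middle_informative (P u) then 1 else 0).
assert (Hf : forall u, I u -> is_derive f u zero).
{ intros u Iu; apply is_derive_ext_loc with (fun _ => f u).
  - generalize (HP u Iu); apply filter_imp; intros v Hv; unfold f.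
    destruct (excluded_middle_informative (P u)), (excluded_middle_informative (P v)); tauto.
  - apply (is_derive_const (K := R_AbsRing) (V := R_NormedModule)). }
assert (E : f s = f t).
{ destruct (total_order_T s t) as [[H | ->] | H]; [| reflexivity | symmetry];
  apply (eq_is_derive (V := R_NormedModule)); trivial; intros u Hu; apply Hf.
  - now apply (HI s u t).
  - now apply (HI t u s). }
unfold f in E; destruct (excluded_middle_informative (P s)); [|contradiction].
destruct (excluded_middle_informative (P t)); [assumption | exfalso; lra].
Qed.

Lemma angle_at_trajectory (I : R -> Prop) (gam : R -> C * C) (t th : R) (q a : C) :
  trajectory I gam -> I t -> velocity_in_Q p (fun s => g (gam s)) t q a -> has_angle a th ->
  angle_at (gam t) th.
Proof.
intros HT It [c [Ec [Hc Hd]]] Ha.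
exists (fun s => I (s + t)), (fun s => gam (s + t)), q, a.
split; [now apply trajectory_shift|]; rewrite Rplus_0_l; split; [exact It|].
split; [reflexivity | split; [|exact Ha]].
exists (fun s => c (s + t)); rewrite Rplus_0_l; split; [exact Ec | split].
- assert (Hcont : continuous (fun s : R => s + t) 0)
    by (apply (ex_derive_continuous (fun s : R => s + t)); auto_derive; trivial).
  unfold continuous in Hcont; rewrite Rplus_0_l in Hcont.
  exact (Hcont _ Hc).
- apply is_derive_RC_shift; now rewrite Rplus_0_l.
Qed.

Lemma angle_at_constant (I : R -> Prop) (gam : R -> C * C) (s t th th' : R) :
  trajectory I gam -> I s -> I t -> ~ calC (gam s) ->
  angle_at (gam s) th -> angle_at (gam t) th' -> angle_eq th th'.
Proof.
intros HT Is It Hs Hth Hth'.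
assert (Hoff := trajectory_off_calC I gam s HT Is Hs).
destruct (Hgeod I gam HT Hoff) as [[HI Harc] _].
assert (HP : forall u, I u -> locally u (fun v =>
  (exists th1, angle_at (gam v) th1 /\ angle_eq th th1) <->
  (exists th1, angle_at (gam u) th1 /\ angle_eq th th1))).
{ intros u Iu; destruct (Harc u Iu) as [q [a [b [Na [Eq Hc]]]]].
  destruct (has_angle_exists a Na) as [th0 Hth0].
  assert (Hu : angle_at (gam u) th0).
  { apply (angle_at_trajectory I gam u th0 q a); trivial.
    now apply (affine_velocity _ u q a b). }
  assert (Hnear : locally u (fun v => exists th1, angle_at (gam v) th1 /\ angle_eq th0 th1)).
  { generalize (filter_and _ _ (proj1 HI u Iu) (locally_locally _ _ Hc)); apply filter_imp.
    intros v [Iv Hv]; assert (Hcv := locally_singleton _ _ Hv).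
    destruct Hcv as [Hq [w [Hw Ew]]].
    (* The representative of the point at time v is w, not the centre q. After the change of chart
       to w the geodesic is still affine, with its direction turned by a multiple of pi/4. *)
    destruct (unfolds_transition q _ w Hq Hw) as [kappa [beta [k [Hk [Ekw Htr]]]]].
    assert (Hmv := Hoff v Iv).
    assert (Hy : snd (gam v) <> RtoC 0) by (intros Z; apply Hmv; right; right; exact Z).
    assert (Hw' : regular w).
    { apply (regular_of_value w (g (gam v))); trivial; [apply Hw| |]; unfold g; intros Z.
      - apply Hmv; left; transitivity (fst (gam v) / snd (gam v) * snd (gam v))%C;
        [field; exact Hy | rewrite Z; ring].
      - apply Hmv; right; left; transitivity (fst (gam v) / snd (gam v) * snd (gam v))%C;
        [field; exact Hy | rewrite Z; ring]. }
    exists (IZR k * (PI / 4) + th0); split; [|exists k; ring].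
    apply (angle_at_trajectory I gam v _ w (kappa * a)%C); trivial;
    [|now apply has_angle_mult].
    exists (fun r => kappa * (RtoC r * a + b) + beta)%C; split; [now symmetry | split].
    - assert (Hcont := is_derive_RC_continuous _ _ _ (is_derive_RC_affine a b v)).
      generalize (filter_and _ _ (locally_preimage _ v _ Hcont Htr) Hv); apply filter_imp.
      intros r [K1 [_ [w' [K2 K3]]]]; split; [exact Hw'|]; exists w'; split; auto.
    - evar_last.
      + apply is_derive_RC_plus; [apply is_derive_RC_cmult, is_derive_RC_affine |
          apply is_derive_RC_const].
      + simpl; ring. }
  generalize (filter_and _ _ (proj1 HI u Iu) Hnear); apply filter_imp.
  intros v [Iv [th1 [H1 E1]]]; split.
  - intros [th2 [H2 E2]]; exists th0; split; [exact Hu|].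
    apply angle_eq_trans with th2; [exact E2|].
    apply angle_eq_trans with th1; [|now apply angle_eq_sym].
    apply (angle_at_unique (gam v)); auto.
  - intros [th2 [H2 E2]]; exists th1; split; [exact H1|].
    apply angle_eq_trans with th2; [exact E2|].
    apply angle_eq_trans with th0; [|exact E1].
    apply (angle_at_unique (gam u)); auto. }
destruct (locally_constant I _ s t HI HP Is It) as [th1 [H1 E1]].
- exists th; split; [exact Hth | apply angle_eq_refl].
- apply angle_eq_trans with th1; [exact E1|].
  apply (angle_at_unique (gam t)); auto.
Qed.

Lemma angle_at_continuous (m0 : C * C) (eps : R) : ~ calC m0 -> 0 < eps ->
  exists del, 0 < del /\ forall m1 : C * C, ~ calC m1 ->
  Cmod (fst m1 - fst m0)%C <= del -> Cmod (snd m1 - snd m0)%C <= del ->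
  forall th0 th1, angle_at m0 th0 -> angle_at m1 th1 ->
  exists th, angle_eq th1 th /\ Rabs (th - th0) < eps.
Proof.
intros Hm0 He; destruct angle_at_scale as [sgn Hscale].
(* Nothing is known here about the size of [sgn], hence the division by |sgn| + 1. *)
set (eps' := eps / (Rabs sgn + 1)); assert (Psgn := Rabs_pos sgn).
assert (He' : 0 < eps') by (unfold eps'; apply Rdiv_lt_0_compat; lra).
destruct (has_angle_near_1 eps' He') as [d1 [Pd1 Hd1]].
destruct (trajectory_connect m0 d1 Hm0 Pd1) as [del [Pdel Hdel]].
exists del; split; [exact Pdel|]; intros m1 Hm1 Hx Hy th0 th1 H0 H1.
destruct (Hdel m1 Hx Hy) as [s [mu [Hmu Hcase]]].
destruct (Hd1 mu Hmu) as [phi [Hphi Bphi]].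
assert (Hm1' := calC_scale mu m1 (proj1 Hphi) Hm1).
(* Five angles are compared: at m0 and s m0, along the trajectory from s m0 to s mu m1, then at mu
   m1 and m1. The contribution of s, which need not be small, occurs at both ends of the trajectory
   and cancels; only that of mu remains. *)
assert (Key : angle_eq (th1 + sgn * phi) th0).
{ destruct Hcase as [[_ E] | [Ns [J [gam [HJ [J0 [J1 [E0 E1]]]]]]]].
  - rewrite E in H0; exact (Hscale m1 mu phi th1 th0 Hm1 Hphi H1 H0).
  - destruct (trajectory_extending J gam HJ J0) as [I [gam' [HT Hext]]].
    destruct (Hext 0 J0) as [I0 E0']; destruct (Hext 1 J1) as [I1 E1'].
    rewrite E0 in E0'; rewrite E1 in E1'.
    destruct (has_angle_exists s Ns) as [psi Hpsi].
    assert (Hs0 := calC_scale s m0 Ns Hm0).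
    assert (Hs1 := calC_scale s _ Ns Hm1'); cbn [fst snd] in Hs1.
    destruct (angle_at_exists _ Hs0) as [al0 A0]; destruct (angle_at_exists _ Hs1) as [al1 A1].
    destruct (angle_at_exists _ Hm1') as [th2 H2].
    assert (K1 := Hscale m0 s psi th0 al0 Hm0 Hpsi H0 A0).
    assert (K2 := Hscale _ s psi th2 al1 Hm1' Hpsi H2 A1).
    assert (K3 := Hscale m1 mu phi th1 th2 Hm1 Hphi H1 H2).
    assert (K4 : angle_eq al0 al1).
    { apply (angle_at_constant I gam' 0 1); trivial; rewrite ?E0', ?E1'; trivial. }
    destruct K1 as [k1 K1], K2 as [k2 K2], K3 as [k3 K3], K4 as [k4 K4].
    exists (k3 + k2 - k4 - k1)%Z; rewrite !minus_IZR, plus_IZR; lra. }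
exists (th0 - sgn * phi); split.
- destruct Key as [k Key]; exists k; lra.
- replace (th0 - sgn * phi - th0) with (- (sgn * phi)) by ring.
  rewrite Rabs_Ropp, Rabs_mult.
  assert (E : eps = (Rabs sgn + 1) * eps') by (unfold eps'; field; lra).
  rewrite E; assert (P := Rabs_pos phi); nra.
Qed.

End Identification.

Lemma is_rot_mod_angle_eq (s t : R) (r : RZ) : angle_eq s t -> is_rot_mod s r -> is_rot_mod t r.
Proof. intros [k ->]; apply is_rot_mod_shift. Qed.

Theorem mainTheorem2 :
  forall p : C -> Chat,
    identification p ->
    sends_trajectories_to_geodesics p ->
    exists Rot : C * C -> RZ,
      (forall m : C * C, ~ calC m ->
         forall rho : RZ, is_Rot p m rho <-> rho = Rot m) /\
      continuous_on (fun m : C * C => ~ calC m) Rot /\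
      (forall (I : R -> Prop) (gam : R -> C * C), trajectory I gam ->
         forall t1 t2 : R, I t1 -> I t2 ->
           ~ calC (gam t1) -> ~ calC (gam t2) ->
           Rot (gam t1) = Rot (gam t2)).
Proof.
intros p Hp Hgeod.
(* Off [calC] the value is shown below to exist and to be unique; on [calC] the choice is
   arbitrary. *)
set (Rot := fun m => epsilon (inhabits (class_mod1 0)) (is_Rot p m)).
assert (Huniq : forall m, ~ calC m -> forall th r r', angle_at p m th -> is_rot_mod th r ->
  is_Rot p m r' -> r' = r).
{ intros m Hm th r r' Hth Hr [th' [Hth' Hr']]%is_Rot_iff.
  apply (is_rot_mod_unique th); [|exact Hr].
  apply (is_rot_mod_angle_eq th'); [|exact Hr'].
  now apply (angle_at_unique p Hp m). }
assert (HRot : forall m, ~ calC m -> is_Rot p m (Rot m)).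
{ intros m Hm; apply epsilon_spec.
  destruct (angle_at_exists p Hgeod m Hm) as [th Hth].
  destruct (is_rot_mod_exists th) as [r Hr].
  exists r; apply is_Rot_iff; exists th; auto. }
assert (Hval : forall m th, ~ calC m -> angle_at p m th -> is_rot_mod th (Rot m)).
{ intros m th Hm Hth; destruct (is_rot_mod_exists th) as [r Hr].
  now rewrite (Huniq m Hm th r (Rot m) Hth Hr (HRot m Hm)). }
exists Rot; split; [|split].
- intros m Hm r; split; [|intros ->; now apply HRot].
  intros Hr; destruct (angle_at_exists p Hgeod m Hm) as [th Hth].
  apply (Huniq m Hm th); auto.
- intros m0 Hm0; apply filterlim_locally; intros eps.
  destruct (is_rot_mod_uniform eps (cond_pos eps)) as [eta [Peta Heta]].
  destruct (angle_at_continuous p Hp Hgeod m0 eta Hm0 Peta) as [del [Pdel Hdel]].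
  (* Balls of C are taken coordinatewise: radius del / 2 keeps the modulus below del. *)
  assert (Pd2 : 0 < del / 2) by lra.
  exists (mkposreal _ Pd2); intros m1 Hball Hm1.
  assert (Hb : forall z w : C, ball z (del / 2) w -> Cmod (w - z)%C <= del).
  { intros [a b] [c d] [H1 H2]; change (Rabs (c - a) < del / 2) in H1.
    change (Rabs (d - b) < del / 2) in H2.
    eapply Rle_trans; [apply Cmod_le_Re_Im|]; unfold Re, Im, Rminus in *; simpl; lra. }
  destruct Hball as [Hx Hy].
  destruct (angle_at_exists p Hgeod m0 Hm0) as [th0 H0].
  destruct (angle_at_exists p Hgeod m1 Hm1) as [th1 H1].
  destruct (Hdel m1 Hm1 (Hb _ _ Hx) (Hb _ _ Hy) th0 th1 H0 H1) as [th [Eth Bth]].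
  apply (Heta th0 th); [now apply Hval | | exact Bth].
  apply (is_rot_mod_angle_eq th1); [exact Eth | now apply Hval].
- intros I gam HT t1 t2 I1 I2 N1 N2.
  destruct (angle_at_exists p Hgeod _ N1) as [th1 H1].
  destruct (angle_at_exists p Hgeod _ N2) as [th2 H2].
  apply (is_rot_mod_unique th2); [|now apply Hval].
  apply (is_rot_mod_angle_eq th1); [|now apply Hval].
  now apply (angle_at_constant p Hp Hgeod I gam t1 t2).
Qed.
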